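(* Let $G$ be the Lie group $SU(2)$ equipped with a left-invariant Riemannian metric $\langle\cdot,\cdot\rangle$, and let $\{e_1,e_2,e_3\}$ be an orthonormal basis of its Lie algebra satisfying $[e_2,e_3]=\lambda_1 e_1$, $[e_3,e_1]=\lambda_2 e_2$, $[e_1,e_2]=\lambda_3 e_3$, with strictly positive constants $\lambda_1\ge\lambda_2\ge\lambda_3$. Let $V=xe_1+ye_2+ze_3$ ($x,y,z\in\mathbb{R}$, $x^2+y^2+z^2=1$) denote a left-invariant unit vector field. (a) If $\lambda_1=\lambda_2=\lambda_3>0$, then every left-invariant unit vector field is a biharmonic unit section. (b) If $\lambda_1=\lambda_2>\lambda_3$, then $V$ is a non-harmonic biharmonic unit section (i.e. a biharmonic unit section that is not a harmonic unit section) if and only if its coordinates lie on one of the circles $\{z=\tfrac{1}{\sqrt2},\ x^2+y^2=\tfrac12\}$ and $\{z=-\tfrac{1}{\sqrt2},\ x^2+y^2=\tfrac12\}$. (c) If $\lambda_1>\lambda_2=\lambda_3$, then $V$ is a non-harmonic biharmonic unit section if and only if its coordinates lie on one of the circles $\{x=\tfrac{1}{\sqrt2},\ y^2+z^2=\tfrac12\}$ and $\{x=-\tfrac{1}{\sqrt2},\ y^2+z^2=\tfrac12\}$. (d) If $\lambda_1>\lambda_2>\lambda_3$, then the only left-invariant non-harmonic biharmonic unit sections are $\pm\tfrac{1}{\sqrt2}e_2\pm\tfrac{1}{\sqrt2}e_3$, $\pm\tfrac{1}{\sqrt2}e_1\pm\tfrac{1}{\sqrt2}e_3$, $\pm\tfrac{1}{\sqrt2}e_1\pm\tfrac{1}{\sqrt2}e_2$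 (all choices of signs). Furthermore, a left-invariant unit vector field is a biharmonic unit section if and only if it is a biharmonic unit vector field.
   Context: Let $(M,g)$ be a compact $m$-dimensional Riemannian manifold with Levi-Civita connection $\nabla$ and curvature $R(X,Y)Z=\nabla_X\nabla_YZ-\nabla_Y\nabla_XZ-\nabla_{[X,Y]}Z$. For a local orthonormal frame $\{e_i\}$ and a smooth unit vector field $V$ set $\bar\Delta V=\sum_i(\nabla_{\nabla_{e_i}e_i}V-\nabla_{e_i}\nabla_{e_i}V)$ and $S(V)=\sum_iR(\nabla_{e_i}V,V)e_i$. Define the vertical energy $E_1^v(V)=\frac12\int_M\|\nabla V\|^2v_g$, the bienergy $E_2(V)=\frac12\int_M\{g(S(V),S(V))+g(\bar\Delta V,\bar\Delta V)-g(\bar\Delta V,V)^2\}v_g$ and the vertical bienergy $E_2^v(V)=\frac12\int_M\{g(\bar\Delta V,\bar\Delta V)-g(\bar\Delta V,V)^2\}v_g$. A unit vector field $V$ is a harmonic unit section (resp. biharmonic unit vector field, biharmonic unit section) if it is a critical point of $E_1^v$ (resp. $E_2$, $E_2^v$) with respect to all smooth variations of $V$ through unit vector fields (not necessarily left-invariant ones). $V$ is a harmonic unit section if and only if $\bar\Delta V$ is (pointwise) collinear to $V$. *)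

(* Defs.v *)
From HB Require Import structures.
From mathcomp Require Import all_boot all_order all_algebra.
From mathcomp Require Import complex ring.
From mathcomp Require Import all_classical all_reals all_analysis.

Set Implicit Arguments.
Unset Strict Implicit.
Unset Printing Implicit Defensive.

Import Order.TTheory GRing.Theory Num.Theory.
Import numFieldNormedType.Exports.
Local Open Scope classical_set_scope.
Local Open Scope ring_scope.

(* The group SU(2), as the group of unit quaternions inside R^4.  The real
   algebra isomorphism [qmx] below sends a quaternion q to the matrix
     [   q0 + i q1   q2 + i q3 ]
     [ - q2 + i q3   q0 - i q1 ]
   and identifies the unit sphere with the special unitary 2 x 2 matrices
   (lemmas [qmxM], [qmx_inj], [special_unitaryP]).  The Lie algebra is the
   space of imaginary quaternions, coordinatised by R^3. *)
Section Quaternions.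
Variable R : realType.
Implicit Types (p q u v : 'rV[R]_4) (a b : 'rV[R]_3).

Definition quat (x0 x1 x2 x3 : R) : 'rV[R]_4 :=
  \row_(i < 4) [:: x0; x1; x2; x3]`_i.

Definition vec3 (x1 x2 x3 : R) : 'rV[R]_3 := \row_(i < 3) [:: x1; x2; x3]`_i.

Definition qmul p q : 'rV[R]_4 :=
  quat (p 0 0 * q 0 0 - p 0 1 * q 0 1 - p 0 2 * q 0 2 - p 0 3 * q 0 3)
       (p 0 0 * q 0 1 + p 0 1 * q 0 0 + p 0 2 * q 0 3 - p 0 3 * q 0 2)
       (p 0 0 * q 0 2 - p 0 1 * q 0 3 + p 0 2 * q 0 0 + p 0 3 * q 0 1)
       (p 0 0 * q 0 3 + p 0 1 * q 0 2 - p 0 2 * q 0 1 + p 0 3 * q 0 0).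

Definition qconj q : 'rV[R]_4 := quat (q 0 0) (- q 0 1) (- q 0 2) (- q 0 3).

Definition imq a : 'rV[R]_4 := quat 0 (a 0 0) (a 0 1) (a 0 2).
Definition vecq q : 'rV[R]_3 := vec3 (q 0 1) (q 0 2) (q 0 3).

Definition SU2 : set 'rV[R]_4 := [set p | \sum_i p 0 i ^+ 2 = 1].

Definition tangent p v : Prop := \sum_i p 0 i * v 0 i = 0.

Definition lie a b : 'rV[R]_3 :=
  vecq (qmul (imq a) (imq b) - qmul (imq b) (imq a)).

(* The left-invariant vector field p |-> d(L_p)(a). *)
Definition left_field a : 'rV[R]_4 -> 'rV[R]_4 := fun p => qmul p (imq a).

Definition inner_product (ip : 'rV[R]_3 -> 'rV[R]_3 -> R) : Prop :=
  [/\ forall a b, ip a b = ip b a,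
      forall (c : R) a a' b, ip (c *: a + a') b = c * ip a b + ip a' b
    & forall a, a != 0 -> 0 < ip a a].

(* The left-invariant metric g_p(u, v) = ip (p^-1 u) (p^-1 v); on SU(2) the
   inverse is the conjugate. *)
Definition left_metric (ip : 'rV[R]_3 -> 'rV[R]_3 -> R) p u v : R :=
  ip (vecq (qmul (qconj p) u)) (vecq (qmul (qconj p) v)).

Definition qmx q : 'M[R[i]]_2 :=
  \matrix_(i < 2, j < 2)
    (if i == 0 then
       if j == 0 then Complex (q 0 0) (q 0 1) else Complex (q 0 2) (q 0 3)
     else
       if j == 0 then Complex (- q 0 2) (q 0 3)
       else Complex (q 0 0) (- q 0 1)).

Definition special_unitary (A : 'M[R[i]]_2) : Prop :=
  A *m (map_mx (@conjc R) A)^T = 1%:M /\ \det A = 1.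

End Quaternions.

(* C^k on an open subset of a finite-dimensional space. *)
Fixpoint Ck_on (R : realType) (E F : normedModType R) (U : set E) (k : nat)
    (f : E -> F) : Prop :=
  match k with
  | 0 => forall p, U p -> {for p, continuous f}
  | k'.+1 => (forall p, U p -> differentiable f p) /\
             (forall v, Ck_on U k' (fun p => 'D_v f p))
  end.

Definition smooth_on (R : realType) (E F : normedModType R) (U : set E)
    (f : E -> F) : Prop := forall k, Ck_on U k f.

(* Riemannian geometry on SU(2).  As SU(2) is closed in R^4, its smooth
   functions and vector fields are the restrictions of the smooth maps on R^4;
   we work with such extensions and only ever compare values on SU(2).  The
   derivative of a function along a vector field, the bracket and the
   connection, evaluated on SU(2), depend only on the restrictions. *)
Section Geometry.
Variable R : realType.
Local Notation H := 'rV[R]_4.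
Implicit Types (f : H -> R) (X Y Z V : H -> H).

Definition vfield X : Prop :=
  smooth_on setT X /\ forall p, SU2 p -> tangent p (X p).

Definition bracket X Y : H -> H := fun p => 'D_(X p) Y p - 'D_(Y p) X p.

Variable g : H -> H -> H -> R.

Definition unit_vfield V : Prop :=
  vfield V /\ forall p, SU2 p -> g p (V p) (V p) = 1.

Definition levi_civita (nabla : (H -> H) -> (H -> H) -> H -> H) : Prop :=
  [/\ forall X Y, vfield X -> vfield Y -> vfield (nabla X Y),
      forall f X Y Z, smooth_on setT f -> vfield X -> vfield Y -> vfield Z ->
        forall p, SU2 p ->
        nabla (fun q => f q *: X q + Y q) Z p = f p *: nabla X Z p + nabla Y Z p,
      forall f X Y Z, smooth_on setT f -> vfield X -> vfield Y -> vfield Z ->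
        forall p, SU2 p ->
        nabla X (fun q => f q *: Y q + Z q) p =
          'D_(X p) f p *: Y p + f p *: nabla X Y p + nabla X Z p,
      forall X Y, vfield X -> vfield Y -> forall p, SU2 p ->
        nabla X Y p - nabla Y X p = bracket X Y p
    & forall X Y Z, vfield X -> vfield Y -> vfield Z -> forall p, SU2 p ->
        'D_(X p) (fun q => g q (Y q) (Z q)) p =
          g p (nabla X Y p) (Z p) + g p (Y p) (nabla X Z p)].

(* Hopf coordinates (eta, alpha, beta): a parametrisation of SU(2) by the box
   [0, pi/2] x [0, 2 pi] x [0, 2 pi], injective and immersive in the interior,
   which misses only a null set. *)
Definition hopf (u : 'rV[R]_3) : H :=
  quat (cos (u 0 0) * cos (u 0 1)) (cos (u 0 0) * sin (u 0 1))
       (sin (u 0 0) * cos (u 0 2)) (sin (u 0 0) * sin (u 0 2)).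

Definition gram (u : 'rV[R]_3) : 'M[R]_3 :=
  \matrix_(i < 3, j < 3)
    g (hopf u) ('D_(delta_mx 0 i) hopf u) ('D_(delta_mx 0 j) hopf u).

Definition integral_vol f : R :=
  Rintegral lebesgue_measure `[0, pi / 2] (fun eta =>
    Rintegral lebesgue_measure `[0, 2 * pi] (fun alpha =>
      Rintegral lebesgue_measure `[0, 2 * pi] (fun beta =>
        let u := vec3 eta alpha beta in
        f (hopf u) * Num.sqrt (\det (gram u))))).

Variables (nabla : (H -> H) -> (H -> H) -> H -> H) (E : 'I_3 -> H -> H).

Definition curv X Y Z : H -> H := fun p =>
  nabla X (nabla Y Z) p - nabla Y (nabla X Z) p - nabla (bracket X Y) Z p.

Definition rough_laplacian V : H -> H := fun p =>
  \sum_(i < 3) (nabla (nabla (E i) (E i)) V p - nabla (E i) (nabla (E i) V) p).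

Definition Sfield V : H -> H := fun p =>
  \sum_(i < 3) curv (nabla (E i) V) V (E i) p.

Definition vertical_energy V : R :=
  2^-1 * integral_vol (fun p =>
    \sum_(i < 3) g p (nabla (E i) V p) (nabla (E i) V p)).

Definition bienergy V : R :=
  2^-1 * integral_vol (fun p =>
    g p (Sfield V p) (Sfield V p)
    + g p (rough_laplacian V p) (rough_laplacian V p)
    - g p (rough_laplacian V p) (V p) ^+ 2).

Definition vertical_bienergy V : R :=
  2^-1 * integral_vol (fun p =>
    g p (rough_laplacian V p) (rough_laplacian V p)
    - g p (rough_laplacian V p) (V p) ^+ 2).

Definition unit_variation V (eps : R) (W : R -> H -> H) : Prop :=
  [/\ smooth_on [set s : R^o * H | `|s.1| < eps] (fun s => W s.1 s.2),
      forall t, `|t| < eps -> unit_vfield (W t)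
    & forall p, SU2 p -> W 0 p = V p].

Definition critical (F : (H -> H) -> R) V : Prop :=
  unit_vfield V /\
  forall (eps : R) W, 0 < eps -> unit_variation V eps W ->
    is_derive (0 : R) (1 : R) (fun t => F (W t)) 0.

Definition harmonic_unit_section V : Prop := critical vertical_energy V.
Definition biharmonic_unit_vfield V : Prop := critical bienergy V.
Definition biharmonic_unit_section V : Prop := critical vertical_bienergy V.

Definition nonharmonic_biharmonic_unit_section V : Prop :=
  biharmonic_unit_section V /\ ~ harmonic_unit_section V.

End Geometry.

Section Identification.
Variable R : realType.

Lemma quatE (x0 x1 x2 x3 : R) :
  (quat x0 x1 x2 x3 0 0 = x0) * (quat x0 x1 x2 x3 0 1 = x1)
  * (quat x0 x1 x2 x3 0 2 = x2) * (quat x0 x1 x2 x3 0 3 = x3).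
Proof. by rewrite /quat !mxE. Qed.

Lemma qmxE (q : 'rV[R]_4) :
  (qmx q 0 0 = Complex (q 0 0) (q 0 1)) * (qmx q 0 1 = Complex (q 0 2) (q 0 3))
  * (qmx q 1 0 = Complex (- q 0 2) (q 0 3))
  * (qmx q 1 1 = Complex (q 0 0) (- q 0 1)).
Proof. by rewrite /qmx !mxE. Qed.

Lemma mx2P (T : Type) (A B : 'M[T]_2) :
  A 0 0 = B 0 0 -> A 0 1 = B 0 1 -> A 1 0 = B 1 0 -> A 1 1 = B 1 1 -> A = B.
Proof.
move=> h00 h01 h10 h11; apply/matrixP => i j.
have P (k : 'I_2) : k = 0 \/ k = 1.
  by case: k => [[|[|//]]] h; [left|right]; exact: val_inj.
by case: (P i) => ->; case: (P j) => ->.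
Qed.

Lemma sum4 (V : zmodType) (F : 'I_4 -> V) :
  \sum_i F i = F 0 + F 1 + F 2 + F 3.
Proof.
rewrite !big_ord_recl big_ord0 addr0 !addrA.
by do !congr (_ + _); congr F; exact: val_inj.
Qed.

Lemma sum2 (V : zmodType) (F : 'I_2 -> V) : \sum_i F i = F 0 + F 1.
Proof.
rewrite !big_ord_recl big_ord0 addr0.
by do !congr (_ + _); congr F; exact: val_inj.
Qed.

Lemma det2 (K : comNzRingType) (A : 'M[K]_2) :
  \det A = A 0 0 * A 1 1 - A 0 1 * A 1 0.
Proof.
rewrite (expand_det_row _ 0) sum2 /cofactor !det_mx11 !mxE /= !expr0 !expr1.
have -> : lift 0 0 = 1 :> 'I_2 by exact: val_inj.
have -> : lift 1 0 = 0 :> 'I_2 by exact: val_inj.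
by rewrite mul1r mulN1r mulrN.
Qed.

Lemma qmxM (p q : 'rV[R]_4) : qmx (qmul p q) = qmx p *m qmx q.
Proof.
by apply: mx2P; rewrite [RHS]mxE sum2 !qmxE /qmul !quatE; congr Complex; ring.
Qed.

Lemma qmx_inj : injective (@qmx R).
Proof.
move=> p q /matrixP h.
have := h 0 0; have := h 0 1; rewrite !qmxE => -[h2 h3] [h0 h1].
apply/rowP => -[[|[|[|[|//]]]] hi].
- by move: h0; congr (_ = _); congr (_ 0 _); exact: val_inj.
- by move: h1; congr (_ = _); congr (_ 0 _); exact: val_inj.
- by move: h2; congr (_ = _); congr (_ 0 _); exact: val_inj.
- by move: h3; congr (_ = _); congr (_ 0 _); exact: val_inj.
Qed.

Lemma special_unitaryP (A : 'M[R[i]]_2) :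
  special_unitary A <-> exists2 q : 'rV[R]_4, SU2 q & A = qmx q.
Proof.
split=> [[hA dA]|[q hq ->]].
- have e00 : (A *m (map_mx (@conjc R) A)^T) 0 0 = 1 by rewrite hA mxE.
  have e10 : (A *m (map_mx (@conjc R) A)^T) 1 0 = 0 by rewrite hA mxE.
  move: e00 e10 dA; rewrite det2 !mxE !sum2 !mxE => e00 e10 dA.
  have ed : A 1 1 = conjc (A 0 0).
    rewrite -[RHS]mulr1 -dA -[LHS]mulr1 -e00.
    move/(congr1 (fun x => A 0 1 * x)): e10; rewrite mulr0 => e10.
    apply/eqP; rewrite -subr_eq0 -[X in _ == X]e10; apply/eqP; ring.
  have ec : A 1 0 = - conjc (A 0 1).
    rewrite -[RHS]mulr1 -dA -[LHS]mulr1 -e00.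
    move/(congr1 (fun x => A 0 0 * x)): e10; rewrite mulr0 => e10.
    apply/eqP; rewrite -subr_eq0 -[X in _ == X]e10; apply/eqP; ring.
  move: e00 ed ec.
  case ha: (A 0 0) => [a a']; case hb: (A 0 1) => [b b'] /= [e1 _] ed ec.
  exists (quat a a' b b').
    by rewrite /SU2 /= sum4 !quatE -e1; ring.
  apply: mx2P; rewrite !qmxE !quatE ?ha ?hb // ec //.
  by apply/eqP; rewrite eq_complex /= opprK !eqxx.
- move: hq; rewrite /SU2 /= sum4 => hq; split.
    apply: mx2P; rewrite mxE sum2 !mxE /=; apply/eqP; rewrite eq_complex /=;
      apply/andP; split; apply/eqP; rewrite -?hq; ring.
  rewrite det2 !qmxE; apply/eqP; rewrite eq_complex /=.
  by apply/andP; split; apply/eqP; rewrite -?hq; ring.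
Qed.

Lemma imq_lie (a b : 'rV[R]_3) :
  imq (lie a b) = qmul (imq a) (imq b) - qmul (imq b) (imq a).
Proof.
apply/rowP => -[[|[|[|[|//]]]] hi]; rewrite /lie /imq /qmul /vecq /vec3 /quat;
  rewrite !mxE //=; ring.
Qed.

End Identification.

(* Main.v *)
Require Import Defs.
From HB Require Import structures.
From mathcomp Require Import all_boot all_order all_algebra.
From mathcomp Require Import ring lra.
From mathcomp Require Import all_classical all_reals all_analysis.

Set Implicit Arguments.
Unset Strict Implicit.
Unset Printing Implicit Defensive.

Import Order.TTheory GRing.Theory Num.Theory.
Import numFieldNormedType.Exports.
Local Open Scope classical_set_scope.
Local Open Scope ring_scope.

(* In the left trivialisation of the tangent bundle by the frame e the Levi-Civita connection
   is D_X y plus the cross product of M x and y, where M is the diagonal matrix with entries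
   mu_i = (l1 + l2 + l3) / 2 - l_i.  The energy densities become explicit polynomials in the
   coordinates w of the field and in their derivatives along the frame, and the volume form
   is, up to a constant, sin x cos x dx dy dz in Hopf coordinates, so that the derivative of a
   function along a left-invariant field integrates to zero.
   A left-invariant field has constant coordinates v.  Hence along a variation w_t the terms
   containing derivatives of w_t integrate to zero to first order, and the energy is
   c + (integral of ell (w_t - v)) + O(t^2), where ell is the differential at v of the density
   restricted to constant coordinates.  So V is critical among all unit fields as soon as ell
   vanishes on the vectors orthogonal to v; rotations of V through left-invariant fields give
   the converse.  For the two bienergies the densities of unit vectors are quadratic forms in
   the squares of the coordinates, and the critical points depend only on which coefficients
   vanish and on the inequality c01 + c12 < c02, which hold for both alike. *)

(** * Smooth functions *)

(** Fields are extended to R^4 but compared on the sphere only, so an identity known on the sphere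
    may be differentiated in tangent directions only; this is the reason for [derive_vanishing] and
    for the passages through [eq_dir]. Since [nabla] is any operator with the Levi-Civita
    properties, Koszul's argument has to compute it before the energies can be evaluated. The energy
    of a general variation contains second derivatives of w_t along the frame. Differentiation in t
    under the integral is avoided: each entry of the 2-jet of w_t is jointly smooth in time and
    space, hence within O(t) of its value at t = 0, uniformly on the compact sphere, and estimates
    of this kind are stable under sums and products. Testing ell on vectors orthogonal to v suffices
    because unit vectors v and w satisfy <v, w - v> = - |w - v|^2 / 2, which is O(t^2) along a
    variation. For the vertical bienergy the form in the squares comes from the identity |A v|^2
    |v|^2 - <A v, v>^2 = sum over i < j of (A_i - A_j)^2 v_i^2 v_j^2, where A is the diagonal matrix
    of the rough Laplacian. *)

Section NearEquality.
Variables (R : realType) (E F : normedModType R).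

(** The little-o expansion sees only the germ at [p], so the differential of [f] serves for [g] as
    well. *)
Lemma near_eq_differentiable (f g : E -> F) (p : E) :
  {near p, f =1 g} -> differentiable f p -> differentiable g p.
Proof.
move=> fg df.
have fgp : f p = g p by exact: nbhs_singleton fg.
have cdf := diff_continuous df.
have H : g \o shift p = cst (g p) + 'd f p +o_ 0 id.
  have /diff_locallyP[_ /eqaddoP dfE] := df.
  apply/eqaddoP => eps eps0; have := dfE _ eps0.
  have : \forall h \near 0, f (h + p) = g (h + p).
    by have := fg; rewrite (near_shift 0 p) subr0.
  apply: filterS2 => h /= fgh.
  by rewrite !fctE /= fgh -fgp.
have dE := diff_unique cdf H.
by apply/diff_locallyP; split; rewrite dE.
Qed.

(** Openness of [U] turns equality on [U] into equality near each of its points, so it passes to the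
    derivatives and the induction on [k] goes on. *)
Lemma Ck_on_ext (U : set E) k (f g : E -> F) : open U ->
  (forall p, U p -> f p = g p) -> Ck_on U k f -> Ck_on U k g.
Proof.
move=> oU; have nU p : U p -> \near p, U p by move=> Up; exact: open_nbhs_nbhs.
elim: k f g => [|k IH] f g fg /=.
  move=> cf p Up; have /= := cf p Up; rewrite /prop_for /continuous_at (fg p Up).
  apply: cvg_trans; apply: near_eq_cvg.
  by apply: filterS (nU p Up) => q /fg.
have nfg p : U p -> {near p, f =1 g} by move=> /nU; apply: filterS => q /fg.
move=> [df ckf]; split.
  by move=> p Up; apply: near_eq_differentiable (df p Up); exact: nfg.
move=> v; apply: IH (ckf v) => p Up; apply: near_eq_derive; exact: nfg.
Qed.

End NearEquality.

Section SmoothCalculus.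
Variables (R : realType) (E : normedModType R) (U : set E).
Hypothesis openU : open U.
Implicit Types (f g : E -> R) (F : normedModType R).

Lemma Ck_onW F k (f : E -> F) : Ck_on U k.+1 f -> Ck_on U k f.
Proof.
elim: k f => [|k IH] f /= [df ckf].
  by move=> p Up; apply: differentiable_continuous; exact: df.
by split => // v; apply: IH; exact: ckf.
Qed.

Lemma smooth_on_differentiable F (f : E -> F) p :
  smooth_on U f -> U p -> differentiable f p.
Proof. by move=> /(_ 1%N) [] + _; exact. Qed.

Lemma smooth_on_continuous F (f : E -> F) p :
  smooth_on U f -> U p -> {for p, continuous f}.
Proof. by move=> /(_ 0%N); exact. Qed.

Lemma smooth_on_derive F (f : E -> F) v :
  smooth_on U f -> smooth_on U (fun p => 'D_v f p).
Proof. by move=> sf k; have [_] := sf k.+1; exact. Qed.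

Lemma smooth_on_ext F (f g : E -> F) : (forall p, U p -> f p = g p) ->
  smooth_on U f -> smooth_on U g.
Proof. by move=> fg sf k; apply: Ck_on_ext (sf k). Qed.

Lemma Ck_on_cst F k (c : F) : Ck_on U k (fun=> c).
Proof.
elim: k c => [|k IH] c /=; first by move=> p _; exact: cst_continuous.
split=> [p _|v]; first exact: differentiable_cst.
by apply: Ck_on_ext (IH 0) => // p _; rewrite derive_cst.
Qed.

Lemma smooth_on_cst F (c : F) : smooth_on U (fun=> c).
Proof. move=> k; exact: Ck_on_cst. Qed.

Lemma smooth_on_affine f (df : E -> R) :
  (forall p, differentiable f p) -> (forall v p, 'D_v f p = df v) ->
  smooth_on U f.
Proof.
move=> hf hdf [|k] /=.
  by move=> p _; apply: differentiable_continuous.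
split=> // v; apply: Ck_on_ext (Ck_on_cst k (df v)) => // p _; rewrite hdf.
Qed.

Lemma Ck_onD F k (f g : E -> F) :
  Ck_on U k f -> Ck_on U k g -> Ck_on U k (fun p => f p + g p).
Proof.
elim: k f g => [|k IH] f g /=.
  by move=> cf cg p Up; apply: continuousD; [exact: cf|exact: cg].
move=> [df ckf] [dg ckg]; split=> [p Up|v].
  by apply: differentiableD; [exact: df|exact: dg].
apply: Ck_on_ext (IH _ _ (ckf v) (ckg v)) => // p Up.
by rewrite deriveD //; apply: diff_derivable; [exact: df|exact: dg].
Qed.

(** The product rule leaves one factor undifferentiated; [Ck_onW] lowers its class to the one of the
    induction hypothesis. *)
Lemma Ck_onM k f g :
  Ck_on U k f -> Ck_on U k g -> Ck_on U k (fun p => f p * g p).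
Proof.
elim: k f g => [|k IH] f g.
  by move=> cf cg p Up; apply: continuousM; [exact: cf|exact: cg].
move=> sf sg; have [df ckf] := sf; have [dg ckg] := sg; split=> [p Up|v].
  by apply: differentiableM; [exact: df|exact: dg].
apply: Ck_on_ext (Ck_onD (IH _ _ (Ck_onW sf) (ckg v))
  (IH _ _ (Ck_onW sg) (ckf v))) => // p Up.
by rewrite deriveM //; apply: diff_derivable; [exact: df|exact: dg].
Qed.

Lemma smooth_onD F (f g : E -> F) : smooth_on U f -> smooth_on U g ->
  smooth_on U (fun p => f p + g p).
Proof. by move=> sf sg k; apply: Ck_onD. Qed.

Lemma smooth_onM f g : smooth_on U f -> smooth_on U g ->
  smooth_on U (fun p => f p * g p).
Proof. by move=> sf sg k; apply: Ck_onM. Qed.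

Lemma smooth_onN f : smooth_on U f -> smooth_on U (fun p => - f p).
Proof.
move=> sf; apply: smooth_on_ext (smooth_onM (smooth_on_cst (-1 : R)) sf) => p _.
by rewrite mulN1r.
Qed.

Lemma smooth_onB f g : smooth_on U f -> smooth_on U g ->
  smooth_on U (fun p => f p - g p).
Proof. by move=> sf sg; apply: smooth_onD => //; exact: smooth_onN. Qed.

Lemma smooth_on_sum n (f : 'I_n -> E -> R) : (forall i, smooth_on U (f i)) ->
  smooth_on U (fun p => \sum_i f i p).
Proof.
elim: n f => [|n IH] f sf.
  by apply: smooth_on_ext (smooth_on_cst (0 : R)) => p _; rewrite big_ord0.
apply: smooth_on_ext (smooth_onD (sf ord0) (IH (fun i => f (lift ord0 i)) _)).
  by move=> p _; rewrite big_ord_recl.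
by move=> i; exact: sf.
Qed.

Lemma differentiable_rowP n (f : E -> 'rV[R]_n) p :
  differentiable f p <-> forall i, differentiable (fun q => f q 0 i) p.
Proof.
split=> [df i|df].
  exact: (@differentiable_comp _ _ _ _ f (fun M : 'rV_n => M 0 i) p df
            (differentiable_coord _ _ _)).
have -> : f = \sum_i (fun q => f q 0 i *: delta_mx 0 i).
  by apply/funext => q; rewrite fct_sumE -row_sum_delta.
by apply: differentiable_sum => i; exact: differentiableZl.
Qed.

Lemma derive_row n (f : E -> 'rV[R]_n) p v i : differentiable f p ->
  ('D_v f p) 0 i = 'D_v (fun q => f q 0 i) p.
Proof. by move=> df; rewrite derive_mx ?mxE//; exact: diff_derivable. Qed.

Lemma Ck_on_rowP n k (f : E -> 'rV[R]_n) :
  Ck_on U k f <-> forall i, Ck_on U k (fun q => f q 0 i).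
Proof.
elim: k f => [|k IH] f /=.
  split=> [cf i p Up|cf p Up].
    apply: (@continuous_comp _ _ _ f (fun M : 'rV_n => M 0 i)); first exact: cf.
    by apply: differentiable_continuous; exact: differentiable_coord.
  have -> : f = fun q => \sum_i f q 0 i *: delta_mx 0 i.
    by apply/funext => q; rewrite -row_sum_delta.
  apply: cvg_big => [|i _]; first exact: add_continuous.
  by apply: cvgZr_tmp; exact: cf.
split=> [[df ckf] i|H].
  split=> [p Up|v]; first by have /differentiable_rowP := df p Up; exact.
  have /IH/(_ i) := ckf v; apply: Ck_on_ext => // p Up.
  by rewrite derive_row//; exact: df.
have df p : U p -> differentiable f p.
  by move=> Up; apply/differentiable_rowP => i; case: (H i) => + _; exact.
split=> // v; apply/IH => i; have [_ /(_ v)] := H i.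
by apply: Ck_on_ext => // p Up; rewrite derive_row//; exact: df.
Qed.

Lemma smooth_on_rowP n (f : E -> 'rV[R]_n) :
  smooth_on U f <-> forall i, smooth_on U (fun q => f q 0 i).
Proof.
split=> [sf i k|sf k]; first by have /Ck_on_rowP := sf k.
by apply/Ck_on_rowP => i; exact: sf.
Qed.

End SmoothCalculus.

Section DirectionalDerivatives.
Variables (R : realType) (E : normedModType R).
Implicit Types (f : E -> R) (U : set E).

Lemma derive_lincomb n f p (x : 'I_n -> R) (b : 'I_n -> E) :
  differentiable f p ->
  'D_(\sum_i x i *: b i) f p = \sum_i x i * 'D_(b i) f p.
Proof.
move=> df; rewrite deriveE// linear_sum; apply: eq_bigr => i _.
by rewrite linearZ /= deriveE.
Qed.

(** [Ck_on] speaks of fixed directions only; a direction that varies with the point is expanded in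
    fixed vectors with smooth coefficients. *)
Lemma smooth_on_dir U n (x : 'I_n -> E -> R) (b : 'I_n -> E) f : open U ->
  (forall i, smooth_on U (x i)) -> smooth_on U f ->
  smooth_on U (fun p => 'D_(\sum_i x i p *: b i) f p).
Proof.
move=> oU sx sf.
apply: (@smooth_on_ext _ _ _ oU _ (fun p => \sum_i x i p * 'D_(b i) f p)).
  by move=> p Up; rewrite derive_lincomb//; exact: smooth_on_differentiable sf Up.
apply: smooth_on_sum => // i; apply: smooth_onM => //.
exact: smooth_on_derive.
Qed.

Lemma is_derive_curve f (c : R -> E) (t : R) dc :
  differentiable f (c t) -> is_derive t 1 c dc ->
  is_derive t 1 (f \o c) ('D_dc f (c t)).
Proof.
move=> df [dc1 dcE].
have dct : differentiable c t by exact/derivable1_diffP.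
apply: DeriveDef; first exact/derivable1_diffP/differentiable_comp.
rewrite deriveE; last exact: differentiable_comp.
have <- : 'd c t 1 = dc by rewrite -deriveE.
by rewrite diff_comp// deriveE.
Qed.

(** The two difference quotients coincide for every [h], so no chain rule is involved. *)
Lemma derive_comp_affine (F G : normedModType R) (L : E -> F) (f : F -> G) p v w :
  (forall h : R, L (h *: v + p) = h *: w + L p) ->
  'D_v (f \o L) p = 'D_w f (L p).
Proof. by move=> Lh; rewrite /derive /=; under eq_fun do rewrite Lh. Qed.

Lemma linear_derive (f : E -> R) p v : linear f -> continuous f ->
  differentiable f p /\ 'D_v f p = f v.
Proof.
move=> lf cf; pose L := GRing.isLinear.Build _ _ _ _ _ lf.
pose g : {linear E -> R} := HB.pack f L.
have dg : differentiable g p by exact: linear_differentiable.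
by split; [exact: dg|rewrite (deriveE v dg) diff_lin].
Qed.

Lemma smooth_on_linear U f : open U -> linear f -> continuous f -> smooth_on U f.
Proof.
move=> oU lf cf; apply: (smooth_on_affine oU (df := f)) => [p|v p].
  by have [] := linear_derive p 0 lf cf.
by have [] := linear_derive p v lf cf.
Qed.

End DirectionalDerivatives.

Section Coordinates.
Variables (R : realType) (n : nat).
Local Notation H := 'rV[R]_n.
Local Notation RH := (R^o * H)%type.

Lemma smooth_on_coord (U : set H) i : open U -> smooth_on U (fun q => q 0 i : R).
Proof.
move=> oU; apply: smooth_on_linear => //; last exact: coord_continuous.
by move=> a u v; rewrite !mxE.
Qed.

Lemma smooth_on_snd_coord (U : set RH) i : open U ->
  smooth_on U (fun s => s.2 0 i : R).
Proof.
move=> oU; apply: smooth_on_linear => //; first by move=> a u v; rewrite !mxE.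
move=> s; apply: (@continuous_comp _ _ _ snd (fun q : H => q 0 i)).
  exact: cvg_snd.
exact: coord_continuous.
Qed.

(** Simultaneous induction on the class, since each of the two functions is, up to sign, the
    derivative of the other. This makes the rotations of a left-invariant field smooth
    variations. *)
Lemma smooth_on_trig (U : set RH) : open U ->
  smooth_on U (fun s => cos s.1) /\ smooth_on U (fun s => sin s.1).
Proof.
move=> oU; suff H k : Ck_on U k (fun s : RH => cos s.1) /\
    Ck_on U k (fun s : RH => sin s.1).
  by split=> k; case: (H k).
have ld (s v : RH) : differentiable (fun s : RH => s.1) s /\
    'D_v (fun s : RH => s.1) s = v.1.
  by apply: (@linear_derive R RH (fun s => s.1)) => // z; exact: cvg_fst.
have trig (f df : R -> R) : (forall x : R, is_derive x (1 : R) f (df x)) ->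
    forall s v : RH, differentiable (fun s : RH => f s.1) s /\
      'D_v (fun s : RH => f s.1) s = df s.1 * v.1.
  move=> fdf s v; have [d1 d1E] := ld s v.
  have df1 : differentiable f s.1.
    by apply/derivable1_diffP; have [] := fdf s.1.
  have dlin (x : R) : 'd f (s.1 : R) x = df s.1 * x.
    rewrite -[in LHS](mulr1 x) -[x * 1]/(x *: (1 : R)) linearZ /=.
    by rewrite -(deriveE (1 : R) df1); have [_ ->] := fdf s.1; rewrite mulrC.
  have dc : differentiable (f \o (fun s : RH => s.1)) s by exact: differentiable_comp.
  split; first exact: dc.
  rewrite [LHS](deriveE v dc) diff_comp//= -(deriveE v d1) d1E.
  by rewrite -dlin.
elim: k => [|k [IHc IHs]].
  by split=> p _; apply: differentiable_continuous;
    [case: (trig _ _ (@is_derive_cos R) p 0)|case: (trig _ _ (@is_derive_sin R) p 0)].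
split.
  split=> [p _|v]; first by case: (trig _ _ (@is_derive_cos R) p 0).
  apply: Ck_on_ext (Ck_onM oU IHs (Ck_on_cst oU k (- v.1 : R))) => // p _.
  by case: (trig _ _ (@is_derive_cos R) p v) => _ ->; rewrite mulrN mulNr.
split=> [p _|v]; first by case: (trig _ _ (@is_derive_sin R) p 0).
apply: Ck_on_ext (Ck_onM oU IHc (Ck_on_cst oU k (v.1 : R))) => // p _.
  by case: (trig _ _ (@is_derive_sin R) p v) => _ ->.
Qed.

Lemma derive_coord (f : H -> R) p v : differentiable f p ->
  'D_v f p = \sum_i v 0 i * 'D_(delta_mx 0 i) f p.
Proof. by move=> df; rewrite -derive_lincomb// -row_sum_delta. Qed.

End Coordinates.

(** * Uniform Lipschitz bounds in time *)

Section TimeBound.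
Variables (R : realType) (n : nat).
Local Notation H := 'rV[R]_n.
Local Notation RH := (R^o * H)%type.

Definition strip (eps : R) : set RH := [set s | `|s.1| < eps].

Lemma open_strip eps : open (strip eps).
Proof.
rewrite (_ : strip eps = (fun s : RH => `|s.1|) @^-1` [set x | x < eps])//.
apply: open_comp; last exact: open_lt.
move=> s _; apply: (@continuous_comp _ _ _ fst (@Num.norm R R^o)); first exact: cvg_fst.
exact: norm_continuous.
Qed.

(** The time derivative is bounded on the compact set of times in [- eps / 2, eps / 2] and points of
    the cube [-1, 1]^n, and the mean value theorem in t does the rest. Halving [eps] keeps this set
    inside the open strip; the cube contains the unit sphere. *)
Lemma strip_lipschitz (eps : R) (h : RH -> R) : 0 < eps ->
  smooth_on (strip eps) h ->
  exists2 C, 0 <= C & forall (t : R) (p : H), `|t| < eps / 2 ->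
    (forall i, `|p 0 i| <= 1) -> `|h (t, p) - h (0, p)| <= C * `|t|.
Proof.
move=> eps0 sh; have oU := @open_strip eps.
pose dh := fun s : RH => 'D_((1, 0) : RH) h s.
have sdh : smooth_on (strip eps) dh by exact: smooth_on_derive.
pose I : set R := `[-1, 1]%classic.
pose box := [set p : H | forall i, I (p 0 i)].
have cbox : compact box by apply: (@rV_compact R n (fun=> I)) => i; exact: segment_compact.
pose K : set RH := (`[- (eps / 2), eps / 2]%classic : set R) `*` box.
have cK : compact K by apply: (@compact_setX R^o H) => //; exact: segment_compact.
have KU : K `<=` strip eps.
  move=> s [] /=; rewrite in_itv /= => /andP[a b] _.
  rewrite /strip /= ltr_norml; lra.
have K0 : K !=set0.
  exists (0, 0); split=> /=; first by rewrite in_itv /=; lra.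
  by move=> i; rewrite /I /= in_itv /= !mxE; lra.
have cdh : {within K, continuous (fun s => `|dh s|)}.
  apply: continuous_in_subspaceT => s; rewrite inE => Ks.
  apply: (@continuous_comp _ _ _ dh (@Num.norm R R)); last exact: norm_continuous.
  exact: smooth_on_continuous sdh (KU _ Ks).
have [c _ maxc] := compact_EVT_max K0 cK cdh.
exists `|dh c| => // t p ht hp.
(* The segment between 0 and t, written so that both signs of t are covered. *)
have hK s : s \in `[Num.min 0 t, Num.max 0 t] -> K (s, p).
  rewrite in_itv /= ge_min le_max => hs; split=> /=; last first.
    by move=> i; rewrite /I /= in_itv /= -ler_norml.
  by move: ht; rewrite in_itv /= ltr_norml; lra.
have dhs s : s \in `[Num.min 0 t, Num.max 0 t] ->
    is_derive s 1 (fun r => h (r, p)) (dh (s, p)).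
  move=> hs; have dhsp : differentiable h (s, p).
    exact: smooth_on_differentiable sh (KU _ (hK _ hs)).
  have Lh (k : R) : (k *: (1 : R^o) + s, p) = k *: (1, 0) + (s, p) :> RH.
    by rewrite /GRing.add /GRing.scale /= /add_pair /scale_pair /= scaler0 add0r.
  have /cvg_ex[l hl] : derivable h (s, p) (1, 0) by exact: diff_derivable.
  have E : (fun k : R => k^-1 *: ((h \o shift (s, p)) (k *: ((1, 0) : RH)) - h (s, p)))
     = (fun k : R => k^-1 *: (((fun r => h (r, p)) \o shift s) (k *: (1 : R)) - h (s, p))).
    by apply/funext => k /=; rewrite -Lh.
  apply: DeriveDef; first by apply/cvg_ex; exists l; rewrite /= -E.
  by rewrite /dh /derive E.
have hm : Num.min 0 t <= Num.max 0 t by rewrite ge_min !le_max !lexx.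
pose f (r : R) := h (r, p); pose df (r : R) := dh (r, p).
have fdf x : x \in `]Num.min 0 t, Num.max 0 t[ -> is_derive x 1 f (df x).
  by rewrite in_itv /= => /andP[? ?]; apply: dhs; rewrite in_itv /= !ltW.
have cf : {within `[Num.min 0 t, Num.max 0 t], continuous f}.
  by apply: derivable_within_continuous => x xI; have [] := dhs x xI.
have [x xI] := MVT_segment hm fdf cf.
move=> /(congr1 Num.norm); rewrite normrM => E.
have -> : `|h (t, p) - h (0, p)| = `|df x| * `|t|.
  rewrite -/(f t) -/(f 0).
  move: E; case: (leP 0 t) => _; rewrite ?subr0 //.
  by rewrite sub0r normrN => <-; rewrite distrC.
apply: ler_wpM2r => //; apply: maxc; rewrite inE; exact: hK.
Qed.

End TimeBound.

(** * The Levi-Civita connection in the left trivialisation *)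

Section Vectors.
Variable R : realType.
Implicit Types (a b c x y : 'rV[R]_3) (p q u v : 'rV[R]_4).

Lemma I3P (i : 'I_3) : [\/ i = 0, i = 1 | i = 2].
Proof.
case: i => [[|[|[|//]]]] h; [apply: Or31|apply: Or32|apply: Or33];
  exact: val_inj.
Qed.

Lemma I4P (i : 'I_4) : [\/ i = 0, i = 1, i = 2 | i = 3].
Proof.
case: i => [[|[|[|[|//]]]]] h; [apply: Or41|apply: Or42|apply: Or43|apply: Or44];
  exact: val_inj.
Qed.

Lemma sum3 (W : zmodType) (F : 'I_3 -> W) : \sum_i F i = F 0 + F 1 + F 2.
Proof.
rewrite !big_ord_recl big_ord0 addr0 !addrA.
by do !congr (_ + _); congr F; exact: val_inj.
Qed.

Lemma row3P a b : a 0 0 = b 0 0 -> a 0 1 = b 0 1 -> a 0 2 = b 0 2 -> a = b.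
Proof. by move=> h0 h1 h2; apply/rowP => i; case: (I3P i) => ->. Qed.

Lemma row4P p q : p 0 0 = q 0 0 -> p 0 1 = q 0 1 -> p 0 2 = q 0 2 ->
  p 0 3 = q 0 3 -> p = q.
Proof. by move=> h0 h1 h2 h3; apply/rowP => i; case: (I4P i) => ->. Qed.

Lemma vec3E (x0 x1 x2 : R) :
  (vec3 x0 x1 x2 0 0 = x0) * (vec3 x0 x1 x2 0 1 = x1) * (vec3 x0 x1 x2 0 2 = x2).
Proof. by rewrite /vec3 !mxE. Qed.

Definition cross a b : 'rV[R]_3 :=
  vec3 (a 0 1 * b 0 2 - a 0 2 * b 0 1) (a 0 2 * b 0 0 - a 0 0 * b 0 2)
       (a 0 0 * b 0 1 - a 0 1 * b 0 0).

Definition dot a b : R := a 0 0 * b 0 0 + a 0 1 * b 0 1 + a 0 2 * b 0 2.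

Definition diag3 (m : 'I_3 -> R) a : 'rV[R]_3 :=
  vec3 (m 0 * a 0 0) (m 1 * a 0 1) (m 2 * a 0 2).

Lemma qmulA p q u : qmul p (qmul q u) = qmul (qmul p q) u.
Proof. by apply: row4P; rewrite /qmul !quatE; ring. Qed.

Lemma qmulDr p q u : qmul p (q + u) = qmul p q + qmul p u.
Proof. by apply: row4P; rewrite /qmul !mxE /=; ring. Qed.

Lemma qmulBr p q u : qmul p (q - u) = qmul p q - qmul p u.
Proof. by apply: row4P; rewrite /qmul !mxE /=; ring. Qed.

Lemma qconjK p q : SU2 p -> qmul (qconj p) (qmul p q) = q.
Proof.
rewrite /SU2 /= sum4 => hp.
apply: row4P; rewrite /qmul /qconj !quatE -[RHS]mul1r -hp; ring.
Qed.

Lemma qmulK p q : SU2 p -> qmul p (qmul (qconj p) q) = q.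
Proof.
rewrite /SU2 /= sum4 => hp.
apply: row4P; rewrite /qmul /qconj !quatE -[RHS]mul1r -hp; ring.
Qed.

Lemma imqK a : vecq (imq a) = a.
Proof. by apply: row3P; rewrite /vecq /imq vec3E !quatE. Qed.

Lemma imqD a b : imq (a + b) = imq a + imq b.
Proof. by apply: row4P; rewrite /imq !mxE /=; ring. Qed.

Lemma imqB a b : imq (a - b) = imq a - imq b.
Proof. by apply: row4P; rewrite /imq !mxE /=; ring. Qed.

Lemma imq0 : imq 0 = 0 :> 'rV[R]_4.
Proof. by apply: row4P; rewrite /imq !mxE. Qed.

Lemma qmul0 p : qmul p 0 = 0.
Proof. by apply: row4P; rewrite /qmul !mxE /=; ring. Qed.

(** The real part of the quaternion conj(p) v is the Euclidean product of p and v, so tangency makes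
    conj(p) v imaginary. *)
Lemma tangent_imq p v : SU2 p -> tangent p v ->
  v = qmul p (imq (vecq (qmul (qconj p) v))).
Proof.
move=> hp; rewrite /tangent sum4 => tv.
rewrite -[LHS](qmulK v hp); congr (qmul p _).
by apply: row4P; rewrite /imq /vecq /qmul /qconj !(quatE, vec3E) -?tv //; ring.
Qed.

Lemma tangent_left p a : tangent p (qmul p (imq a)).
Proof. by rewrite /tangent sum4 /qmul /imq !quatE; ring. Qed.

Lemma vecqD p q : vecq (p + q) = vecq p + vecq q.
Proof. by apply: row3P; rewrite /vecq !mxE. Qed.

Lemma vecqZ (k : R) p : vecq (k *: p) = k *: vecq p.
Proof. by apply: row3P; rewrite /vecq !mxE. Qed.

Lemma lieE a b : lie a b = 2 *: cross a b.
Proof.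
rewrite /lie /cross /imq /qmul; move: (a 0 0) (a 0 1) (a 0 2) (b 0 0) (b 0 1) (b 0 2).
move=> a0 a1 a2 b0 b1 b2; apply: row3P; rewrite /vecq /vec3 /quat !mxE /=; ring.
Qed.

Lemma lie_linearl (k : R) a a' b : lie (k *: a + a') b = k *: lie a b + lie a' b.
Proof.
rewrite !lieE scalerA mulrC -scalerA -scalerDr; congr (_ *: _).
by apply: row3P; rewrite /cross !mxE /=; ring.
Qed.

Lemma lieC a b : lie a b = - lie b a.
Proof.
rewrite !lieE -scalerN; congr (_ *: _).
by apply: row3P; rewrite /cross !mxE /=; ring.
Qed.

End Vectors.

Section TangentialDerivative.
Variable R : realType.
Local Notation H := 'rV[R]_4.

Lemma is_derive_Zl (E : normedModType R) (k : R -> R) (u : E) (t dk : R) :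
  is_derive t (1 : R) k dk -> is_derive t (1 : R) (fun s => k s *: u) (dk *: u).
Proof.
move=> [/derivable1_diffP dk1 <-].
have dku : differentiable (fun s => k s *: u) t by exact: differentiableZl.
by apply: DeriveDef; [exact/derivable1_diffP|rewrite !deriveE// diffZl].
Qed.

(* A rational curve in the sphere through p with velocity v. *)
Lemma derive_vanishing (f : H -> R) (p v : H) : SU2 p -> tangent p v ->
  differentiable f p -> (forall q, SU2 q -> f q = 0) -> 'D_v f p = 0.
Proof.
(* With |v|^2 = 4 s and v orthogonal to p, the vector (1 - s t^2) p + t v has norm 1 + s t^2;
   dividing by this norm gives the curve [c]. *)
move=> hp tv df f0; pose s : R := (\sum_i v 0 i ^+ 2) / 4.
have s0 : 0 <= s by apply: divr_ge0 => //; apply: sumr_ge0 => i _; exact: sqr_ge0.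
pose w (t : R) := 1 + s * t ^+ 2.
have w0 t : 0 < w t by have := sqr_ge0 t; rewrite /w; nra.
pose c (t : R) : H := ((1 - s * t ^+ 2) / w t) *: p + (t / w t) *: v.
have c0 : c 0 = p.
  by rewrite /c /w expr0n mulr0 subr0 addr0 divr1 mul0r scale0r scale1r addr0.
have cS t : SU2 (c t).
  have vs : \sum_i v 0 i ^+ 2 = 4 * s by rewrite /s mulrC divfK.
  move: hp tv vs; rewrite /SU2 /tangent /c /= !sum4 !mxE => hp tv vs.
  have wn : w t != 0 by rewrite gt_eqF.
  set a := (1 - _) / _; set b := t / _.
  transitivity (a ^+ 2 * (p 0 0 ^+ 2 + p 0 1 ^+ 2 + p 0 2 ^+ 2 + p 0 3 ^+ 2)
     + 2 * a * b * (p 0 0 * v 0 0 + p 0 1 * v 0 1 + p 0 2 * v 0 2 + p 0 3 * v 0 3)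
     + b ^+ 2 * (v 0 0 ^+ 2 + v 0 1 ^+ 2 + v 0 2 ^+ 2 + v 0 3 ^+ 2)); first by ring.
  by rewrite hp tv vs /a /b; move: wn; rewrite /w => wn; field.
have dw : is_derive (0 : R) (1 : R) w 0.
  by rewrite /w; apply: is_derive_eq; rewrite /GRing.scale /=; ring.
have dc : is_derive (0 : R) (1 : R) c v.
  have w00 : w 0 != 0 by rewrite gt_eqF.
  have w01 : w 0 = 1 by rewrite /w expr0n mulr0 addr0.
  have dwV : is_derive (0 : R) (1 : R) (fun t => (w t)^-1) 0.
    apply: DeriveDef; first by apply: derivableV => //; exact: ex_derive.
    by rewrite deriveV// derive_val /GRing.scale /= mulr0.
  have dA : is_derive (0 : R) (1 : R) (fun t => (1 - s * t ^+ 2) / w t) 0.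
    by apply: is_derive_eq; rewrite /GRing.scale /= w01; ring.
  have dB : is_derive (0 : R) (1 : R) (fun t : R => t / w t) 1.
    by apply: is_derive_eq; rewrite /GRing.scale /= w01 /=; field.
  by rewrite -[v]scale1r -[1 *: v]add0r -(scale0r p); apply: is_deriveD;
    exact: is_derive_Zl.
have dfc : differentiable f (c 0) by rewrite c0.
have [_] := is_derive_curve dfc dc; rewrite c0 => <-.
rewrite (_ : f \o c = cst 0) ?derive_cst//.
by apply/funext => t /=; rewrite f0.
Qed.

(** The tool for differentiating identities that hold on the sphere but not for the chosen
    extensions. *)
Lemma eq_derive_SU2 (f g : H -> R) (p v : H) : SU2 p -> tangent p v ->
  differentiable f p -> differentiable g p -> (forall q, SU2 q -> f q = g q) ->
  'D_v f p = 'D_v g p.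
Proof.
move=> hp tv df dg fg; apply/eqP; rewrite -subr_eq0 -deriveB; last 2 first.
- exact: diff_derivable.
- exact: diff_derivable.
apply/eqP; apply: derive_vanishing => //; first exact: differentiableB.
by move=> q hq; rewrite !fctE fg// subrr.
Qed.

End TangentialDerivative.

Section SmoothQuaternions.
Variables (R : realType) (E : normedModType R) (U : set E).
Hypothesis openU : open U.

Lemma smooth_on_quat (f0 f1 f2 f3 : E -> R) :
  smooth_on U f0 -> smooth_on U f1 -> smooth_on U f2 -> smooth_on U f3 ->
  smooth_on U (fun s => quat (f0 s) (f1 s) (f2 s) (f3 s)).
Proof.
move=> s0 s1 s2 s3; apply/(smooth_on_rowP openU) => i.
by case: (I4P i) => ->; [apply: smooth_on_ext s0|apply: smooth_on_ext s1
  |apply: smooth_on_ext s2|apply: smooth_on_ext s3] => // s _; rewrite quatE.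
Qed.

Lemma smooth_on_vec3 (f0 f1 f2 : E -> R) :
  smooth_on U f0 -> smooth_on U f1 -> smooth_on U f2 ->
  smooth_on U (fun s => vec3 (f0 s) (f1 s) (f2 s)).
Proof.
move=> s0 s1 s2; apply/(smooth_on_rowP openU) => i.
by case: (I3P i) => ->; [apply: smooth_on_ext s0|apply: smooth_on_ext s1
  |apply: smooth_on_ext s2] => // s _; rewrite vec3E.
Qed.

Lemma smooth_on_entry n (f : E -> 'rV[R]_n) i :
  smooth_on U f -> smooth_on U (fun s => f s 0 i).
Proof. by move/(smooth_on_rowP openU); exact. Qed.

Lemma smooth_on_qmul (f g : E -> 'rV[R]_4) : smooth_on U f -> smooth_on U g ->
  smooth_on U (fun s => qmul (f s) (g s)).
Proof.
move=> sf sg; have sfg i j := smooth_onM openU (smooth_on_entry i sf) (smooth_on_entry j sg).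
have D := @smooth_onD _ _ _ openU; have B := @smooth_onB _ _ _ openU.
by apply: smooth_on_quat; do ?[apply: (B)|apply: (D)].
Qed.

Lemma smooth_on_qconj (f : E -> 'rV[R]_4) : smooth_on U f ->
  smooth_on U (fun s => qconj (f s)).
Proof.
move=> sf; have N := @smooth_onN _ _ _ openU.
by apply: smooth_on_quat; do ?apply: (N); exact: smooth_on_entry.
Qed.

Lemma smooth_on_imq (f : E -> 'rV[R]_3) : smooth_on U f ->
  smooth_on U (fun s => imq (f s)).
Proof.
move=> sf; apply: smooth_on_quat; try exact: smooth_on_entry.
exact: smooth_on_cst.
Qed.

Lemma smooth_on_vecq (f : E -> 'rV[R]_4) : smooth_on U f ->
  smooth_on U (fun s => vecq (f s)).
Proof. by move=> sf; apply: smooth_on_vec3; exact: smooth_on_entry. Qed.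

End SmoothQuaternions.

Section LeviCivita.
Variable R : realType.
Local Notation H := 'rV[R]_4.
Variables (ip : 'rV[R]_3 -> 'rV[R]_3 -> R) (e : 'I_3 -> 'rV[R]_3).
Hypothesis hip : inner_product ip.
Hypothesis he : forall i j, ip (e i) (e j) = (i == j)%:R.
Implicit Types (a b c : 'rV[R]_3) (p q v : H) (X Y Z V : H -> H).

Definition crd a : 'rV[R]_3 := \row_k ip a (e k).
Definition dec c : 'rV[R]_3 := \sum_k c 0 k *: e k.
(** The left trivialisation of the tangent bundle, in which left-invariant fields become constant on
    the sphere. *)
Definition crdf X : H -> 'rV[R]_3 := fun p => crd (vecq (qmul (qconj p) (X p))).

Lemma ipDZl (k : R) a b c : ip (k *: a + b) c = k * ip a c + ip b c.
Proof. by case: hip => _ h _; exact: h. Qed.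

Lemma ipC a b : ip a b = ip b a.
Proof. by case: hip. Qed.

Lemma ip0l c : ip 0 c = 0.
Proof. by have := ipDZl (-1) 0 0 c; rewrite scaler0 addr0 mulN1r addNr. Qed.

Lemma ip_suml (F : 'I_3 -> R) (x : 'I_3 -> 'rV[R]_3) c :
  ip (\sum_k F k *: x k) c = \sum_k F k * ip (x k) c.
Proof.
rewrite !sum3 -addrA !ipDZl -[F 2 *: _]addr0 ipDZl ip0l addr0.
by rewrite addrA.
Qed.

Lemma crd_linear : linear crd.
Proof. by move=> k a b; apply/rowP => i; rewrite !mxE ipDZl. Qed.

Lemma crdD a b : crd (a + b) = crd a + crd b.
Proof. by rewrite -[a]scale1r crd_linear !scale1r. Qed.

Lemma crdN a : crd (- a) = - crd a.
Proof.
apply/rowP => i; rewrite !mxE -[- a]addr0 -scaleN1r ipDZl ip0l addr0.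
by rewrite mulN1r.
Qed.

Lemma crdB a b : crd (a - b) = crd a - crd b.
Proof. by rewrite crdD crdN. Qed.

Lemma decK c : crd (dec c) = c.
Proof.
apply/rowP => i; rewrite mxE ip_suml (bigD1 i)//= he eqxx mulr1.
by rewrite big1 ?addr0// => j ji; rewrite he (negbTE ji) mulr0.
Qed.

Definition crdmx : 'M[R]_3 := \matrix_(j, k) ip (delta_mx 0 j) (e k).
Definition framemx : 'M[R]_3 := \matrix_(i, j) e i 0 j.

Lemma crdE b : crd b = b *m crdmx.
Proof.
apply/rowP => k; rewrite !mxE [in LHS](row_sum_delta b) ip_suml.
by apply: eq_bigr => j _; rewrite mxE.
Qed.

Lemma mul_framemx_crdmx : framemx *m crdmx = 1%:M.
Proof.
apply/row_matrixP => i; rewrite row_mul.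
have -> : row i framemx = e i by apply/rowP => j; rewrite !mxE.
by rewrite -crdE; apply/rowP => k; rewrite !mxE he.
Qed.

Lemma det_crdmx_neq0 : \det crdmx != 0.
Proof.
have := congr1 determinant mul_framemx_crdmx.
rewrite det_mulmx det1; case: eqP => // -> /eqP.
by rewrite mulr0 eq_sym oner_eq0.
Qed.

(** Orthonormality gives the other composite only; this one follows because a one-sided inverse of a
    square matrix is two-sided, which also shows that the [e i] span. *)
Lemma crdK a : dec (crd a) = a.
Proof.
have decE c : dec c = c *m framemx.
  apply/rowP => j; rewrite !mxE /dec summxE.
  by apply: eq_bigr => k _; rewrite !mxE.
by rewrite crdE decE -mulmxA (mulmx1C mul_framemx_crdmx) mulmx1.
Qed.

Lemma ip_dot a b : ip a b = dot (crd a) (crd b).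
Proof.
rewrite -[in LHS](crdK a) ip_suml sum3 /dot.
by rewrite ![ip (e _) b]ipC !mxE.
Qed.

Lemma left_metric_dot X Y p :
  left_metric ip p (X p) (Y p) = dot (crdf X p) (crdf Y p).
Proof. by rewrite /left_metric ip_dot. Qed.

Lemma smooth_on_crd (E : normedModType R) (U : set E) (f : E -> 'rV[R]_3) : open U ->
  smooth_on U f -> smooth_on U (fun s => crd (f s)).
Proof.
move=> oU sf; apply/(smooth_on_rowP oU) => i.
apply: (smooth_on_ext oU (f := fun s => \sum_j f s 0 j * ip (delta_mx 0 j) (e i))).
  by move=> s _; rewrite mxE [in RHS](row_sum_delta (f s)) ip_suml.
apply: smooth_on_sum => // j; apply: smooth_onM => //; first exact: smooth_on_entry.
exact: smooth_on_cst.
Qed.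

Lemma smooth_on_dec (E : normedModType R) (U : set E) (f : E -> 'rV[R]_3) : open U ->
  smooth_on U f -> smooth_on U (fun s => dec (f s)).
Proof.
move=> oU sf; apply/(smooth_on_rowP oU) => i.
apply: (smooth_on_ext oU (f := fun s => \sum_j f s 0 j * e j 0 i)).
  by move=> s _; rewrite /dec summxE; apply: eq_bigr => j _; rewrite mxE.
apply: smooth_on_sum => // j; apply: smooth_onM => //; first exact: smooth_on_entry.
exact: smooth_on_cst.
Qed.

Lemma smooth_id : smooth_on setT (fun q : H => q).
Proof.
by apply/(smooth_on_rowP openT) => i; apply: smooth_on_coord; exact: openT.
Qed.

Lemma smooth_crdf X : smooth_on setT X -> smooth_on setT (crdf X).
Proof.
have oT := @openT H; move=> sX; apply: smooth_on_crd => //.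
apply: smooth_on_vecq => //; apply: smooth_on_qmul => //.
by apply: smooth_on_qconj => //; exact: smooth_id.
Qed.

Lemma smooth_crdfi X k : smooth_on setT X -> smooth_on setT (fun q => crdf X q 0 k).
Proof. by move=> sX; apply: smooth_on_entry; [exact: openT|exact: smooth_crdf]. Qed.

Lemma vfield_left a : vfield (left_field a : H -> H).
Proof.
have oT := @openT H; split=> [|p _]; last exact: tangent_left.
apply: smooth_on_qmul => //; first exact: smooth_id.
exact: smooth_on_cst.
Qed.

Lemma crdf_left a p : SU2 p -> crdf (left_field a) p = crd a.
Proof. by move=> hp; rewrite /crdf /left_field qconjK// imqK. Qed.

Lemma vfieldE X p : vfield X -> SU2 p -> X p = qmul p (imq (dec (crdf X p))).
Proof. by move=> [_ tX] hp; rewrite crdK; apply: tangent_imq => //; exact: tX. Qed.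

Definition dir X (f : H -> 'rV[R]_3) : H -> 'rV[R]_3 :=
  fun p => \row_k 'D_(X p) (fun q => f q 0 k) p.

Lemma eq_dir X f g p : vfield X -> SU2 p -> smooth_on setT f -> smooth_on setT g ->
  (forall q, SU2 q -> f q = g q) -> dir X f p = dir X g p.
Proof.
move=> [_ tX] hp sf sg fg; apply/rowP => k; rewrite !mxE.
have sm (h : H -> 'rV[R]_3) : smooth_on setT h -> differentiable (fun q => h q 0 k : R) p.
  by move=> sh; apply: (smooth_on_differentiable (smooth_on_entry openT k sh)).
by apply: eq_derive_SU2 => //; [exact: tX|exact: sm|exact: sm|move=> q /fg ->].
Qed.

Lemma dir_cst X (c : 'rV[R]_3) p : dir X (fun=> c) p = 0.
Proof. by apply/rowP => k; rewrite !mxE derive_cst. Qed.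

Lemma dir_eq_cst X f (c : 'rV[R]_3) p : vfield X -> SU2 p -> smooth_on setT f ->
  (forall q, SU2 q -> f q = c) -> dir X f p = 0.
Proof.
move=> vX hp sf fc; rewrite (eq_dir (g := fun=> c))// ?dir_cst//.
by apply: smooth_on_cst; exact: openT.
Qed.

(** On the sphere [Y] agrees with the map q -> q y(q), where y(q) is imaginary. As [X p] is tangent,
    the product rule may be applied to this map in place of [Y]. *)
Lemma derive_vfield X Y p : vfield X -> vfield Y -> SU2 p ->
  'D_(X p) Y p = qmul (X p) (imq (dec (crdf Y p))) + qmul p (imq (dec (dir X (crdf Y) p))).
Proof.
move=> [sX tX] vY hp; have [sY _] := vY.
pose y k q := crdf Y q 0 k; pose Y' q := qmul q (imq (dec (crdf Y q))).
have sY' : smooth_on setT Y'.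
  have oT := @openT H; apply: smooth_on_qmul => //; first exact: smooth_id.
  by apply: smooth_on_imq => //; apply: smooth_on_dec => //; exact: smooth_crdf.
have dY : differentiable Y p by exact: smooth_on_differentiable sY _.
have dY' : differentiable Y' p by exact: smooth_on_differentiable sY' _.
have dy k : is_derive p (X p) (y k) ('D_(X p) (y k) p).
  apply: DeriveDef => //; apply: diff_derivable.
  exact: smooth_on_differentiable (smooth_crdfi k sY) _.
have dq j : is_derive p (X p) (fun q : H => q 0 j) (X p 0 j).
  have dj := differentiable_coord p 0 j.
  apply: DeriveDef; first exact: diff_derivable.
  have [] := @linear_derive R H (fun q => q 0 j) p (X p) => //.
    by move=> a u v; rewrite !mxE.
  exact: coord_continuous.
transitivity ('D_(X p) Y' p).
  apply/rowP => j; rewrite !derive_row//.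
  apply: eq_derive_SU2 => //; [exact: tX|exact: (differentiable_rowP Y p).1
    |exact: (differentiable_rowP Y' p).1|by move=> q hq; rewrite [in LHS](vfieldE vY hq)].
have decE q j : dec (crdf Y q) 0 j = y 0 q * e 0 0 j + y 1 q * e 1 0 j + y 2 q * e 2 0 j.
  by rewrite /y /dec sum3 !mxE.
have ddecE j : dec (dir X (crdf Y) p) 0 j = 'D_(X p) (y 0) p * e 0 0 j
    + 'D_(X p) (y 1) p * e 1 0 j + 'D_(X p) (y 2) p * e 2 0 j.
  by rewrite /dec sum3 !mxE.
apply/rowP => j; rewrite derive_row//; apply: derive_val.
have db k : is_derive p (X p) (fun q => dec (crdf Y q) 0 k) (dec (dir X (crdf Y) p) 0 k).
  rewrite ddecE; under eq_fun do rewrite decE.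
  by apply: is_derive_eq; rewrite /GRing.scale /=; ring.
rewrite mxE /Y' /qmul /imq.
case: (I4P j) => ->; under eq_fun do rewrite !quatE; rewrite !quatE;
  by apply: is_derive_eq; rewrite /GRing.scale /=; ring.
Qed.

Variable l : 'I_3 -> R.
Hypotheses (h1 : lie (e 1) (e 2) = l 0 *: e 0) (h2 : lie (e 2) (e 0) = l 1 *: e 1)
  (h3 : lie (e 0) (e 1) = l 2 *: e 2).

(** By bilinearity the three structure relations suffice. This is Milnor's form of the bracket of a
    unimodular Lie algebra: a self-adjoint map, diagonal in this frame, applied to the cross
    product. *)
Lemma lie_dec (x y : 'rV[R]_3) : lie (dec x) (dec y) = dec (diag3 l (cross x y)).
Proof.
have l0 a : lie 0 a = 0 by rewrite lieE (_ : cross _ _ = 0) ?scaler0//;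
  apply: row3P; rewrite /cross !mxE /=; ring.
have laa a : lie a a = 0 by rewrite lieE (_ : cross _ _ = 0) ?scaler0//;
  apply: row3P; rewrite /cross !mxE /=; ring.
have lD a b c : lie (a + b) c = lie a c + lie b c.
  by rewrite -[a]scale1r lie_linearl !scale1r.
have lZ k a c : lie (k *: a) c = k *: lie a c.
  by rewrite -[k *: a]addr0 lie_linearl l0 addr0.
have rD a b c : lie c (a + b) = lie c a + lie c b.
  by rewrite lieC lD opprD -!lieC.
have rZ k a c : lie c (k *: a) = k *: lie c a.
  by rewrite lieC lZ -scalerN -lieC.
rewrite /dec !sum3 !(lD, rD, lZ, rZ) !laa h1 h2 h3.
rewrite (lieC (e 2) (e 1)) (lieC (e 0) (e 2)) (lieC (e 1) (e 0)) h1 h2 h3.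
by apply: row3P; rewrite !mxE /=; ring.
Qed.

(** Milnor's constants, characterised by [mu 0 + mu 1 = l 2] and its cyclic analogues. With M and L
    the diagonal matrices of [mu] and [l], these relations say M x × y - M y × x = L (x × y), which
    is the vanishing of the torsion. *)
Definition mu (i : 'I_3) : R := (l 0 + l 1 + l 2) / 2 - l i.

Lemma crdfE X p c : X p = qmul p (imq (dec c)) -> SU2 p -> crdf X p = c.
Proof. by move=> XE hp; rewrite /crdf XE qconjK// imqK decK. Qed.

(** In the ambient difference of derivatives, the terms that come from moving the base point are p x
    y and p y x, and their difference is the left translate of the Lie bracket. *)
Lemma crdf_bracket X Y p : vfield X -> vfield Y -> SU2 p ->
  crdf (bracket X Y) p = dir X (crdf Y) p - dir Y (crdf X) p
    + diag3 l (cross (crdf X p) (crdf Y p)).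
Proof.
move=> vX vY hp; apply: crdfE => //.
rewrite /bracket !derive_vfield// [in LHS](vfieldE vX hp) [in LHS](vfieldE vY hp).
rewrite -!qmulA; set a := dec (crdf X p); set b := dec (crdf Y p).
have decB c d : dec (c - d) = dec c - dec d.
  by rewrite /dec -sumrB; apply: eq_bigr => k _; rewrite !mxE scalerBl.
have decD c d : dec (c + d) = dec c + dec d.
  by rewrite /dec -big_split; apply: eq_bigr => k _; rewrite !mxE scalerDl.
rewrite decD decB -lie_dec -/a -/b imqD imqB imq_lie !(qmulBr, qmulDr).
move: (qmul p (qmul (imq a) (imq b))) (qmul p (qmul (imq b) (imq a))) => A B.
move: (qmul p (imq (dec (dir X _ p)))) (qmul p (imq (dec (dir Y _ p)))) => C D.
by apply/rowP => j; rewrite !mxE; ring.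
Qed.

Variable nabla : (H -> H) -> (H -> H) -> H -> H.
Hypothesis hnabla : levi_civita (left_metric ip) nabla.

Lemma vfield_nabla X Y : vfield X -> vfield Y -> vfield (nabla X Y).
Proof. by case: hnabla => h _ _ _ _; exact: h. Qed.

Lemma vfield_bracket X Y : vfield X -> vfield Y -> forall p, SU2 p ->
  nabla X Y p - nabla Y X p = bracket X Y p.
Proof. by case: hnabla => _ _ _ h _; exact: h. Qed.

Lemma crdfB X Y p : crdf (fun q => X q - Y q) p = crdf X p - crdf Y p.
Proof.
rewrite /crdf qmulBr -crdB; congr crd.
by rewrite -scaleN1r vecqD vecqZ scaleN1r.
Qed.

Lemma dir_dot X Y Z p : vfield X -> vfield Y -> vfield Z -> SU2 p ->
  'D_(X p) (fun q => left_metric ip q (Y q) (Z q)) p =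
  dot (dir X (crdf Y) p) (crdf Z p) + dot (crdf Y p) (dir X (crdf Z) p).
Proof.
move=> vX [sY _] [sZ _] hp.
have dW W k : smooth_on setT W ->
    is_derive p (X p) (fun q => crdf W q 0 k) (dir X (crdf W) p 0 k).
  move=> sW; rewrite mxE; apply: DeriveDef => //; apply: diff_derivable.
  exact: smooth_on_differentiable (smooth_crdfi k sW) _.
under eq_fun do rewrite left_metric_dot /dot.
have dY k := dW Y k sY; have dZ k := dW Z k sZ.
by apply: derive_val; apply: is_derive_eq; rewrite /dot /GRing.scale /=; ring.
Qed.

(* The Koszul argument: the defect of the formula below is symmetric in its first
   two arguments by the torsion axiom, and skew in its last two by the metric axiom. *)
Lemma crdf_nabla X Y p : vfield X -> vfield Y -> SU2 p ->
  crdf (nabla X Y) p = dir X (crdf Y) p + cross (diag3 mu (crdf X p)) (crdf Y p).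
Proof.
move=> + + hp.
pose d X Y := crdf (nabla X Y) p - dir X (crdf Y) p
  - cross (diag3 mu (crdf X p)) (crdf Y p).
pose T X Y Z := dot (d X Y) (crdf Z p).
have dC A B : vfield A -> vfield B -> d A B = d B A.
  move=> vA vB.
  have := crdf_bracket vA vB hp; have := crdfB (nabla A B) (nabla B A) p.
  rewrite {1}/crdf vfield_bracket// -/(crdf (bracket A B) p) => -> /eqP.
  rewrite -subr_eq0 => /eqP E; apply/eqP; rewrite -subr_eq0 -E; apply/eqP.
  by apply: row3P; rewrite /d /cross /diag3 /mu !mxE /=; field.
have skew A B C : vfield A -> vfield B -> vfield C -> T A B C = - T A C B.
  move=> vA vB vC; have := dir_dot vA vB vC hp.
  have [_ _ _ _ ->]// := hnabla; rewrite !left_metric_dot => E.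
  apply/eqP; rewrite -addr_eq0.
  have -> : T A B C + T A C B = (dot (crdf (nabla A B) p) (crdf C p) +
      dot (crdf B p) (crdf (nabla A C) p)) - (dot (dir A (crdf B) p) (crdf C p) +
      dot (crdf B p) (dir A (crdf C) p)).
    by rewrite /T /d /dot /cross /diag3 !mxE /=; ring.
  by rewrite E subrr.
have T0 A B C : vfield A -> vfield B -> vfield C -> T A B C = 0.
  move=> vA vB vC.
  have sym A' B' C' : vfield A' -> vfield B' -> T A' B' C' = T B' A' C'.
    by move=> vA' vB'; rewrite /T dC.
  suff : T A B C = - T A B C by lra.
  (* T(A,B,C) = - T(A,C,B) = - T(C,A,B) = T(C,B,A) = T(B,C,A) = - T(B,A,C) = - T(A,B,C). *)
  by rewrite [LHS]skew// sym// skew// sym// skew// sym// !opprK.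
move=> vX vY; have d0 : d X Y = 0.
  apply/rowP => k; have := T0 X Y (left_field (e k)) vX vY (vfield_left _).
  rewrite /T crdf_left//; have -> : crd (e k) = delta_mx 0 k.
    by apply/rowP => j; rewrite !mxE he eq_sym.
  by case: (I3P k) => ->; rewrite /dot !mxE /= ?mulr1 ?mulr0 ?addr0 ?add0r.
apply/eqP; rewrite -subr_eq0 opprD addrA; exact/eqP.
Qed.

End LeviCivita.

(** * Laplacian, curvature and energy densities in the frame *)

Section FrameOperators.
Variable R : realType.
Local Notation H := 'rV[R]_4.
Local Notation RH := (R^o * H)%type.
Variables (e : 'I_3 -> 'rV[R]_3) (l : 'I_3 -> R).
Local Notation mu := (mu l).
Implicit Types (f : H -> 'rV[R]_3).

Definition unitv (i : 'I_3) : 'rV[R]_3 := delta_mx 0 i.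

Definition nab (i : 'I_3) f : H -> 'rV[R]_3 :=
  fun p => dir (left_field (e i)) f p + mu i *: cross (unitv i) (f p).

(** The first-order correction of the rough Laplacian is absent because the covariant derivative of
    e_i along itself is mu_i e_i × e_i = 0. *)
Definition lapl f : H -> 'rV[R]_3 := fun p => - \sum_i nab i (nab i f) p.

(** The curvature tensor: by the Jacobi identity the commutator of the operators M x × and M y × is
    the product with M x × M y, and the subtracted term is the connection along the bracket L (x ×
    y). *)
Definition curvv (x y z : 'rV[R]_3) : 'rV[R]_3 :=
  cross (cross (diag3 mu x) (diag3 mu y) - diag3 mu (diag3 l (cross x y))) z.

Definition Svec f : H -> 'rV[R]_3 :=
  fun p => \sum_i curvv (nab i f p) (f p) (unitv i).

Lemma smooth_on_left (E : normedModType R) (U : set E) (a : 'rV[R]_3) (f : E -> H) :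
  open U -> smooth_on U f -> smooth_on U (fun s => left_field a (f s)).
Proof.
by move=> oU sf; apply: smooth_on_qmul => //; exact: smooth_on_cst.
Qed.

Lemma smooth_derive_vfield X (f : H -> R) : smooth_on setT X -> smooth_on setT f ->
  smooth_on setT (fun p => 'D_(X p) f p).
Proof.
move=> sX sf; have oT := @openT H.
apply: (smooth_on_ext oT (f := fun p => 'D_(\sum_j X p 0 j *: delta_mx 0 j) f p)).
  by move=> p _; rewrite -row_sum_delta.
by apply: smooth_on_dir => // j; exact: smooth_on_entry.
Qed.

Lemma smooth_dir X f : smooth_on setT X -> smooth_on setT f -> smooth_on setT (dir X f).
Proof.
have oT := @openT H; move=> sX sf; apply/(smooth_on_rowP oT) => k.
apply: (smooth_on_ext oT (f := fun p => 'D_(X p) (fun q => f q 0 k) p)).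
  by move=> p _; rewrite mxE.
by apply: smooth_derive_vfield => //; exact: smooth_on_entry.
Qed.

Lemma smooth_crossr (c : 'rV[R]_3) f : smooth_on setT f ->
  smooth_on setT (fun q => cross c (f q)).
Proof.
have oT := @openT H; move=> sf.
by apply: smooth_on_vec3 => //; apply: smooth_onB => //; apply: smooth_onM => //;
  (exact: smooth_on_cst || exact: smooth_on_entry).
Qed.

Lemma smooth_crossl (c : 'rV[R]_3) f : smooth_on setT f ->
  smooth_on setT (fun q => cross (f q) c).
Proof.
have oT := @openT H; move=> sf.
by apply: smooth_on_vec3 => //; apply: smooth_onB => //; apply: smooth_onM => //;
  (exact: smooth_on_cst || exact: smooth_on_entry).
Qed.

Lemma smooth_diag3 (m : 'I_3 -> R) f : smooth_on setT f ->
  smooth_on setT (fun q => diag3 m (f q)).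
Proof.
have oT := @openT H; move=> sf.
by apply: smooth_on_vec3 => //; apply: smooth_onM => //;
  (exact: smooth_on_cst || exact: smooth_on_entry).
Qed.

Lemma smooth_nab i f : smooth_on setT f -> smooth_on setT (nab i f).
Proof.
have oT := @openT H; move=> sf; apply: smooth_onD => //.
  by apply: smooth_dir => //; apply: smooth_on_left => //; exact: smooth_id.
apply/(smooth_on_rowP oT) => k.
apply: (smooth_on_ext oT (f := fun p => mu i * cross (unitv i) (f p) 0 k)).
  by move=> p _; rewrite [RHS]mxE.
apply: smooth_onM => //; first exact: smooth_on_cst.
by apply: smooth_on_entry => //; exact: smooth_crossr.
Qed.

Lemma is_derive_entry f p v k : smooth_on setT f ->
  is_derive p v (fun q => f q 0 k) ('D_v (fun q => f q 0 k) p).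
Proof.
move=> sf; apply: DeriveDef => //; apply: diff_derivable.
exact: (smooth_on_differentiable (smooth_on_entry openT k sf)).
Qed.

Lemma dir_cross_diag X f (c : 'rV[R]_3) p : smooth_on setT f ->
  dir X (fun q => cross (diag3 mu (f q)) c) p = cross (diag3 mu (dir X f p)) c.
Proof.
move=> sf; have df k := is_derive_entry p (X p) k sf.
apply: row3P; rewrite /cross /diag3 !(mxE, vec3E) /=; apply: derive_val;
  under eq_fun do rewrite !vec3E /=;
  by apply: is_derive_eq; rewrite /GRing.scale /=; ring.
Qed.

End FrameOperators.

Section EnergyDensities.
Variable R : realType.
Local Notation H := 'rV[R]_4.
Variables (ip : 'rV[R]_3 -> 'rV[R]_3 -> R) (e : 'I_3 -> 'rV[R]_3) (l : 'I_3 -> R).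
Hypothesis hip : inner_product ip.
Hypothesis he : forall i j, ip (e i) (e j) = (i == j)%:R.
Hypotheses (h1 : lie (e 1) (e 2) = l 0 *: e 0) (h2 : lie (e 2) (e 0) = l 1 *: e 1)
  (h3 : lie (e 0) (e 1) = l 2 *: e 2).
Variable nabla : (H -> H) -> (H -> H) -> H -> H.
Hypothesis hnabla : levi_civita (left_metric ip) nabla.
Local Notation E := (fun i => left_field (e i)).
Local Notation crdf := (crdf ip e).
Local Notation nab := (nab e l).
Implicit Types (X Y Z V : H -> H).

Let crdfN := crdf_nabla hip he h1 h2 h3 hnabla.
Let vN := vfield_nabla hnabla.

Lemma vfieldE_left i : vfield (E i : H -> H).
Proof. exact: vfield_left. Qed.
Local Hint Resolve vfieldE_left : core.

Lemma crd_e i : crd ip e (e i) = unitv R i.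
Proof. by apply/rowP => j; rewrite !mxE he eq_sym. Qed.

Lemma crdfE_left i p : SU2 p -> crdf (E i) p = unitv R i.
Proof. by move=> hp; rewrite crdf_left// crd_e. Qed.

Lemma diag3_unitv m i : diag3 m (unitv R i) = m i *: unitv R i.
Proof. by apply: row3P; case: (I3P i) => ->; rewrite /diag3 /unitv !mxE /=; ring. Qed.

Lemma cross_scalel k (a b : 'rV[R]_3) : cross (k *: a) b = k *: cross a b.
Proof. by apply: row3P; rewrite /cross !mxE /=; ring. Qed.

Lemma crossaa (a : 'rV[R]_3) : cross a a = 0.
Proof. by apply: row3P; rewrite /cross !mxE /=; ring. Qed.

Lemma cross0l (a : 'rV[R]_3) : cross 0 a = 0.
Proof. by apply: row3P; rewrite /cross !mxE /=; ring. Qed.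

Lemma cross_addl (a b c : 'rV[R]_3) : cross (a + b) c = cross a c + cross b c.
Proof. by apply: row3P; rewrite /cross !mxE /=; ring. Qed.

Lemma cross_subl (a b c : 'rV[R]_3) : cross (a - b) c = cross a c - cross b c.
Proof. by apply: row3P; rewrite /cross !mxE /=; ring. Qed.

Lemma diag3D m (a b : 'rV[R]_3) : diag3 m (a + b) = diag3 m a + diag3 m b.
Proof. by apply: row3P; rewrite /diag3 !mxE /=; ring. Qed.

Lemma diag3B m (a b : 'rV[R]_3) : diag3 m (a - b) = diag3 m a - diag3 m b.
Proof. by apply: row3P; rewrite /diag3 !mxE /=; ring. Qed.

Lemma cross_jacobi (a b c : 'rV[R]_3) :
  cross a (cross b c) - cross b (cross a c) = cross (cross a b) c.
Proof.
apply: row3P; rewrite [LHS]mxE [X in _ + X]mxE /cross !vec3E; ring.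
Qed.

Lemma crdf_nabla_frame i V p : vfield V -> SU2 p ->
  crdf (nabla (E i) V) p = nab i (crdf V) p.
Proof.
by move=> vV hp; rewrite crdfN// crdfE_left// diag3_unitv cross_scalel.
Qed.

Lemma crdf_sum (X : 'I_3 -> H -> H) p :
  crdf (fun q => \sum_i X i q) p = \sum_i crdf (X i) p.
Proof.
rewrite sum3 /crdf sum3.
by rewrite !(qmulDr, vecqD, crdD e hip).
Qed.

(** [nabla (E i) (E i)] vanishes on the sphere. For the iterated derivative, the formula for
    [nabla (E i) V] is known on the sphere only, so it is differentiated through [eq_dir]. *)
Lemma crdf_laplacian V p : vfield V -> SU2 p ->
  crdf (rough_laplacian nabla E V) p = lapl e l (crdf V) p.
Proof.
move=> vV hp; rewrite /rough_laplacian crdf_sum /lapl -sumrN.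
apply: eq_bigr => i _; rewrite (crdfB e hip).
have [sV _] := vV.
have N0 q : SU2 q -> crdf (nabla (E i) (E i)) q = 0.
  move=> hq; rewrite crdfN// crdfE_left// diag3_unitv cross_scalel crossaa scaler0.
  rewrite (dir_eq_cst _ _ (c := unitv R i)) ?addr0//.
    by apply: smooth_crdf => //; case: (vfieldE_left i).
  by move=> q' hq'; rewrite crdfE_left.
have vNEE : vfield (nabla (E i) (E i)) by exact: vN.
rewrite crdfN// N0//.
have X0 : nabla (E i) (E i) p = 0.
  by rewrite (vfieldE hip he vNEE hp) N0// /dec sum3 !mxE !scale0r !addr0 imq0 qmul0.
have -> : diag3 (mu l) 0 = 0 by apply: row3P; rewrite /diag3 !mxE /= mulr0.
rewrite cross0l addr0.
have -> : dir (nabla (E i) (E i)) (crdf V) p = 0.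
  by apply/rowP => k; rewrite !mxE X0 derive0.
rewrite sub0r; congr (- _).
rewrite crdf_nabla_frame//; last exact: vN.
rewrite /nab; congr (_ + _ *: cross _ _); last exact: crdf_nabla_frame.
apply: eq_dir => //.
- by apply: smooth_crdf => //; case: (vN (vfieldE_left i) vV).
- by apply: smooth_nab; exact: smooth_crdf.
- by move=> q hq; rewrite crdf_nabla_frame.
Qed.

(** Tangency comes from the torsion axiom, which makes the bracket a difference of two tangent
    fields on the sphere. *)
Lemma vfield_brk X Y : vfield X -> vfield Y -> vfield (bracket X Y).
Proof.
move=> vX vY; have [sX tX] := vX; have [sY tY] := vY; split.
  have oT := @openT H; apply/(smooth_on_rowP oT) => k.
  apply: (smooth_on_ext oT (f := fun p => 'D_(X p) (fun q => Y q 0 k) p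
      - 'D_(Y p) (fun q => X q 0 k) p)).
    move=> p _; rewrite /bracket [RHS]mxE -(derive_row _ _ (smooth_on_differentiable sY I)).
    by rewrite [X in _ = _ + X]mxE -(derive_row _ _ (smooth_on_differentiable sX I)).
  by apply: smooth_onB => //; apply: smooth_derive_vfield => //; exact: smooth_on_entry.
move=> p hp; rewrite -(vfield_bracket hnabla)//.
have [_ /(_ _ hp)] := vN vX vY; have [_ /(_ _ hp)] := vN vY vX.
by rewrite /tangent !sum4 !mxE => t1 t2; lra.
Qed.

(** The third field has constant coordinates, so its covariant derivative along any field is
    algebraic in that field. The derivatives of the coordinates of [X] and [Y] that then appear
    cancel against those in the bracket. *)
Lemma crdf_curv X Y i p : vfield X -> vfield Y -> SU2 p ->
  crdf (curv nabla X Y (E i)) p = curvv l (crdf X p) (crdf Y p) (unitv R i).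
Proof.
move=> vX vY hp; rewrite /curv !(crdfB e hip).
have sX := smooth_crdf e hip (proj1 vX); have sY := smooth_crdf e hip (proj1 vY).
have NE Z q : vfield Z -> SU2 q ->
    crdf (nabla Z (E i)) q = cross (diag3 (mu l) (crdf Z q)) (unitv R i).
  move=> vZ hq; rewrite crdfN// crdfE_left//.
  rewrite (dir_eq_cst _ _ (c := unitv R i)) ?add0r//.
    by apply: smooth_crdf => //; case: (vfieldE_left i).
  by move=> q' hq'; rewrite crdfE_left.
have NN Z W : vfield Z -> vfield W -> crdf (nabla Z (nabla W (E i))) p =
    cross (diag3 (mu l) (dir Z (crdf W) p)) (unitv R i)
    + cross (diag3 (mu l) (crdf Z p)) (cross (diag3 (mu l) (crdf W p)) (unitv R i)).
  move=> vZ vW; have vWE := vN vW (vfieldE_left i).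
  have sW := smooth_crdf e hip (proj1 vW).
  rewrite crdfN// NE//; congr (_ + _).
  rewrite -dir_cross_diag//; apply: eq_dir => //.
  - by apply: smooth_crdf => //; case: vWE.
  - by apply: smooth_crossl; exact: smooth_diag3.
  - by move=> q hq; rewrite NE.
rewrite !NN// NE//; last exact: vfield_brk.
rewrite (crdf_bracket hip he h1 h2 h3)// /curvv.
rewrite !(diag3B, diag3D, cross_subl, cross_addl) -cross_jacobi.
set a := cross (diag3 _ (dir X _ p)) _; set b := cross (diag3 _ (dir Y _ p)) _.
set c := cross (diag3 _ (diag3 _ _)) _.
set d := cross (diag3 _ (crdf X p)) _; set f := cross (diag3 _ (crdf Y p)) _.
move: a b c d f => a b c d f.
by apply/rowP => j; rewrite !mxE; ring.
Qed.

Lemma crdf_S V p : vfield V -> SU2 p ->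
  crdf (Sfield nabla E V) p = Svec e l (crdf V) p.
Proof.
move=> vV hp; rewrite /Sfield crdf_sum /Svec.
apply: eq_bigr => i _; rewrite crdf_curv//; last exact: vN.
by rewrite crdf_nabla_frame.
Qed.

Lemma eq_integral_vol (g : H -> H -> H -> R) (f1 f2 : H -> R) :
  (forall p, SU2 p -> f1 p = f2 p) -> integral_vol g f1 = integral_vol g f2.
Proof.
move=> f12; rewrite /integral_vol; apply: eq_Rintegral => x _.
apply: eq_Rintegral => y _; apply: eq_Rintegral => z _ /=.
rewrite f12// /SU2 /= sum4 /hopf !quatE.
have c0 := cos2Dsin2 (vec3 x y z 0 0); have c1 := cos2Dsin2 (vec3 x y z 0 1).
have c2 := cos2Dsin2 (vec3 x y z 0 2).
rewrite !exprMn -addrA -!mulrDr c1 c2 !mulr1; exact: c0.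
Qed.

Definition dens_vert (f : H -> 'rV[R]_3) p := \sum_i dot (nab i f p) (nab i f p).

Definition dens_bivert (f : H -> 'rV[R]_3) p :=
  dot (lapl e l f p) (lapl e l f p) - dot (lapl e l f p) (f p) ^+ 2.

Definition dens_bi (f : H -> 'rV[R]_3) p :=
  dot (Svec e l f p) (Svec e l f p) + dens_bivert f p.

Local Notation g := (left_metric ip).

Lemma vertical_energyE V : vfield V ->
  vertical_energy g nabla E V = 2^-1 * integral_vol g (dens_vert (crdf V)).
Proof.
move=> vV; rewrite /vertical_energy.
rewrite (@eq_integral_vol _ _ (dens_vert (crdf V)))// => p hp.
rewrite /dens_vert; apply: eq_bigr => i _.
by rewrite (left_metric_dot hip he) crdf_nabla_frame.
Qed.

Lemma vertical_bienergyE V : vfield V ->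
  vertical_bienergy g nabla E V = 2^-1 * integral_vol g (dens_bivert (crdf V)).
Proof.
move=> vV; rewrite /vertical_bienergy.
rewrite (@eq_integral_vol _ _ (dens_bivert (crdf V)))// => p hp.
by rewrite !(left_metric_dot hip he) crdf_laplacian.
Qed.

Lemma bienergyE V : vfield V ->
  bienergy g nabla E V = 2^-1 * integral_vol g (dens_bi (crdf V)).
Proof.
move=> vV; rewrite /bienergy; rewrite (@eq_integral_vol _ _ (dens_bi (crdf V)))// => p hp.
by rewrite !(left_metric_dot hip he) crdf_laplacian// crdf_S// /dens_bi -addrA.
Qed.

End EnergyDensities.

(** * Integration over the sphere *)

Section ParametricIntegrals.
Variable R : realType.
Local Notation mu := (@lebesgue_measure R).
Implicit Types (a b : R).

Lemma continuous_integrable (f : R -> R) a b : continuous f ->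
  mu.-integrable `[a, b] (EFin \o f).
Proof.
move=> cf; apply: continuous_compact_integrable; first exact: segment_compact.
exact: continuous_subspaceT.
Qed.

Lemma Rintegral_bound (f : R -> R) a b (C : R) : a <= b -> continuous f ->
  (forall x, a <= x <= b -> `|f x| <= C) ->
  `|\int[mu]_(x in `[a, b]) f x| <= C * (b - a).
Proof.
move=> ab cf fC; have mI := @measurable_itv R `[a, b].
apply: le_trans (le_normr_Rintegral (mu := mu) mI (continuous_integrable a b cf)) _.
have -> : C * (b - a) = \int[mu]_(x in `[a, b]) C.
  rewrite (Rintegral_cst mu mI); congr (_ * _); apply: esym.
  apply: (etrans (congr1 fine (@lebesgue_measure_itv R `[a, b]))).
  by rewrite /= lte_fin; case: ltgtP ab => //= [->]; rewrite subrr.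
apply: (le_Rintegral (mu := mu) mI).
- apply: (continuous_integrable (f := fun x => `|f x|)) => x.
  by apply: (@continuous_comp _ _ _ f (@Num.norm R R)); [exact: cf|exact: norm_continuous].
- by apply: (continuous_integrable (f := fun=> C)) => x; exact: cvg_cst.
- by move=> x; rewrite /= in_itv /=; exact: fC.
Qed.

Lemma continuous_section (T U V : topologicalType) (f : T * U -> V) (x : T) :
  continuous f -> continuous (fun y => f (x, y)).
Proof.
move=> cf y; apply: (@continuous_comp _ _ _ (fun y => (x, y)) f); last exact: cf.
by apply: cvg_pair => //; exact: cvg_cst.
Qed.

(** Compactness of [a, b] makes [f x] uniformly close to [f x0] there once [x] is near [x0]. *)
Lemma continuous_Rintegral (T : topologicalType) (f : T -> R -> R) a b :
  a <= b -> continuous (fun u : T * R => f u.1 u.2) ->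
  continuous (fun x => \int[mu]_(y in `[a, b]) f x y).
Proof.
move=> ab cf x0; apply/cvgrPdist_le => eps eps0.
(* The summand 1 keeps the denominator positive when [a = b]. *)
pose eta := eps / (b - a + 1).
have eta0 : 0 < eta by apply: divr_gt0 => //; lra.
have cfx x : continuous (f x) by exact: (@continuous_section _ _ _ (fun u => f u.1 u.2) x cf).
have H : \forall x \near x0, `[a, b]%classic `<=` [set y | `|f x0 y - f x y| <= eta].
  have /compact_near_coveringP cK := @segment_compact R a b.
  apply: (cK T (nbhs x0) (fun x y => `|f x0 y - f x y| <= eta)) => y Ky.
  have /cvgrPdist_le/(_ (eta / 2)) := cf (x0, y).
  rewrite divr_gt0// => /(_ isT) [[A B] /= [nA nB] AB].
  exists (B, A); first by [].
  move=> [y' x] /= [By' Ax].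
  have h1 := AB (x, y') (conj Ax By'); have h2 := AB (x0, y') (conj (nbhs_singleton nA) By').
  rewrite -(subrKA (f x0 y)) (splitr eta) (le_trans (ler_normD _ _))//.
  by rewrite lerD// distrC.
apply: filterS H => x fx.
have mI := @measurable_itv R `[a, b].
rewrite -RintegralB//; [|exact: continuous_integrable|exact: continuous_integrable].
apply: le_trans (Rintegral_bound (C := eta) ab _ _) _.
- by move=> y; apply: cvgB; exact: cfx.
- by move=> y hy; apply: fx; rewrite /= in_itv.
- by rewrite /eta mulrAC ler_pdivrMr; [rewrite ler_pM2l//; lra|lra].
Qed.

Lemma Rintegral_derive (F f : R -> R) a b : a < b ->
  (forall x, is_derive x (1 : R) F (f x)) -> continuous f ->
  \int[mu]_(x in `[a, b]) f x = F b - F a.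
Proof.
move=> ab dF cf; rewrite /Rintegral (@continuous_FTC2 _ f F a b)//.
- exact: continuous_subspaceT.
- have cF : continuous F.
    by move=> x; apply: differentiable_continuous; apply/derivable1_diffP; have [] := dF x.
  split; first by move=> x _; have [] := dF x.
    by apply: cvg_at_right_filter; exact: cF.
  by apply: cvg_at_left_filter; exact: cF.
- by move=> x _; rewrite derive1E; have [_] := dF x.
Qed.

(** The partial derivative is bounded on the compact rectangle [x - 1, x + 1] × [a, b], and the
    constant bound is the integrable majorant for differentiation under the integral sign. *)
Lemma is_derive_Rintegral (f df : R -> R -> R) a b (x : R) :
  (forall x y, is_derive x (1 : R) (f ^~ y) (df x y)) ->
  (forall x, continuous (f x)) ->
  continuous (fun u : R * R => df u.1 u.2) ->
  is_derive x (1 : R) (fun x => \int[mu]_(y in `[a, b]) f x y)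
    (\int[mu]_(y in `[a, b]) df x y).
Proof.
move=> fdf cf cdf.
have mI := @measurable_itv R `[a, b].
pose K : set (R * R) := `[x - 1, x + 1]%classic `*` `[a, b]%classic.
have cK : compact K by apply: compact_setX; exact: segment_compact.
have [M hM] : exists M, forall u, K u -> `|df u.1 u.2| <= M.
  (* The rectangle is empty when [b < a]. *)
  have [K0|/set0P K0] := eqVneq K set0; first by exists 0 => u; rewrite K0.
  have cdf' : {within K, continuous (fun u : R * R => `|df u.1 u.2|)}.
    apply: continuous_subspaceT => u.
    apply: (@continuous_comp _ _ _ (fun u : R * R => df u.1 u.2) (@Num.norm R R)).
      exact: cdf.
    exact: norm_continuous.
  have [c _ hc] := compact_EVT_max K0 cK cdf'.
  by exists `|df c.1 c.2| => u Ku; apply: hc; rewrite inE.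
have xI : `]x - 1, x + 1[%classic x by rewrite /= in_itv /=; lra.
have dE y z : partial1of2 f y z = df y z.
  by rewrite partial1of2E; have [] := fdf y z.
have intf y : `]x - 1, x + 1[%classic y -> mu.-integrable `[a, b] (EFin \o f y).
  by move=> _; exact: continuous_integrable.
have derf y z : `]x - 1, x + 1[%classic y -> `[a, b]%classic z -> derivable (f ^~ z) y 1.
  by move=> _ _; have [] := fdf y z.
have M0 (y : R) : 0 <= Num.max 0 M by rewrite le_max lexx.
have intM : mu.-integrable `[a, b] (EFin \o (fun=> Num.max 0 M)).
  by apply: continuous_integrable => y; exact: cvg_cst.
have ub y z : `]x - 1, x + 1[%classic y -> `[a, b]%classic z ->
    `|partial1of2 f y z| <= Num.max 0 M.
  move=> hy hz; rewrite dE le_max; apply/orP; right; apply: (hM (y, z)); split => //=.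
  by move: hy; rewrite /= !in_itv /= => /andP[? ?]; rewrite !ltW.
apply: DeriveDef.
  exact: (derivable_under_integral (mu := mu) mI xI intf derf M0 intM ub).
rewrite -derive1E (differentiation_under_integral (mu := mu) mI xI intf derf M0 intM ub).
by apply: eq_Rintegral => y _; rewrite dE.
Qed.

End ParametricIntegrals.

Section IteratedIntegral.
Variable R : realType.
Local Notation mu := (@lebesgue_measure R).
Local Notation R3 := (R * R * R)%type.
Implicit Types (f g : R -> R -> R -> R).

Definition box_int f : R :=
  \int[mu]_(x in `[0, pi / 2]) \int[mu]_(y in `[0, 2 * pi])
    \int[mu]_(z in `[0, 2 * pi]) f x y z.

Definition cont3 f := continuous (fun u : R3 => f u.1.1 u.1.2 u.2).

Lemma pi2_gt0 : 0 < pi / 2 :> R. Proof. by have := pi_gt0 R; lra. Qed.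
Lemma twopi_gt0 : 0 < 2 * pi :> R. Proof. by have := pi_gt0 R; lra. Qed.
Local Hint Resolve pi2_gt0 twopi_gt0 : core.
Let pi2_ge0 := ltW pi2_gt0.
Let twopi_ge0 := ltW twopi_gt0.

Lemma cont3_inner f x y : cont3 f -> continuous (f x y).
Proof. exact: (@continuous_section _ _ _ (fun u : R3 => f u.1.1 u.1.2 u.2) (x, y)). Qed.

Lemma cont3_int1 f : cont3 f ->
  continuous (fun u : R * R => \int[mu]_(z in `[0, 2 * pi]) f u.1 u.2 z).
Proof. by move=> cf; apply: (@continuous_Rintegral _ _ (fun u : R * R => f u.1 u.2)). Qed.

Lemma cont3_int1_inner f x : cont3 f ->
  continuous (fun y => \int[mu]_(z in `[0, 2 * pi]) f x y z).
Proof.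
move=> cf; exact: (@continuous_section _ _ _
  (fun u : R * R => \int[mu]_(z in `[0, 2 * pi]) f u.1 u.2 z) x (cont3_int1 cf)).
Qed.

Lemma cont3_int2 f : cont3 f ->
  continuous (fun x => \int[mu]_(y in `[0, 2 * pi]) \int[mu]_(z in `[0, 2 * pi]) f x y z).
Proof.
move=> cf; apply: (@continuous_Rintegral _ _
  (fun x y => \int[mu]_(z in `[0, 2 * pi]) f x y z)) => //; exact: cont3_int1.
Qed.

Lemma cont3_comp (T : topologicalType) (a b c : T -> R) f : cont3 f ->
  continuous a -> continuous b -> continuous c ->
  continuous (fun u => f (a u) (b u) (c u)).
Proof.
move=> cf ca cb cc u.
apply: (@continuous_comp _ _ _ (fun u => (a u, b u, c u))
  (fun u : R3 => f u.1.1 u.1.2 u.2)); last exact: cf.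
exact: cvg_pair (cvg_pair (ca u) (cb u)) (cc u).
Qed.

Lemma cont3_fst f x : cont3 f -> continuous (fun u : R * R => f x u.1 u.2).
Proof.
move=> cf; apply: (cont3_comp cf) => u; [exact: cvg_cst|exact: cvg_fst|exact: cvg_snd].
Qed.

Lemma cont3_snd f y : cont3 f -> continuous (fun u : R * R => f u.1 y u.2).
Proof.
move=> cf; apply: (cont3_comp cf) => u; [exact: cvg_fst|exact: cvg_cst|exact: cvg_snd].
Qed.

Lemma eq_box_int f g : (forall x y z, 0 <= x <= pi / 2 -> f x y z = g x y z) ->
  box_int f = box_int g.
Proof.
move=> fg; apply: eq_Rintegral => x; rewrite inE /= in_itv /= => xI.
by apply: eq_Rintegral => y _; apply: eq_Rintegral => z _; exact: fg.
Qed.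

Lemma box_intD f g : cont3 f -> cont3 g ->
  box_int (fun x y z => f x y z + g x y z) = box_int f + box_int g.
Proof.
move=> cf cg; rewrite /box_int.
under eq_Rintegral => x _.
  under eq_Rintegral => y _.
    rewrite (RintegralD (mu := mu) (@measurable_itv R _)); last 2 first.
    - by apply: continuous_integrable; exact: cont3_inner.
    - by apply: continuous_integrable; exact: cont3_inner.
    over.
  rewrite (RintegralD (mu := mu) (@measurable_itv R _)); last 2 first.
  - by apply: continuous_integrable; exact: cont3_int1_inner.
  - by apply: continuous_integrable; exact: cont3_int1_inner.
  over.
rewrite (RintegralD (mu := mu) (@measurable_itv R _))//.
- by apply: continuous_integrable; exact: cont3_int2.
- by apply: continuous_integrable; exact: cont3_int2.
Qed.

Lemma box_intZ f (k : R) : cont3 f ->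
  box_int (fun x y z => k * f x y z) = k * box_int f.
Proof.
move=> cf; rewrite /box_int.
under eq_Rintegral => x _.
  under eq_Rintegral => y _.
    rewrite (RintegralZl (mu := mu) _ (@measurable_itv R _)); last first.
      by apply: continuous_integrable; exact: cont3_inner.
    over.
  rewrite (RintegralZl (mu := mu) _ (@measurable_itv R _)); last first.
    by apply: continuous_integrable; exact: cont3_int1_inner.
  over.
rewrite (RintegralZl (mu := mu) _ (@measurable_itv R _))//.
by apply: continuous_integrable; exact: cont3_int2.
Qed.

Lemma box_int_bound f C : cont3 f ->
  (forall x y z, `|f x y z| <= C) -> `|box_int f| <= C * (2 * pi) * (2 * pi) * (pi / 2).
Proof.
move=> cf fC; have B (h : R -> R) (b D : R) : 0 <= b -> continuous h ->
    (forall x, `|h x| <= D) -> `|\int[mu]_(x in `[0, b]) h x| <= D * b.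
  by move=> b0 ch hD; rewrite -[X in D * X](subr0 b); exact: Rintegral_bound.
apply: (B) => // [|x]; first exact: cont3_int2.
apply: (B) => // [|y]; first exact: cont3_int1_inner.
by apply: (B) => //; exact: cont3_inner.
Qed.

Lemma Rintegral0 (a b : R) : \int[mu]_(x in `[a, b]) (0 : R) = 0.
Proof. by rewrite (Rintegral_cst mu (@measurable_itv R _)) mul0r. Qed.

(** In this and the next two lemmas the fundamental theorem of calculus reduces the integral to
    boundary terms. They cancel by periodicity in the two angles and vanish separately in the
    direction x. For y and x the inner integrals are first differentiated under the integral
    sign. *)
Lemma box_int_dz f df : cont3 df ->
  (forall x y z, is_derive z (1 : R) (f x y) (df x y z)) ->
  (forall x y, f x y (2 * pi) = f x y 0) -> box_int df = 0.
Proof.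
move=> cdf fdf per; rewrite /box_int.
under eq_Rintegral => x _.
  under eq_Rintegral => y _.
    rewrite (Rintegral_derive (F := f x y))// ?per ?subrr; last exact: cont3_inner.
    over.
  rewrite Rintegral0; over.
exact: Rintegral0.
Qed.

Lemma box_int_dy f df : cont3 f -> cont3 df ->
  (forall x y z, is_derive y (1 : R) (fun y => f x y z) (df x y z)) ->
  (forall x z, f x (2 * pi) z = f x 0 z) -> box_int df = 0.
Proof.
move=> cf cdf fdf per; rewrite /box_int.
have dF x y : is_derive y (1 : R) (fun y => \int[mu]_(z in `[0, 2 * pi]) f x y z)
    (\int[mu]_(z in `[0, 2 * pi]) df x y z).
  apply: (is_derive_Rintegral (f := f x) (df := df x)) => //.
    by move=> y'; exact: cont3_inner.
  exact: cont3_fst.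
under eq_Rintegral => x _.
  rewrite (Rintegral_derive twopi_gt0 (dF x) (cont3_int1_inner (x := x) cdf)).
  under eq_Rintegral do rewrite per.
  rewrite subrr; over.
exact: Rintegral0.
Qed.

Lemma box_int_dx f df : cont3 f -> cont3 df ->
  (forall x y z, is_derive x (1 : R) (fun x => f x y z) (df x y z)) ->
  (forall y z, f (pi / 2) y z = 0) -> (forall y z, f 0 y z = 0) -> box_int df = 0.
Proof.
move=> cf cdf fdf f1 f0; rewrite /box_int.
have dF x : is_derive x (1 : R) (fun x => \int[mu]_(y in `[0, 2 * pi])
    \int[mu]_(z in `[0, 2 * pi]) f x y z) (\int[mu]_(y in `[0, 2 * pi])
    \int[mu]_(z in `[0, 2 * pi]) df x y z).
  apply: (is_derive_Rintegral
    (f := fun x y => \int[mu]_(z in `[0, 2 * pi]) f x y z)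
    (df := fun x y => \int[mu]_(z in `[0, 2 * pi]) df x y z)).
  - move=> x' y; apply: (is_derive_Rintegral (f := fun x => f x y) (df := fun x => df x y)).
    + by move=> ?; exact: cont3_inner.
    + exact: cont3_snd.
  - by move=> x'; exact: cont3_int1_inner.
  - exact: cont3_int1.
rewrite (Rintegral_derive pi2_gt0 dF (cont3_int2 cdf)).
have Z (h : R -> R -> R) : (forall y z, h y z = 0) ->
    \int[mu]_(y in `[0, 2 * pi]) \int[mu]_(z in `[0, 2 * pi]) h y z = 0.
  move=> h0; under eq_Rintegral => y _.
    under eq_Rintegral do rewrite h0.
    rewrite Rintegral0; over.
  exact: Rintegral0.
by rewrite !Z// subrr.
Qed.

End IteratedIntegral.

(** * The sphere in Hopf coordinates *)

Section HopfCoordinates.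
Variable R : realType.
Local Notation H := 'rV[R]_4.
Local Notation R3 := (R * R * R)%type.
Local Notation lebesgue := (@lebesgue_measure R).

Lemma is_derive_row (E : normedModType R) n (f : E -> 'rV[R]_n) p v (d : 'rV[R]_n) :
  (forall i, is_derive p v (fun q => f q 0 i) (d 0 i)) -> is_derive p v f d.
Proof.
move=> fd; have df : derivable f p v.
  by apply/derivable_mxP => i j; rewrite ord1; have [] := fd j.
apply: DeriveDef => //; apply/rowP => j; rewrite derive_mx// mxE.
by have [_] := fd j.
Qed.

Definition hopf3 (x y z : R) : H := hopf (vec3 x y z).
Definition hopf_x (x y z : R) : H :=
  quat (- sin x * cos y) (- sin x * sin y) (cos x * cos z) (cos x * sin z).
Definition hopf_y (x y z : R) : H := quat (- cos x * sin y) (cos x * cos y) 0 0.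
Definition hopf_z (x y z : R) : H := quat 0 0 (- sin x * sin z) (sin x * cos z).

Lemma hopf3E x y z :
  hopf3 x y z = quat (cos x * cos y) (cos x * sin y) (sin x * cos z) (sin x * sin z).
Proof. by rewrite /hopf3 /hopf !vec3E. Qed.

Lemma is_derive_hopf_x x y z :
  is_derive x (1 : R) (fun x => hopf3 x y z) (hopf_x x y z).
Proof.
apply: is_derive_row => i; under eq_fun do rewrite hopf3E; rewrite /hopf_x.
by case: (I4P i) => ->; under eq_fun do rewrite quatE; rewrite quatE;
  apply: is_derive_eq; rewrite /GRing.scale /=; ring.
Qed.

Lemma is_derive_hopf_y x y z :
  is_derive y (1 : R) (fun y => hopf3 x y z) (hopf_y x y z).
Proof.
apply: is_derive_row => i; under eq_fun do rewrite hopf3E; rewrite /hopf_y.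
by case: (I4P i) => ->; under eq_fun do rewrite quatE; rewrite quatE;
  apply: is_derive_eq; rewrite /GRing.scale /=; ring.
Qed.

Lemma is_derive_hopf_z x y z :
  is_derive z (1 : R) (fun z => hopf3 x y z) (hopf_z x y z).
Proof.
apply: is_derive_row => i; under eq_fun do rewrite hopf3E; rewrite /hopf_z.
by case: (I4P i) => ->; under eq_fun do rewrite quatE; rewrite quatE;
  apply: is_derive_eq; rewrite /GRing.scale /=; ring.
Qed.

Definition hopf_d (x y z : R) (i : 'I_3) : H :=
  [:: hopf_x x y z; hopf_y x y z; hopf_z x y z]`_i.

Lemma derive_hopf x y z i :
  'D_(delta_mx 0 i) (@hopf R) (vec3 x y z) = hopf_d x y z i.
Proof.
have D (L : R -> 'rV[R]_3) t j : (forall h : R, L (h *: 1 + t) = h *: delta_mx 0 j + L t) ->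
    'D_(1 : R) (@hopf R \o L) t = 'D_(delta_mx 0 j) (@hopf R) (L t).
  by move=> Lh; exact: (@derive_comp_affine R R 'rV[R]_3 H L (@hopf R) t 1).
case: (I3P i) => ->.
- rewrite -(D (fun x => vec3 x y z)); first by have [_] := is_derive_hopf_x x y z.
  by move=> h; apply: row3P; rewrite /vec3 !mxE /= /GRing.scale /=; ring.
- rewrite -(D (fun y => vec3 x y z)); first by have [_] := is_derive_hopf_y x y z.
  by move=> h; apply: row3P; rewrite /vec3 !mxE /= /GRing.scale /=; ring.
- rewrite -(D (fun z => vec3 x y z)); first by have [_] := is_derive_hopf_z x y z.
  by move=> h; apply: row3P; rewrite /vec3 !mxE /= /GRing.scale /=; ring.
Qed.

Lemma det3 (A : 'M[R]_3) : \det A =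
  A 0 0 * (A 1 1 * A 2 2 - A 1 2 * A 2 1) - A 0 1 * (A 1 0 * A 2 2 - A 1 2 * A 2 0)
  + A 0 2 * (A 1 0 * A 2 1 - A 1 1 * A 2 0).
Proof.
rewrite (expand_det_row _ 0) sum3 /cofactor !det2 !mxE /=.
have -> : lift 0 0 = 1 :> 'I_3 by exact: val_inj.
have -> : lift 0 1 = 2 :> 'I_3 by exact: val_inj.
have -> : lift 1 0 = 0 :> 'I_3 by exact: val_inj.
have -> : lift 1 1 = 2 :> 'I_3 by exact: val_inj.
have -> : lift 2 0 = 0 :> 'I_3 by exact: val_inj.
have -> : lift 2 1 = 1 :> 'I_3 by exact: val_inj.
by rewrite /= !addn0 expr0 expr1 expr2; ring.
Qed.

(* With w = z - y, c = cos x and s = sin x, the coordinate fields are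
   (0, cos w, sin w), (c^2, - c s sin w, c s cos w) and (- s^2, - c s sin w, c s cos w)
   in the left trivialisation of the tangent bundle. *)
Definition hopf_left (x y z : R) (i : 'I_3) : 'rV[R]_3 :=
  let C := cos y * cos z + sin y * sin z in
  let S := cos y * sin z - sin y * cos z in
  [:: vec3 0 C S;
      vec3 (cos x ^+ 2) (- (cos x * sin x * S)) (cos x * sin x * C);
      vec3 (- (sin x ^+ 2)) (- (cos x * sin x * S)) (cos x * sin x * C)]`_i.

Lemma hopf_leftE x y z i :
  vecq (qmul (qconj (hopf3 x y z)) (hopf_d x y z i)) = hopf_left x y z i.
Proof.
rewrite hopf3E /hopf_d /hopf_left /hopf_x /hopf_y /hopf_z /vecq /qmul /qconj !quatE.
have := cos2Dsin2 x; have := cos2Dsin2 y; have := cos2Dsin2 z.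
move: (cos x) (sin x) (cos y) (sin y) (cos z) (sin z) => c s cy sy cz sz hz hy hx.
case: (I3P i) => ->; rewrite /= !quatE; congr vec3; try ring.
- transitivity ((c ^+ 2 + s ^+ 2) * (cy * cz + sy * sz)); first by ring.
  by rewrite hx mul1r.
- transitivity ((c ^+ 2 + s ^+ 2) * (cy * sz - sy * cz)); first by ring.
  by rewrite hx mul1r.
- transitivity (c ^+ 2 * (cy ^+ 2 + sy ^+ 2)); first by ring.
  by rewrite hy mulr1.
- transitivity (- (s ^+ 2 * (cz ^+ 2 + sz ^+ 2))); first by ring.
  by rewrite hz mulr1.
Qed.

Lemma det_hopf x y z :
  \det (\matrix_(i < 3, j < 3) hopf_left x y z i 0 j) = - (sin x * cos x).
Proof.
pose A := \matrix_(i < 3, j < 3) hopf_left x y z i 0 j.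
have AE i j : A i j = hopf_left x y z i 0 j by rewrite mxE.
rewrite -/A det3 !AE /hopf_left /= !vec3E.
have := cos2Dsin2 x; have := cos2Dsin2 y; have := cos2Dsin2 z.
move: (cos x) (sin x) (cos y) (sin y) (cos z) (sin z) => c s cy sy cz sz hz hy hx.
transitivity (- (s * c) * ((cy ^+ 2 + sy ^+ 2) * (cz ^+ 2 + sz ^+ 2)) *
  (c ^+ 2 + s ^+ 2)); first by ring.
by rewrite hx hy hz !mulr1.
Qed.

End HopfCoordinates.

Section BoxContinuity.
Variable R : realType.
Local Notation H := 'rV[R]_4.
Implicit Types (f g : R -> R -> R -> R).

Lemma cont3_eq f g : (forall x y z, f x y z = g x y z) -> cont3 g -> cont3 f.
Proof. by move=> fg; have -> : f = g by do 3![apply/funext => ?]; exact: fg. Qed.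

Lemma cont3D f g : cont3 f -> cont3 g -> cont3 (fun x y z => f x y z + g x y z).
Proof. by move=> cf cg u; apply: cvgD; [exact: cf|exact: cg]. Qed.

Lemma cont3M f g : cont3 f -> cont3 g -> cont3 (fun x y z => f x y z * g x y z).
Proof. by move=> cf cg u; apply: cvgM; [exact: cf|exact: cg]. Qed.

Lemma cont3N f : cont3 f -> cont3 (fun x y z => - f x y z).
Proof. by move=> cf u; apply: cvgN; exact: cf. Qed.

Lemma cont3_cst (c : R) : cont3 (fun _ _ _ => c).
Proof. by move=> u; exact: cvg_cst. Qed.

Lemma cont3_x (h : R -> R) : continuous h -> cont3 (fun x _ _ => h x).
Proof.
move=> ch u; apply: (@continuous_comp _ _ _ (fun u : R * R * R => u.1.1) h); last exact: ch.
by apply: (@continuous_comp _ _ _ (@fst (R * R) R) (@fst R R)); exact: cvg_fst.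
Qed.

Lemma cont3_y (h : R -> R) : continuous h -> cont3 (fun _ y _ => h y).
Proof.
move=> ch u; apply: (@continuous_comp _ _ _ (fun u : R * R * R => u.1.2) h); last exact: ch.
by apply: (@continuous_comp _ _ _ (@fst (R * R) R) (@snd R R)); [exact: cvg_fst|exact: cvg_snd].
Qed.

Lemma cont3_z (h : R -> R) : continuous h -> cont3 (fun _ _ z => h z).
Proof.
move=> ch u; apply: (@continuous_comp _ _ _ (fun u : R * R * R => u.2) h); last exact: ch.
exact: cvg_snd.
Qed.

Lemma cont3_sum n (F : 'I_n -> R -> R -> R -> R) : (forall i, cont3 (F i)) ->
  cont3 (fun x y z => \sum_i F i x y z).
Proof.
move=> cF u; apply: cvg_big => [|i _]; [exact: add_continuous|exact: cF].
Qed.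

Lemma continuous_row (T : topologicalType) n (h : T -> 'rV[R]_n) :
  (forall i, continuous (fun u => h u 0 i)) -> continuous h.
Proof.
move=> ch; have -> : h = fun u => \sum_i h u 0 i *: delta_mx 0 i.
  by apply/funext => u; rewrite -row_sum_delta.
move=> u; apply: cvg_big => [|i _]; first exact: add_continuous.
by apply: cvgZr_tmp; exact: ch.
Qed.

Lemma cont3_hopf (f : H -> R) : continuous f -> cont3 (fun x y z => f (hopf3 x y z)).
Proof.
move=> cf u; apply: (@continuous_comp _ _ _ (fun u => hopf3 u.1.1 u.1.2 u.2) f);
  last exact: cf.
have [cs cc] := (@continuous_sin R, @continuous_cos R).
have M f1 f2 := @cont3M f1 f2.
apply: continuous_row => i.
pose F j : R -> R -> R -> R := fun x y z => hopf3 x y z 0 j.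
suff K j : cont3 (F j) by exact: (K i).
case: (I4P j) => -> {i j}; rewrite /F.
- apply: (@cont3_eq _ (fun x y z => cos x * cos y)) => [x y z|]; first by rewrite hopf3E quatE.
  by apply: M; [exact: cont3_x|exact: cont3_y].
- apply: (@cont3_eq _ (fun x y z => cos x * sin y)) => [x y z|]; first by rewrite hopf3E quatE.
  by apply: M; [exact: cont3_x|exact: cont3_y].
- apply: (@cont3_eq _ (fun x y z => sin x * cos z)) => [x y z|]; first by rewrite hopf3E quatE.
  by apply: M; [exact: cont3_x|exact: cont3_z].
- apply: (@cont3_eq _ (fun x y z => sin x * sin z)) => [x y z|]; first by rewrite hopf3E quatE.
  by apply: M; [exact: cont3_x|exact: cont3_z].
Qed.

(** Integration against the round volume form of the unit sphere. It is invariant under left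
    translations, so the volume form of a left-invariant metric is a constant multiple of it. *)
Definition sphere_int (f : H -> R) : R :=
  box_int (fun x y z => f (hopf3 x y z) * (sin x * cos x)).

Lemma cont3_sphere (f : H -> R) : continuous f ->
  cont3 (fun x y z => f (hopf3 x y z) * (sin x * cos x)).
Proof.
move=> cf; apply: cont3M; first exact: cont3_hopf.
by apply: cont3M; apply: cont3_x; [exact: continuous_sin|exact: continuous_cos].
Qed.

Lemma sphere_intD (f g : H -> R) : continuous f -> continuous g ->
  sphere_int (fun p => f p + g p) = sphere_int f + sphere_int g.
Proof.
move=> cf cg; rewrite /sphere_int -box_intD; [|exact: cont3_sphere|exact: cont3_sphere].
by congr box_int; do 3![apply/funext => ?]; rewrite mulrDl.
Qed.

Lemma sphere_intZ (f : H -> R) (k : R) : continuous f ->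
  sphere_int (fun p => k * f p) = k * sphere_int f.
Proof.
move=> cf; rewrite /sphere_int -box_intZ; last exact: cont3_sphere.
by congr box_int; do 3![apply/funext => ?]; rewrite -mulrA.
Qed.

Lemma SU2_hopf3 (x y z : R) : SU2 (hopf3 x y z).
Proof.
rewrite /SU2 /= sum4 hopf3E !quatE.
have := cos2Dsin2 x; have := cos2Dsin2 y; have := cos2Dsin2 z => hz hy hx.
by rewrite !exprMn -addrA -!mulrDr hy hz !mulr1.
Qed.

Lemma eq_sphere_int (f g : H -> R) : (forall p, SU2 p -> f p = g p) ->
  sphere_int f = sphere_int g.
Proof. by move=> fg; apply: eq_box_int => x y z _; rewrite fg//; exact: SU2_hopf3. Qed.

(** The volume of the coordinate box; the weight sin x cos x has absolute value at most 1. *)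
Definition sphere_bound : R := (2 * pi) * (2 * pi) * (pi / 2).

Lemma sphere_int_bound (f : H -> R) C : continuous f ->
  (forall p, SU2 p -> `|f p| <= C) -> `|sphere_int f| <= C * sphere_bound.
Proof.
move=> cf fC.
have -> : C * sphere_bound = C * (2 * pi) * (2 * pi) * (pi / 2).
  by rewrite /sphere_bound; ring.
apply: box_int_bound => [|x y z].
  exact: cont3_sphere.
rewrite normrM -[C]mulr1; apply: ler_pM => //; first by apply: fC; exact: SU2_hopf3.
rewrite normrM -[1]mulr1; apply: ler_pM => //; rewrite ler_norml.
  by rewrite sin_geN1 sin_le1.
by rewrite cos_geN1 cos_le1.
Qed.

(** The weight has the antiderivative (sin x)^2 / 2. Strict positivity allows the volume to be
    cancelled when a vanishing derivative of the energy is turned into a vanishing gradient. *)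
Lemma sphere_int1_gt0 : 0 < sphere_int (fun=> 1).
Proof.
rewrite /sphere_int /box_int.
have M := @measurable_itv R `[0, 2 * pi].
have V : fine (lebesgue_measure (`[0, 2 * pi]%classic : set R)) = 2 * pi.
  apply: (etrans (congr1 fine (@lebesgue_measure_itv R `[0, 2 * pi]))).
  by rewrite /= lte_fin twopi_gt0 /= subr0.
under eq_Rintegral => x _.
  under eq_Rintegral => y _.
    rewrite (Rintegral_cst (@lebesgue_measure R) M) V; over.
  rewrite (Rintegral_cst (@lebesgue_measure R) M) V; over.
have dF x : is_derive x (1 : R) (fun x : R => (sin x) ^+ 2 / 2 * (2 * pi) * (2 * pi))
    (1 * (sin x * cos x) * (2 * pi) * (2 * pi)).
  by apply: is_derive_eq; rewrite /GRing.scale /=; field.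
rewrite (Rintegral_derive (@pi2_gt0 R) dF).
  rewrite sin_pihalf sin0 expr1n expr0n /= mul0r !mul0r subr0.
  by rewrite !mulr_gt0 ?invr_gt0 ?pi_gt0.
move=> x; apply: cvgM; last exact: cvg_cst.
apply: cvgM; last exact: cvg_cst; apply: cvgM; first exact: cvg_cst.
by apply: cvgM; [exact: continuous_sin|exact: continuous_cos].
Qed.

End BoxContinuity.

Section Divergence.
Variable R : realType.
Local Notation H := 'rV[R]_4.

Definition hopf_comp (a : 'rV[R]_3) (x y z : R) (i : 'I_3) : R :=
  let C := cos y * cos z + sin y * sin z in
  let S := cos y * sin z - sin y * cos z in
  [:: sin x * cos x * (a 0 1 * C + a 0 2 * S);
      a 0 0 * (sin x * cos x) + sin x ^+ 2 * (a 0 2 * C - a 0 1 * S);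
      - (a 0 0 * (sin x * cos x)) + cos x ^+ 2 * (a 0 2 * C - a 0 1 * S)]`_i.

(* Up to the density sin x cos x, hopf_comp lists the components of the left-invariant
   field of a in the coordinate frame; they have no pole at x = 0 and x = pi / 2. *)
Lemma left_field_hopf (a : 'rV[R]_3) x y z :
  (sin x * cos x) *: left_field a (hopf3 x y z) =
  \sum_i hopf_comp a x y z i *: hopf_d x y z i.
Proof.
rewrite sum3 /hopf_comp /hopf_d /left_field /hopf_x /hopf_y /hopf_z hopf3E /imq /qmul.
have := cos2Dsin2 x; have := cos2Dsin2 y; have := cos2Dsin2 z.
move: (cos x) (sin x) (cos y) (sin y) (cos z) (sin z) (a 0 0) (a 0 1) (a 0 2).
move=> c s cy sy cz sz a0 a1 a2 hz hy hx.
have q (k x0 x1 x2 x3 : R) : k *: quat x0 x1 x2 x3 = quat (k * x0) (k * x1) (k * x2) (k * x3).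
  by apply: row4P; rewrite mxE !quatE.
have qD (x0 x1 x2 x3 y0 y1 y2 y3 : R) : quat x0 x1 x2 x3 + quat y0 y1 y2 y3 =
    quat (x0 + y0) (x1 + y1) (x2 + y2) (x3 + y3).
  by apply: row4P; rewrite mxE !quatE.
rewrite /= !q !qD !quatE; congr quat.
- transitivity (s * c * (- (c * sy * a0) - (cy ^+ 2 + sy ^+ 2) * (s * cz * a1 + s * sz * a2))).
    by rewrite hy; ring.
  by ring.
- transitivity (s * c * (c * cy * a0 + (cy ^+ 2 + sy ^+ 2) * (s * cz * a2 - s * sz * a1))).
    by rewrite hy; ring.
  by ring.
- transitivity (s * c * (s * sz * a0 + (cz ^+ 2 + sz ^+ 2) * (c * cy * a1 - c * sy * a2))).
    by rewrite hz; ring.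
  by ring.
- transitivity (s * c * (- (s * cz * a0) + (cz ^+ 2 + sz ^+ 2) * (c * cy * a2 + c * sy * a1))).
    by rewrite hz; ring.
  by ring.
Qed.

(** Left-invariant fields preserve the round volume: the coordinate divergence of [hopf_comp] is a_1
    C + a_2 S times (cos x)^2 - (sin x)^2 + (sin x)^2 - (cos x)^2 = 0. The integrand is therefore a
    sum of three coordinate derivatives; the first primitive has the factor sin x cos x and vanishes
    at both ends, the other two are periodic. *)
Lemma sphere_int_left (a : 'rV[R]_3) (f : H -> R) : smooth_on setT f ->
  sphere_int (fun p => 'D_(left_field a p) f p) = 0.
Proof.
move=> sf; have df p : differentiable f p by exact: smooth_on_differentiable sf _.
have cf : continuous f by move=> p; exact: smooth_on_continuous sf _.
pose F i x y z := hopf_comp a x y z i * f (hopf3 x y z).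
pose Df i x y z := 'D_(hopf_d x y z i) f (hopf3 x y z).
pose C y z : R := cos y * cos z + sin y * sin z.
pose S y z : R := cos y * sin z - sin y * cos z.
pose dF0 x y z := (cos x ^+ 2 - sin x ^+ 2) * (a 0 1 * C y z + a 0 2 * S y z)
  * f (hopf3 x y z) + hopf_comp a x y z 0 * Df 0 x y z.
pose dF1 x y z := sin x ^+ 2 * (a 0 2 * S y z + a 0 1 * C y z)
  * f (hopf3 x y z) + hopf_comp a x y z 1 * Df 1 x y z.
pose dF2 x y z := - (cos x ^+ 2 * (a 0 2 * S y z + a 0 1 * C y z))
  * f (hopf3 x y z) + hopf_comp a x y z 2 * Df 2 x y z.
have cs := cont3_x (@continuous_sin R); have cc := cont3_x (@continuous_cos R).
have csy := cont3_y (@continuous_sin R); have ccy := cont3_y (@continuous_cos R).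
have csz := cont3_z (@continuous_sin R); have ccz := cont3_z (@continuous_cos R).
have cC : cont3 (fun _ y z => C y z).
  exact: cont3D (cont3M ccy ccz) (cont3M csy csz).
have cS : cont3 (fun _ y z => S y z).
  exact: cont3D (cont3M ccy csz) (cont3N (cont3M csy ccz)).
have csc := cont3M cs cc; have cs2 := cont3M cs cs; have cc2 := cont3M cc cc.
have ca i := @cont3_cst R (a 0 i).
have cT : cont3 (fun _ y z => a 0 2 * C y z - a 0 1 * S y z).
  exact: cont3D (cont3M (ca 2) cC) (cont3N (cont3M (ca 1) cS)).
have chopf i : cont3 (fun x y z => hopf_comp a x y z i).
  case: (I3P i) => ->; rewrite /hopf_comp /=.
  - exact: cont3M csc (cont3D (cont3M (ca 1) cC) (cont3M (ca 2) cS)).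
  - exact: cont3D (cont3M (ca 0) csc) (cont3M cs2 cT).
  - exact: cont3D (cont3N (cont3M (ca 0) csc)) (cont3M cc2 cT).
pose G i j : R -> R -> R -> R := fun x y z => hopf_d x y z i 0 j.
have chd i j : cont3 (G i j).
  pose q (f0 f1 f2 f3 : R -> R -> R -> R) x y z k :=
    quat (f0 x y z) (f1 x y z) (f2 x y z) (f3 x y z) 0 k.
  have Q f0 f1 f2 f3 k : cont3 f0 -> cont3 f1 -> cont3 f2 -> cont3 f3 ->
      cont3 (fun x y z => q f0 f1 f2 f3 x y z k).
    move=> q0 q1 q2 q3; case: (I4P k) => ->.
    - by apply: cont3_eq q0 => x y z; rewrite /q quatE.
    - by apply: cont3_eq q1 => x y z; rewrite /q quatE.
    - by apply: cont3_eq q2 => x y z; rewrite /q quatE.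
    - by apply: cont3_eq q3 => x y z; rewrite /q quatE.
  case: (I3P i) => ->; rewrite /G /hopf_d /=.
  - by apply: cont3_eq (Q _ _ _ _ j (cont3M (cont3N cs) ccy) (cont3M (cont3N cs) csy)
      (cont3M cc ccz) (cont3M cc csz)) => x y z.
  - by apply: cont3_eq (Q _ _ _ _ j (cont3M (cont3N cc) csy) (cont3M cc ccy)
      (@cont3_cst R 0) (@cont3_cst R 0)) => x y z.
  - by apply: cont3_eq (Q _ _ _ _ j (@cont3_cst R 0) (@cont3_cst R 0)
      (cont3M (cont3N cs) csz) (cont3M cs ccz)) => x y z.
have cDf i : cont3 (Df i).
  apply: (@cont3_eq _ _ (fun x y z => \sum_j G i j x y z *
      'D_(delta_mx 0 j) f (hopf3 x y z))).
    by move=> x y z; exact: derive_coord.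
  apply: cont3_sum => j; apply: cont3M; first exact: chd.
  apply: (@cont3_hopf _ (fun p => 'D_(delta_mx 0 j) f p)) => p.
  exact: smooth_on_continuous (smooth_on_derive (delta_mx 0 j) sf) _.
have cfh := cont3_hopf cf.
have cF i : cont3 (F i) by exact: cont3M (chopf i) cfh.
have cT' : cont3 (fun _ y z => a 0 2 * S y z + a 0 1 * C y z).
  exact: cont3D (cont3M (ca 2) cS) (cont3M (ca 1) cC).
have c0 : cont3 dF0.
  exact: cont3D (cont3M (cont3M (cont3D cc2 (cont3N cs2))
    (cont3D (cont3M (ca 1) cC) (cont3M (ca 2) cS))) cfh) (cont3M (chopf 0) (cDf 0)).
have c1 : cont3 dF1.
  exact: cont3D (cont3M (cont3M cs2 cT') cfh) (cont3M (chopf 1) (cDf 1)).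
have c2 : cont3 dF2.
  exact: cont3D (cont3M (cont3N (cont3M cc2 cT')) cfh) (cont3M (chopf 2) (cDf 2)).
have E x y z : 'D_(left_field a (hopf3 x y z)) f (hopf3 x y z) * (sin x * cos x) =
    dF0 x y z + (dF1 x y z + dF2 x y z).
  have := derive_lincomb (hopf_comp a x y z) (hopf_d x y z) (df (hopf3 x y z)).
  rewrite -left_field_hopf deriveE// linearZ /= -deriveE// sum3 => e.
  by rewrite mulrC [LHS]e /dF0 /dF1 /dF2 /Df; ring.
have sE : sphere_int (fun p => 'D_(left_field a p) f p) =
    box_int dF0 + (box_int dF1 + box_int dF2).
  apply: etrans (congr1 (+%R (box_int dF0)) (box_intD c1 c2)).
  apply: etrans (box_intD c0 (cont3D c1 c2)).
  by apply: eq_box_int => x y z _; exact: E.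
have dx x y z : is_derive x (1 : R) (fun x => F 0 x y z) (dF0 x y z).
  have d := @is_derive_curve _ _ f (fun x => hopf3 x y z) x _ (df _) (is_derive_hopf_x x y z).
  rewrite /F /hopf_comp /=; apply: is_derive_eq.
  by rewrite /GRing.scale /dF0 /Df /hopf_comp /hopf_d /C /S /=; ring.
have dy x y z : is_derive y (1 : R) (fun y => F 1 x y z) (dF1 x y z).
  have d := @is_derive_curve _ _ f (fun y => hopf3 x y z) y _ (df _) (is_derive_hopf_y x y z).
  rewrite /F /hopf_comp /=; apply: is_derive_eq.
  by rewrite /GRing.scale /dF1 /Df /hopf_comp /hopf_d /C /S /=; ring.
have dz x y z : is_derive z (1 : R) (F 2 x y) (dF2 x y z).
  have d := @is_derive_curve _ _ f (fun z => hopf3 x y z) z _ (df _) (is_derive_hopf_z x y z).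
  rewrite /F /hopf_comp /=; apply: is_derive_eq.
  by rewrite /GRing.scale /dF2 /Df /hopf_comp /hopf_d /C /S /=; ring.
have [cos2 sin2] : cos (2 * pi) = 1 :> R /\ sin (2 * pi) = 0 :> R.
  by rewrite mulrC mulr_natr cos2pi sin2pi.
have I0 : box_int dF0 = 0.
  apply: (box_int_dx (cF 0) c0 dx) => y z; rewrite /F /hopf_comp /=.
    by rewrite cos_pihalf mulr0 !mul0r.
  by rewrite sin0 !mul0r.
have I1 : box_int dF1 = 0.
  apply: (box_int_dy (cF 1) c1 dy) => x z.
  by rewrite /F /hopf_comp !hopf3E /= cos2 sin2 cos0 sin0.
have I2 : box_int dF2 = 0.
  apply: (box_int_dz c2 dz) => x y.
  by rewrite /F /hopf_comp !hopf3E /= cos2 sin2 cos0 sin0.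
by rewrite sE I0 I1 I2 !addr0.
Qed.

End Divergence.

Section VolumeForm.
Variable R : realType.
Local Notation H := 'rV[R]_4.
Variables (ip : 'rV[R]_3 -> 'rV[R]_3 -> R) (e : 'I_3 -> 'rV[R]_3).
Hypothesis hip : inner_product ip.
Hypothesis he : forall i j, ip (e i) (e j) = (i == j)%:R.

Definition vol_factor : R := `|\det (crdmx ip e)|.

Lemma vol_factor_gt0 : 0 < vol_factor.
Proof. by rewrite normr_gt0; exact: det_crdmx_neq0. Qed.

(** The Gram matrix is A A^T, where the rows of A are the orthonormal coordinates of the
    left-translated coordinate fields, so the root of its determinant is |det A|. The range of x
    fixes the sign of sin x cos x. *)
Lemma sqrt_det_gram x y z : 0 <= x <= pi / 2 ->
  Num.sqrt (\det (gram (left_metric ip) (vec3 x y z))) = vol_factor * (sin x * cos x).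
Proof.
move=> xI; pose B := \matrix_(i < 3, j < 3) hopf_left x y z i 0 j.
have -> : gram (left_metric ip) (vec3 x y z) =
    (B *m crdmx ip e) *m (B *m crdmx ip e)^T.
  apply/matrixP => i j; rewrite !mxE !derive_hopf /left_metric -/(hopf3 x y z).
  rewrite !hopf_leftE (ip_dot hip he) !(crdE e hip) /dot sum3 ![_^T _ _]mxE.
  have K i' k : (hopf_left x y z i' *m crdmx ip e) 0 k = (B *m crdmx ip e) i' k.
    by rewrite !mxE; apply: eq_bigr => m _; rewrite [B _ _]mxE.
  by rewrite !K.
rewrite det_mulmx det_tr -expr2 sqrtr_sqr det_mulmx det_hopf normrM normrN mulrC.
congr (_ * _); rewrite ger0_norm// mulr_ge0//.
  by apply: sin_ge0_pi; have := pi_gt0 R; lra.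
by apply: cos_ge0_pihalf; lra.
Qed.

Lemma integral_volE (f : H -> R) : continuous f ->
  integral_vol (left_metric ip) f = vol_factor * sphere_int f.
Proof.
move=> cf; rewrite /sphere_int -box_intZ; last exact: cont3_sphere.
apply: eq_box_int => x y z xI.
by rewrite /= sqrt_det_gram// mulrCA.
Qed.

End VolumeForm.

(** * First variation *)

Section JointDerivatives.
Variable R : realType.
Local Notation H := 'rV[R]_4.
Local Notation RH := (R^o * H)%type.

(** A space derivative regarded as a function of time and space together, so that [strip_lipschitz]
    also applies to derivatives along the frame. *)
Definition joint_dir (a : 'rV[R]_3) (h : RH -> R) : RH -> R :=
  fun s => 'D_((0, left_field a s.2) : RH) h s.

Lemma smooth_on_snd (U : set RH) : open U -> smooth_on U (fun s : RH => s.2).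
Proof.
by move=> oU; apply/(smooth_on_rowP oU) => i; exact: smooth_on_snd_coord.
Qed.

Lemma smooth_joint_dir (U : set RH) a h : open U -> smooth_on U h ->
  smooth_on U (joint_dir a h).
Proof.
move=> oU sh.
apply: (smooth_on_ext oU (f := fun s => 'D_(\sum_j left_field a s.2 0 j *:
    ((0, delta_mx 0 j) : RH)) h s)).
  move=> s _; rewrite /joint_dir; congr ('D_ _ _ _).
  rewrite [in RHS](row_sum_delta (left_field a s.2)).
  apply: injective_projections => /=.
    by rewrite (raddf_sum (@fst R^o H)) big1// => j _; exact: scaler0.
  by rewrite (raddf_sum (@snd R^o H)); apply: eq_bigr.
apply: smooth_on_dir => // j; apply: smooth_on_entry => //.
by apply: smooth_on_left => //; exact: smooth_on_snd.
Qed.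

Lemma joint_dirE a (h : RH -> R) t p :
  joint_dir a h (t, p) = 'D_(left_field a p) (fun q => h (t, q)) p.
Proof.
rewrite /joint_dir.
rewrite -(@derive_comp_affine R H RH R (fun q => (t, q)) h p (left_field a p))//.
move=> k; rewrite /GRing.add /GRing.scale /= /add_pair /scale_pair /=.
by rewrite scaler0 add0r.
Qed.

End JointDerivatives.

Section FirstOrderRemainder.
Variable R : realType.

(** A remainder bounded by C t^2 has derivative 0 at 0, whatever its regularity elsewhere. *)
Lemma is_derive_remainder (F G : R -> R) (c d C delta : R) : 0 < delta ->
  (forall t, `|t| < delta -> `|F t - (c + G t)| <= C * t ^+ 2) ->
  is_derive (0 : R) (1 : R) G d -> is_derive (0 : R) (1 : R) F d.
Proof.
move=> delta0 FG dG; pose r t := F t - (c + G t).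
have C0 : 0 <= C.
  have h : `|delta / 2| < delta by rewrite ger0_norm; lra.
  have p : 0 < (delta / 2) ^+ 2 by rewrite exprn_gt0//; lra.
  by rewrite -(pmulr_lge0 _ p); apply: le_trans (FG _ h); exact: normr_ge0.
(* At t = 0 the bound itself forces F 0 = c + G 0. *)
have r0 : r 0 = 0.
  apply/eqP; rewrite -normr_le0; have := FG 0; rewrite normr0 expr0n mulr0; exact.
have dr : is_derive (0 : R) (1 : R) r 0.
  suff cr : (fun h : R => h^-1 *: ((r \o shift 0) (h *: (1 : R)) - r 0)) @ 0^' --> (0 : R).
    by apply: DeriveDef; [apply/cvg_ex; exists 0|exact: cvg_lim].
  apply/cvgrPdist_le => eps eps0.
  have : \forall h \near 0^', `|h : R| < Num.min delta (eps / (C + 1)).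
    apply: dnbhs0_lt; rewrite lt_min delta0 divr_gt0//; lra.
  move=> near; have nz : \forall h \near (0 : R)^', h != 0 by exact: nbhs_dnbhs_neq.
  apply: filterS2 near nz => h; rewrite lt_min => /andP[h1 h2] hn.
  rewrite sub0r normrN r0 subr0 /= addr0 /GRing.scale /= mulr1 normrM normfV.
  rewrite ler_pdivrMl ?normr_gt0//; apply: le_trans (FG _ h1) _.
  rewrite -real_normK ?num_real// expr2 mulrA [leRHS]mulrC ler_wpM2r//.
  rewrite ltr_pdivlMr in h2; last lra.
  have := normr_ge0 h; nra.
have -> : F = (fun t => r t + (c + G t)).
  by apply/funext => t; rewrite /r subrK.
by apply: is_derive_eq; rewrite !add0r mul1r.
Qed.

End FirstOrderRemainder.

(** * Calculus of first-order expansions *)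

Section ProductBounds.
Variable R : realType.
Implicit Types c a q C t : R.

(** One constant for both estimates: the first three summands bound the remainder of a product, the
    last one bounds its first-order part. *)
Definition product_const c1 c2 C1 C2 : R := C1 * C2 + C1 * (`|c2| + C2 + C2)
  + (`|c1| + C1) * C2 + (`|c1| * C2 + `|c2| * C1).

Lemma product_const_ge0 c1 c2 C1 C2 : 0 <= C1 -> 0 <= C2 ->
  0 <= product_const c1 c2 C1 C2.
Proof.
rewrite /product_const; have := normr_ge0 c1; have := normr_ge0 c2.
move: `|c1| `|c2| => n1 n2 h1 h2 h3 h4.
by rewrite !addr_ge0// mulr_ge0// !addr_ge0.
Qed.

Lemma product_first_order c1 c2 C1 C2 a1 a2 t : 0 <= C1 -> 0 <= C2 ->
  `|a1| <= C1 * `|t| -> `|a2| <= C2 * `|t| ->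
  `|c1 * a2 + c2 * a1| <= product_const c1 c2 C1 C2 * `|t|.
Proof.
move=> h1 h2 b1 b2; apply: le_trans (ler_normD _ _) _; rewrite !normrM /product_const.
have e1 : `|c1| * `|a2| <= `|c1| * (C2 * `|t|) by exact: ler_wpM2l.
have e2 : `|c2| * `|a1| <= `|c2| * (C1 * `|t|) by exact: ler_wpM2l.
apply: le_trans (lerD e1 e2) _.
have n1 := normr_ge0 c1; have n2 := normr_ge0 c2; have nt := normr_ge0 t.
move: (`|c1|) (`|c2|) (`|t|) n1 n2 nt => {e1 e2 b1 b2} n1 n2 s h3 h4 h5.
rewrite !mulrA -mulrDl; apply: ler_wpM2r => //; rewrite lerDr.
by rewrite !addr_ge0// mulr_ge0// !addr_ge0.
Qed.

(** The factors are c_i + a_i + q_i with first-order part a_i and remainder q_i. For |t| <= 1 both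
    are bounded by C_i, so each term of the product remainder keeps a factor t^2. *)
Lemma product_remainder c1 c2 C1 C2 a1 a2 q1 q2 t : 0 <= C1 -> 0 <= C2 -> `|t| <= 1 ->
  `|a1| <= C1 * `|t| -> `|a2| <= C2 * `|t| ->
  `|q1| <= C1 * t ^+ 2 -> `|q2| <= C2 * t ^+ 2 ->
  `|a1 * a2 + q1 * (c2 + a2 + q2) + (c1 + a1) * q2| <=
  product_const c1 c2 C1 C2 * t ^+ 2.
Proof.
move=> C10 C20 t1 B1 B2 Q1 Q2.
have tt : t ^+ 2 = `|t| ^+ 2 by rewrite real_normK ?num_real.
have tt1 : t ^+ 2 <= 1 by rewrite tt expr_le1.
have t20 : 0 <= t ^+ 2 by exact: sqr_ge0.
have Q2' : `|q2| <= C2 by apply: le_trans Q2 _; exact: ler_piMr.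
have B2' : `|a2| <= C2 by apply: le_trans B2 _; exact: ler_piMr.
have B1' : `|a1| <= C1 by apply: le_trans B1 _; exact: ler_piMr.
have e1 : `|a1 * a2| <= C1 * C2 * t ^+ 2.
  have -> : C1 * C2 * t ^+ 2 = C1 * `|t| * (C2 * `|t|) by rewrite tt expr2 mulrACA.
  by rewrite normrM; exact: ler_pM.
have e2 : `|q1 * (c2 + a2 + q2)| <= C1 * (`|c2| + C2 + C2) * t ^+ 2.
  rewrite normrM (mulrAC C1); apply: (ler_pM (normr_ge0 _) (normr_ge0 _) Q1).
  apply: le_trans (ler_normD _ _) _; apply: lerD Q2'.
  by apply: le_trans (ler_normD _ _) _; rewrite lerD2l.
have e3 : `|(c1 + a1) * q2| <= (`|c1| + C1) * C2 * t ^+ 2.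
  rewrite normrM -(mulrA (`|c1| + C1)).
  apply: (ler_pM (normr_ge0 _) (normr_ge0 _) _ Q2).
  by apply: le_trans (ler_normD _ _) _; rewrite lerD2l.
apply: le_trans (le_trans (ler_normD _ _) (lerD (le_trans (ler_normD _ _) (lerD e1 e2)) e3)) _.
rewrite -!mulrDl; apply: ler_wpM2r => //; rewrite /product_const lerDl.
by apply: addr_ge0; apply: mulr_ge0.
Qed.

End ProductBounds.

Section FirstOrderExpansion.
Variable R : realType.
Local Notation H := 'rV[R]_4.

Lemma continuous_add (f g : H -> R) : continuous f -> continuous g ->
  continuous (fun p => f p + g p).
Proof. by move=> cf cg p; apply: (@continuousD _ _ _ f g); [exact: cf|exact: cg]. Qed.

Lemma continuous_mul (f g : H -> R) : continuous f -> continuous g ->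
  continuous (fun p => f p * g p).
Proof. by move=> cf cg p; apply: (@continuousM _ _ f g); [exact: cf|exact: cg]. Qed.

Lemma continuous_scal (a : R) (f : H -> R) : continuous f -> continuous (fun p => a * f p).
Proof. by move=> cf; apply: continuous_mul => //; exact: cst_continuous. Qed.

Variables (w : R -> H -> 'rV[R]_3) (v : 'rV[R]_3) (delta : R).
Hypothesis delta1 : delta <= 1.
Hypothesis cw : forall t k, `|t| < delta -> continuous (fun p => w t p 0 k : R).
Implicit Types (h : R -> H -> R) (ell : 'rV[R]_3 -> R) (f : R -> H -> 'rV[R]_3)
  (L : 'rV[R]_3 -> 'rV[R]_3).

(* [expansion h c ell]: uniformly on the sphere h t = c + k t + O(t^2) with k t = O(t),
   where k t and ell (w t - v) have the same integral.  The pairs (c, ell) are multiplied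
   like dual numbers. *)
Definition expansion h (c : R) ell : Prop :=
  (exists g, forall u, ell u = dot g u) /\
  exists (k : R -> H -> R) (C : R), 0 <= C /\ forall t, `|t| < delta ->
    [/\ continuous (h t), continuous (k t),
        forall p, SU2 p -> `|h t p - c - k t p| <= C * t ^+ 2,
        forall p, SU2 p -> `|k t p| <= C * `|t|
      & sphere_int (k t) = sphere_int (fun p => ell (w t p - v))].

Lemma dotDr (a b c : 'rV[R]_3) : dot a (b + c) = dot a b + dot a c.
Proof. by rewrite /dot !mxE; ring. Qed.

Lemma dotDl (a b c : 'rV[R]_3) : dot (b + c) a = dot b a + dot c a.
Proof. by rewrite /dot !mxE; ring. Qed.

Lemma dotZl (k : R) (a b : 'rV[R]_3) : dot (k *: a) b = k * dot a b.
Proof. by rewrite /dot !mxE; ring. Qed.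

Lemma continuous_ell g t : `|t| < delta -> continuous (fun p => dot g (w t p - v)).
Proof.
move=> ht.
pose G k : R := g 0 k; pose F k (p : H) : R := w t p 0 k - v 0 k.
have c1 k : continuous (fun p => G k * F k p).
  apply: continuous_scal; apply: (@continuous_add (fun p => w t p 0 k)).
    exact: (@cw t k ht).
  exact: cst_continuous.
have -> : (fun p => dot g (w t p - v)) = fun p => G 0 * F 0 p + G 1 * F 1 p + G 2 * F 2 p.
  by apply/funext => p; rewrite /dot !mxE.
by do 2![apply: continuous_add => //].
Qed.

Lemma expansion_cst (c : R) : expansion (fun _ _ => c) c (fun=> 0).
Proof.
split; first by exists 0 => u; rewrite /dot !mxE; ring.
exists (fun _ _ => 0), 0; split=> // t ht; split.
- exact: cst_continuous.
- exact: cst_continuous.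
- by move=> p _; rewrite subrr subr0 normr0 mul0r.
- by move=> p _; rewrite normr0 mul0r.
- by [].
Qed.

Lemma expansionD h1 h2 c1 c2 ell1 ell2 :
  expansion h1 c1 ell1 -> expansion h2 c2 ell2 ->
  expansion (fun t p => h1 t p + h2 t p) (c1 + c2) (fun u => ell1 u + ell2 u).
Proof.
move=> [[g1 G1] [k1 [C1 [C10 H1]]]] [[g2 G2] [k2 [C2 [C20 H2]]]].
rewrite {ell1 G1}(funext G1 : ell1 = dot g1) in H1 *.
rewrite {ell2 G2}(funext G2 : ell2 = dot g2) in H2 *.
split; first by exists (g1 + g2) => u; rewrite dotDl.
exists (fun t p => k1 t p + k2 t p), (C1 + C2); split=> [|t ht]; first exact: addr_ge0.
have [ch1 ck1 r1 b1 i1] := H1 t ht; have [ch2 ck2 r2 b2 i2] := H2 t ht.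
split.
- exact: continuous_add.
- exact: continuous_add.
- move=> p hp; rewrite mulrDl.
  have -> : h1 t p + h2 t p - (c1 + c2) - (k1 t p + k2 t p) =
    (h1 t p - c1 - k1 t p) + (h2 t p - c2 - k2 t p) by ring.
  by apply: le_trans (ler_normD _ _) _; apply: lerD; [exact: r1|exact: r2].
- move=> p hp; rewrite mulrDl.
  by apply: le_trans (ler_normD _ _) _; apply: lerD; [exact: b1|exact: b2].
- rewrite (sphere_intD ck1 ck2) i1 i2.
  by rewrite (sphere_intD (@continuous_ell g1 t ht) (@continuous_ell g2 t ht)).
Qed.

(** Since [c1] and [c2] are constant on the sphere, the integral of the new first-order part follows
    by linearity; products of two first-order parts go into the remainder. *)
Lemma expansionM h1 h2 c1 c2 ell1 ell2 :
  expansion h1 c1 ell1 -> expansion h2 c2 ell2 ->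
  expansion (fun t p => h1 t p * h2 t p) (c1 * c2) (fun u => c1 * ell2 u + c2 * ell1 u).
Proof.
move=> [[g1 G1] [k1 [C1 [C10 H1]]]] [[g2 G2] [k2 [C2 [C20 H2]]]].
rewrite {ell1 G1}(funext G1 : ell1 = dot g1) in H1 *.
rewrite {ell2 G2}(funext G2 : ell2 = dot g2) in H2 *.
split; first by exists (c1 *: g2 + c2 *: g1) => u; rewrite dotDl !dotZl.
exists (fun t p => c1 * k2 t p + c2 * k1 t p), (product_const c1 c2 C1 C2).
split=> [|t ht]; first exact: product_const_ge0.
have [ch1 ck1 r1 b1 i1] := H1 t ht; have [ch2 ck2 r2 b2 i2] := H2 t ht.
have t1 : `|t| <= 1 by exact: le_trans (ltW ht) delta1.
split.
- exact: continuous_mul.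
- by apply: continuous_add; exact: continuous_scal.
- move=> p hp; have -> : h1 t p * h2 t p - c1 * c2 - (c1 * k2 t p + c2 * k1 t p) =
    k1 t p * k2 t p + (h1 t p - c1 - k1 t p) * (c2 + k2 t p + (h2 t p - c2 - k2 t p))
    + (c1 + k1 t p) * (h2 t p - c2 - k2 t p) by ring.
  exact: (product_remainder c1 c2 C10 C20 t1 (b1 p hp) (b2 p hp) (r1 p hp) (r2 p hp)).
- by move=> p hp; exact: (product_first_order c1 c2 C10 C20 (b1 p hp) (b2 p hp)).
- have ce1 := @continuous_ell g1 t ht; have ce2 := @continuous_ell g2 t ht.
  rewrite (sphere_intD (@continuous_scal c1 _ ck2) (@continuous_scal c2 _ ck1)).
  rewrite (sphere_intZ _ ck1) (sphere_intZ _ ck2) i1 i2.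
  rewrite (sphere_intD (@continuous_scal c1 _ ce2) (@continuous_scal c2 _ ce1)).
  by rewrite (sphere_intZ _ ce1) (sphere_intZ _ ce2).
Qed.

Lemma expansionZ (c : R) h ch ell : expansion h ch ell ->
  expansion (fun t p => c * h t p) (c * ch) (fun u => c * ell u).
Proof.
move=> eh; have := expansionM (expansion_cst c) eh.
by congr expansion; apply/funext => u; rewrite mulr0 addr0.
Qed.

Lemma expansionN h c ell : expansion h c ell ->
  expansion (fun t p => - h t p) (- c) (fun u => - ell u).
Proof.
move=> /(expansionZ (-1)); congr expansion; last 1 first.
- by apply/funext => u; rewrite mulN1r.
- by apply/funext => t; apply/funext => p; rewrite mulN1r.
- by rewrite mulN1r.
Qed.

Lemma expansionB h1 h2 c1 c2 ell1 ell2 :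
  expansion h1 c1 ell1 -> expansion h2 c2 ell2 ->
  expansion (fun t p => h1 t p - h2 t p) (c1 - c2) (fun u => ell1 u - ell2 u).
Proof. by move=> e1 e2; exact: (expansionD e1 (expansionN e2)). Qed.

Lemma expansion_ext h h' c c' ell ell' :
  (forall t p, `|t| < delta -> h t p = h' t p) -> c = c' -> (forall u, ell u = ell' u) ->
  expansion h c ell -> expansion h' c' ell'.
Proof.
move=> hh <- ee [[g G] [k [C [C0 Hk]]]]; have <- : ell = ell' by apply/funext.
split; first by exists g.
exists k, C; split; first exact: C0.
move=> t ht; have [ch ck r b i] := Hk t ht.
have hE : h t = h' t by apply/funext => p; exact: hh.
by split; rewrite -?hE; [exact: ch|exact: ck|exact: r|exact: b|exact: i].
Qed.

Definition vexpansion f (c : 'rV[R]_3) L : Prop :=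
  forall k, expansion (fun t p => f t p 0 k) (c 0 k) (fun u => L u 0 k).

Lemma vexpansion_cst (c : 'rV[R]_3) : vexpansion (fun _ _ => c) c (fun=> 0).
Proof.
move=> k; have := expansion_cst (c 0 k); apply: expansion_ext => // u.
by rewrite mxE.
Qed.

Lemma vexpansionD f1 f2 c1 c2 L1 L2 : vexpansion f1 c1 L1 -> vexpansion f2 c2 L2 ->
  vexpansion (fun t p => f1 t p + f2 t p) (c1 + c2) (fun u => L1 u + L2 u).
Proof.
move=> e1 e2 k; have := expansionD (e1 k) (e2 k).
by apply: expansion_ext => [t p _||u]; rewrite mxE.
Qed.

Lemma vexpansionB f1 f2 c1 c2 L1 L2 : vexpansion f1 c1 L1 -> vexpansion f2 c2 L2 ->
  vexpansion (fun t p => f1 t p - f2 t p) (c1 - c2) (fun u => L1 u - L2 u).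
Proof.
move=> e1 e2 k; have := expansionB (e1 k) (e2 k).
by apply: expansion_ext => [t p _||u]; rewrite !mxE.
Qed.

Lemma vexpansionN f c L : vexpansion f c L ->
  vexpansion (fun t p => - f t p) (- c) (fun u => - L u).
Proof.
move=> e1 k; have := expansionN (e1 k).
by apply: expansion_ext => [t p _||u]; rewrite !mxE.
Qed.

Lemma vexpansionZ (m : R) f c L : vexpansion f c L ->
  vexpansion (fun t p => m *: f t p) (m *: c) (fun u => m *: L u).
Proof.
move=> e1 k; have := expansionZ m (e1 k).
by apply: expansion_ext => [t p _||u]; rewrite !mxE.
Qed.

Lemma vexpansion_sum (f : 'I_3 -> R -> H -> 'rV[R]_3) (c : 'I_3 -> 'rV[R]_3)
    (L : 'I_3 -> 'rV[R]_3 -> 'rV[R]_3) : (forall i, vexpansion (f i) (c i) (L i)) ->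
  vexpansion (fun t p => \sum_i f i t p) (\sum_i c i) (fun u => \sum_i L i u).
Proof.
move=> ef k; have := vexpansionD (vexpansionD (ef 0) (ef 1)) (ef 2) k.
by apply: expansion_ext => [t p _||u]; rewrite sum3.
Qed.

Lemma vexpansion_cross f1 f2 c1 c2 L1 L2 : vexpansion f1 c1 L1 -> vexpansion f2 c2 L2 ->
  vexpansion (fun t p => cross (f1 t p) (f2 t p)) (cross c1 c2)
    (fun u => cross (L1 u) c2 + cross c1 (L2 u)).
Proof.
move=> e1 e2 k; have M i j := expansionM (e1 i) (e2 j).
case: (I3P k) => ->.
- have := expansionB (M 1 2) (M 2 1).
  apply: expansion_ext => [t p _||u]; [by rewrite /cross !vec3E|by rewrite /cross !vec3E|].
  by rewrite [RHS]mxE /cross !vec3E; ring.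
- have := expansionB (M 2 0) (M 0 2).
  apply: expansion_ext => [t p _||u]; [by rewrite /cross !vec3E|by rewrite /cross !vec3E|].
  by rewrite [RHS]mxE /cross !vec3E; ring.
- have := expansionB (M 0 1) (M 1 0).
  apply: expansion_ext => [t p _||u]; [by rewrite /cross !vec3E|by rewrite /cross !vec3E|].
  by rewrite [RHS]mxE /cross !vec3E; ring.
Qed.

Lemma vexpansion_diag m f c L : vexpansion f c L ->
  vexpansion (fun t p => diag3 m (f t p)) (diag3 m c) (fun u => diag3 m (L u)).
Proof.
move=> e1 k; have Z i := expansionZ (m i) (e1 i).
by case: (I3P k) => ->; [have := Z 0|have := Z 1|have := Z 2];
  apply: expansion_ext => [t p _||u]; rewrite /diag3 !vec3E.
Qed.

Lemma expansion_dot f1 f2 c1 c2 L1 L2 : vexpansion f1 c1 L1 -> vexpansion f2 c2 L2 ->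
  expansion (fun t p => dot (f1 t p) (f2 t p)) (dot c1 c2)
    (fun u => dot (L1 u) c2 + dot c1 (L2 u)).
Proof.
move=> e1 e2; have M i := expansionM (e1 i) (e2 i).
have := expansionD (expansionD (M 0) (M 1)) (M 2).
by apply: expansion_ext => // u; rewrite /dot; ring.
Qed.

Lemma sphere_int_expansion h c ell : expansion h c ell ->
  exists C, forall t, `|t| < delta ->
  `|sphere_int (h t) - (c * sphere_int (fun=> 1) + sphere_int (fun p => ell (w t p - v)))|
    <= C * t ^+ 2.
Proof.
move=> [_ [k [C [C0 Hk]]]]; exists (C * sphere_bound R) => t ht.
have [ch ck r b i] := Hk t ht; rewrite -i.
have c1 : continuous (fun _ : H => 1 : R) by exact: cst_continuous.
have cc := @continuous_scal (- c) _ c1; have cN := @continuous_scal (-1) _ ck.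
have cr := continuous_add cc cN.
have -> : sphere_int (h t) - (c * sphere_int (fun=> 1) + sphere_int (k t)) =
    sphere_int (fun p => h t p + (- c * 1 + -1 * k t p)).
  rewrite (sphere_intD ch cr) (sphere_intD cc cN) (sphere_intZ _ c1) (sphere_intZ _ ck).
  by move: (sphere_int _) (sphere_int (fun=> 1)) (sphere_int (k t)) => x y z; ring.
rewrite mulrAC; apply: (sphere_int_bound (continuous_add ch cr)) => p hp.
have -> : h t p + (- c * 1 + -1 * k t p) = h t p - c - k t p by ring.
exact: r.
Qed.

End FirstOrderExpansion.

(** * Differentials of the densities and their expansions along a variation *)

Section Gradients.
Variables (R : realType) (l : 'I_3 -> R).

(** The algebraic part of [nab i], which is all that acts on constant coordinates. *)
Definition frame_rot (i : 'I_3) (u : 'rV[R]_3) : 'rV[R]_3 :=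
  mu l i *: cross (unitv R i) u.

Definition lapl0 (u : 'rV[R]_3) : 'rV[R]_3 := - \sum_i frame_rot i (frame_rot i u).

Definition S0 (u : 'rV[R]_3) : 'rV[R]_3 :=
  \sum_i curvv l (frame_rot i u) u (unitv R i).

(** The polarisation of the quadratic map [S0], hence its differential at [v]. *)
Definition dS0 (v u : 'rV[R]_3) : 'rV[R]_3 :=
  \sum_i (curvv l (frame_rot i u) v (unitv R i) + curvv l (frame_rot i v) u (unitv R i)).

(** Here and below the equal terms are left uncollected, in the shape that [expansion_dot] and
    [expansionM] produce. *)
Definition grad_vert (v u : 'rV[R]_3) : R :=
  \sum_i (dot (frame_rot i u) (frame_rot i v) + dot (frame_rot i v) (frame_rot i u)).

Definition grad_bivert (v u : 'rV[R]_3) : R :=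
  (dot (lapl0 u) (lapl0 v) + dot (lapl0 v) (lapl0 u)) -
  (dot (lapl0 v) v * (dot (lapl0 u) v + dot (lapl0 v) u) +
   dot (lapl0 v) v * (dot (lapl0 u) v + dot (lapl0 v) u)).

Definition grad_bi (v u : 'rV[R]_3) : R :=
  dot (dS0 v u) (S0 v) + dot (S0 v) (dS0 v u) + grad_bivert v u.

End Gradients.

Section Variations.
Variable R : realType.
Local Notation H := 'rV[R]_4.
Local Notation RH := (R^o * H)%type.
Variables (ip : 'rV[R]_3 -> 'rV[R]_3 -> R) (e : 'I_3 -> 'rV[R]_3) (l : 'I_3 -> R).
Hypothesis hip : inner_product ip.
Hypothesis he : forall i j, ip (e i) (e j) = (i == j)%:R.
Local Notation g := (left_metric ip).
Local Notation E := (fun i => left_field (e i)).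
Local Notation cf := (crdf ip e).

(** The bound 1 serves the estimates of products, eps / 2 the compactness in [strip_lipschitz]. *)
Definition time_radius (eps : R) : R := Num.min 1 (eps / 2).

Lemma time_radius_gt0 eps : 0 < eps -> 0 < time_radius eps.
Proof. by move=> eps0; rewrite lt_min ltr01 divr_gt0. Qed.

Lemma time_radius_le1 eps : time_radius eps <= 1.
Proof. by rewrite ge_min lexx. Qed.

Lemma lt_time_radius eps (t : R) : `|t| < time_radius eps -> `|t| < eps / 2.
Proof. by rewrite lt_min => /andP[]. Qed.

Lemma time_radius_lt eps (t : R) : 0 < eps -> `|t| < time_radius eps -> `|t| < eps.
Proof. by move=> eps0 /lt_time_radius; lra. Qed.

Section Jets.
Variables (a : 'rV[R]_3) (eps : R) (W : R -> H -> H).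
Hypothesis eps0 : 0 < eps.
Hypothesis varW : unit_variation g (left_field a) eps W.
Local Notation v := (crd ip e a).
Local Notation w := (fun t => cf (W t)).
Local Notation delta := (time_radius eps).

Lemma vfieldW t : `|t| < eps -> vfield (W t).
Proof. by case: varW => _ h _ /h[]. Qed.

Lemma smooth_w t k : `|t| < eps -> smooth_on setT (fun p => w t p 0 k : R).
Proof. by move=> ht; apply: smooth_crdfi => //; case: (vfieldW ht). Qed.

Lemma continuous_w t k : `|t| < delta -> continuous (fun p => w t p 0 k : R).
Proof.
by move=> ht p; apply: (smooth_on_continuous (smooth_w k (time_radius_lt eps0 ht))).
Qed.

Lemma w0 p : SU2 p -> w 0 p = v.
Proof.
by case: varW => _ _ h hp; rewrite -(crdf_left ip e a hp) /crdf h.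
Qed.

Definition jointw k : RH -> R := fun s => w s.1 s.2 0 k.

Lemma smooth_jointw k : smooth_on (strip (n := 4) eps) (jointw k).
Proof.
have oU := @open_strip R 4 eps; apply: smooth_on_entry => //.
apply: smooth_on_crd => //; apply: smooth_on_vecq => //; apply: smooth_on_qmul => //.
  by apply: smooth_on_qconj => //; exact: smooth_on_snd.
by case: varW.
Qed.

Lemma SU2_box (p : H) i : SU2 p -> `|p 0 i| <= 1.
Proof.
rewrite /SU2 /= => hp; rewrite -(expr_le1 (n := 2))// real_normK ?num_real//.
rewrite -hp (bigD1 i)//= lerDl; apply: sumr_ge0 => j _; exact: sqr_ge0.
Qed.

Lemma strip_bound (h : RH -> R) (c : R) : smooth_on (strip (n := 4) eps) h ->
  (forall p, SU2 p -> h (0, p) = c) ->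
  exists2 C, 0 <= C & forall t p, `|t| < delta -> SU2 p -> `|h (t, p) - c| <= C * `|t|.
Proof.
move=> sh h0; have [C C0 hC] := strip_lipschitz eps0 sh; exists C => // t p ht hp.
by rewrite -(h0 p hp); apply: hC => [|i]; [exact: lt_time_radius|exact: SU2_box].
Qed.

(** The first-order part is the full difference w_t - v and the remainder is zero; the Lipschitz
    bound in time makes the difference O(t). *)
Lemma expansion_jointw k : expansion w v delta (fun t p => w t p 0 k) (v 0 k)
  (fun u => u 0 k).
Proof.
split; first by exists (delta_mx 0 k) => u; case: (I3P k) => ->; rewrite /dot !mxE /=; ring.
have [C C0 hC] : exists2 C, 0 <= C & forall t p, `|t| < delta -> SU2 p ->
    `|jointw k (t, p) - v 0 k| <= C * `|t|.
  by apply: strip_bound; [exact: smooth_jointw|move=> p hp; rewrite /jointw /= w0].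
exists (fun t p => w t p 0 k - v 0 k), C; split; first exact: C0.
move=> t ht; split.
- exact: continuous_w.
- apply: (@continuous_add _ (fun p => w t p 0 k)); first exact: continuous_w.
  exact: cst_continuous.
- by move=> p _; rewrite subrr normr0; apply: mulr_ge0 => //; exact: sqr_ge0.
- by move=> p hp; exact: hC.
- by apply: eq_sphere_int => p _; rewrite !mxE.
Qed.

(** At time 0 the function is constant on the sphere, though perhaps not off it; a left-invariant
    direction is tangent and sees the sphere only. *)
Lemma joint_dir_cst b (h : RH -> R) (c : R) : smooth_on setT (fun p => h (0, p)) ->
  (forall p, SU2 p -> h (0, p) = c) -> forall p, SU2 p -> joint_dir b h (0, p) = 0.
Proof.
move=> sh h0 p hp; rewrite joint_dirE.
transitivity ('D_(left_field b p) (fun _ : H => c) p); last exact: derive_cst.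
apply: eq_derive_SU2 hp (tangent_left _ _) _ _ h0.
  by apply: (smooth_on_differentiable sh).
exact: differentiable_cst.
Qed.

(** The derivative is taken as its own first-order part: it is O(t) because it vanishes at t = 0,
    and its integral is zero by [sphere_int_left], so the linear form 0 represents it. *)
Lemma expansion_derive b (h : RH -> R) (c : R) : smooth_on (strip (n := 4) eps) h ->
  (forall t, `|t| < eps -> smooth_on setT (fun p => h (t, p))) ->
  (forall p, SU2 p -> h (0, p) = c) ->
  expansion w v delta (fun t p => 'D_(left_field b p) (fun q => h (t, q)) p) 0 (fun=> 0).
Proof.
move=> sh sht h0; split; first by exists 0 => u; rewrite /dot !mxE; ring.
have h00 : `|0 : R| < eps by rewrite normr0.
have [C C0 hC] := strip_bound (smooth_joint_dir b (@open_strip R 4 eps) sh)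
  (joint_dir_cst b (sht 0 h00) h0).
exists (fun t p => 'D_(left_field b p) (fun q => h (t, q)) p), C; split; first exact: C0.
move=> t ht; have sb : smooth_on setT (fun p => 'D_(left_field b p) (fun q => h (t, q)) p).
  apply: smooth_derive_vfield; first by case: (vfield_left b).
  by apply: sht; exact: time_radius_lt.
split.
- by move=> p; apply: (smooth_on_continuous sb).
- by move=> p; apply: (smooth_on_continuous sb).
- by move=> p _; rewrite subr0 subrr normr0; apply: mulr_ge0 => //; exact: sqr_ge0.
- by move=> p hp; have := hC t p ht hp; rewrite joint_dirE subr0.
- rewrite sphere_int_left; last by apply: sht; exact: time_radius_lt.
  have z : continuous (fun _ : H => 0 : R) by exact: cst_continuous.
  have := sphere_intZ 0 z; rewrite [RHS]mul0r => z0; apply: etrans (esym z0) _.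
  by apply: eq_sphere_int => p _; rewrite mul0r.
Qed.

Local Notation mu := (mu l).
Local Notation N := (frame_rot l).

Lemma vexpansion_ext (f f' : R -> H -> 'rV[R]_3) c c' L L' :
  (forall t p, `|t| < delta -> f t p = f' t p) -> c = c' -> (forall u, L u = L' u) ->
  vexpansion w v delta f c L -> vexpansion w v delta f' c' L'.
Proof.
move=> ff <- LL ef k; have := ef k.
by apply: expansion_ext => [t p /ff ->||u]; rewrite ?LL.
Qed.

Lemma vexpansion_w : vexpansion w v delta w v id.
Proof. by move=> k; exact: expansion_jointw. Qed.

Lemma vexpansion_dir i : vexpansion w v delta (fun t => dir (E i) (w t)) 0 (fun=> 0).
Proof.
move=> k; have := expansion_derive (e i) (smooth_jointw k)
  (fun t => @smooth_w t k) (c := v 0 k) (fun p hp => congr1 (fun u : 'rV_3 => u 0 k) (w0 hp)).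
by apply: expansion_ext => [t p _||u]; rewrite mxE.
Qed.

Lemma smooth_dir_w i t : `|t| < eps -> smooth_on setT (dir (E i) (w t)).
Proof.
move=> ht; apply: smooth_dir; first by case: (vfield_left (e i)).
by apply: smooth_crdf => //; case: (vfieldW ht).
Qed.

(** The first derivative, as a function of time and space, again satisfies the hypotheses of
    [expansion_derive], now with value 0 at time 0. *)
Lemma vexpansion_dir2 i :
  vexpansion w v delta (fun t => dir (E i) (dir (E i) (w t))) 0 (fun=> 0).
Proof.
move=> k; pose h := joint_dir (e i) (jointw k).
have hE t p : h (t, p) = dir (E i) (w t) p 0 k by rewrite /h joint_dirE mxE.
have sh : smooth_on (strip (n := 4) eps) h.
  by apply: smooth_joint_dir; [exact: open_strip|exact: smooth_jointw].
have sht t : `|t| < eps -> smooth_on setT (fun p => h (t, p)).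
  move=> ht; rewrite (_ : (fun p => _) = fun p => dir (E i) (w t) p 0 k).
    by apply: smooth_on_entry; [exact: openT|exact: smooth_dir_w].
  by apply/funext => p.
have h0 p : SU2 p -> h (0, p) = 0.
  have e0 : `|0 : R| < eps by rewrite normr0.
  apply: (joint_dir_cst (e i) (h := jointw k) (c := v 0 k)) => [|q hq].
    exact: smooth_w e0.
  by rewrite /jointw /= w0.
have := expansion_derive (e i) sh sht h0.
apply: expansion_ext => [t p _||u]; rewrite [RHS]mxE//.
by congr ('D_ _ _ _); apply/funext => q.
Qed.

Lemma vexpansion_N i f c L : vexpansion w v delta f c L ->
  vexpansion w v delta (fun t p => N i (f t p)) (N i c) (fun u => N i (L u)).
Proof.
move=> ef; have ec := vexpansion_cst w v delta (unitv R i).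
have := vexpansionZ (time_radius_le1 eps) continuous_w (mu i)
  (vexpansion_cross (time_radius_le1 eps) continuous_w ec ef).
apply: vexpansion_ext => // u; rewrite /frame_rot; congr (_ *: _).
by rewrite cross0l add0r.
Qed.

Lemma vexpansion_nab i : vexpansion w v delta (fun t => nab e l i (w t)) (N i v) (N i).
Proof.
have := vexpansionD continuous_w (vexpansion_dir i) (vexpansion_N i vexpansion_w).
by apply: vexpansion_ext => // [|u]; rewrite add0r.
Qed.

Lemma dir_nab i t p : `|t| < eps -> dir (E i) (nab e l i (w t)) p =
  dir (E i) (dir (E i) (w t)) p + N i (dir (E i) (w t) p).
Proof.
move=> ht; have sD := smooth_dir_w i ht.
have sw : smooth_on setT (w t) by apply: smooth_crdf => //; case: (vfieldW ht).
have dD k := is_derive_entry p (left_field (e i) p) k sD.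
have dw k := is_derive_entry p (left_field (e i) p) k sw.
have nE q k : nab e l i (w t) q 0 k = dir (E i) (w t) q 0 k
    + mu i * cross (unitv R i) (w t q) 0 k by rewrite [LHS]mxE [X in _ + X]mxE.
apply/rowP => k; rewrite [LHS]mxE [RHS]mxE [X in X + _]mxE [X in _ + X]mxE.
apply: derive_val; under eq_fun do rewrite nE.
move: (unitv R i) => c.
by case: (I3P k) => ->; rewrite /cross vec3E; under eq_fun do rewrite vec3E;
  apply: is_derive_eq; rewrite /GRing.scale /= ![dir _ (w t) _ _ _]mxE; ring.
Qed.

(** Every term of [nab i (nab i w)] that contains a derivative has constant term and linear form 0,
    so only the square of [frame_rot i] survives. *)
Lemma vexpansion_lapl : vexpansion w v delta (fun t => lapl e l (w t))
  (lapl0 l v) (lapl0 l).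
Proof.
have en i : vexpansion w v delta (fun t => nab e l i (nab e l i (w t)))
    (N i (N i v)) (fun u => N i (N i u)).
  have := vexpansionD continuous_w (vexpansionD continuous_w (vexpansion_dir2 i)
    (vexpansion_N i (vexpansion_dir i))) (vexpansion_N i (vexpansion_nab i)).
  have N0 : N i 0 = 0 :> 'rV[R]_3.
    by apply: row3P; rewrite /frame_rot /cross !mxE /=; ring.
  apply: vexpansion_ext => [t p ht||u]; last 2 first.
  - by rewrite N0 !add0r.
  - by rewrite N0 !add0r.
  - by rewrite -dir_nab//; exact: time_radius_lt.
exact: (vexpansionN (time_radius_le1 eps) continuous_w (vexpansion_sum continuous_w en)).
Qed.

Lemma vexpansion_S : vexpansion w v delta (fun t => Svec e l (w t)) (S0 l v) (dS0 l v).
Proof.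
have ed i : vexpansion w v delta (fun t p => curvv l (nab e l i (w t) p) (w t p) (unitv R i))
    (curvv l (N i v) v (unitv R i)) (fun u => curvv l (N i u) v (unitv R i)
      + curvv l (N i v) u (unitv R i)).
  have C := @vexpansion_cross R w v delta (time_radius_le1 eps) continuous_w.
  have D := @vexpansion_diag R w v delta (time_radius_le1 eps) continuous_w.
  have B := @vexpansionB R w v delta (time_radius_le1 eps) continuous_w.
  have en := vexpansion_nab i; have ew := vexpansion_w.
  have eK := B _ _ _ _ _ _ (C _ _ _ _ _ _ (D mu _ _ _ en) (D mu _ _ _ ew))
    (D mu _ _ _ (D l _ _ _ (C _ _ _ _ _ _ en ew))).
  have := C _ _ _ _ _ _ eK (vexpansion_cst w v delta (unitv R i)).
  apply: vexpansion_ext => // u.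
  have c0 (x : 'rV[R]_3) : cross x 0 = 0 by apply: row3P; rewrite /cross !mxE /=; ring.
  rewrite c0 addr0 /curvv -cross_addl; congr (cross _ _).
  by rewrite !diag3D opprD addrACA.
exact: (vexpansion_sum continuous_w ed).
Qed.

Lemma expansion_vert : exists c,
  expansion w v delta (fun t => dens_vert e l (w t)) c (grad_vert l v).
Proof.
have en i := expansion_dot (time_radius_le1 eps) continuous_w (vexpansion_nab i) (vexpansion_nab i).
have := expansionD continuous_w (expansionD continuous_w (en 0) (en 1)) (en 2) => es.
eexists; apply: expansion_ext es => [t p _||u]; last 2 first.
- reflexivity.
- by rewrite /grad_vert sum3.
- by rewrite /dens_vert sum3.
Qed.

Lemma expansion_bivert : exists c,
  expansion w v delta (fun t => dens_bivert e l (w t)) c (grad_bivert l v).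
Proof.
have d1 := expansion_dot (time_radius_le1 eps) continuous_w vexpansion_lapl vexpansion_lapl.
have d2 := expansion_dot (time_radius_le1 eps) continuous_w vexpansion_lapl vexpansion_w.
have := expansionB (time_radius_le1 eps) continuous_w d1
  (expansionM (time_radius_le1 eps) continuous_w d2 d2) => es.
by eexists; apply: expansion_ext es.
Qed.

Lemma expansion_bi : exists c,
  expansion w v delta (fun t => dens_bi e l (w t)) c (grad_bi l v).
Proof.
have [c ec] := expansion_bivert.
have d1 := expansion_dot (time_radius_le1 eps) continuous_w vexpansion_S vexpansion_S.
by exists (dot (S0 l v) (S0 l v) + c); exact: (expansionD continuous_w d1 ec).
Qed.

End Jets.

End Variations.

(** * The criterion for a left-invariant field to be critical *)

Section DotProduct.
Variable R : realType.

Lemma dotC (a b : 'rV[R]_3) : dot a b = dot b a.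
Proof. by rewrite /dot; ring. Qed.

Lemma dotZr (k : R) (a b : 'rV[R]_3) : dot a (k *: b) = k * dot a b.
Proof. by rewrite dotC dotZl dotC. Qed.

End DotProduct.

Section Criticality.
Variable R : realType.
Local Notation H := 'rV[R]_4.
Variables (ip : 'rV[R]_3 -> 'rV[R]_3 -> R) (e : 'I_3 -> 'rV[R]_3).
Hypothesis hip : inner_product ip.
Hypothesis he : forall i j, ip (e i) (e j) = (i == j)%:R.
Local Notation g := (left_metric ip).
Local Notation cf := (crdf ip e).
Variables (F : (H -> H) -> R) (D : (H -> 'rV[R]_3) -> H -> R) (a : 'rV[R]_3).
Local Notation v := (crd ip e a).
Variable ell : 'rV[R]_3 -> R.
Hypothesis v1 : dot v v = 1.
Hypothesis FE : forall X, vfield X -> F X = 2^-1 * integral_vol g (D (cf X)).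
Hypothesis Dexp : forall (eps : R) W, 0 < eps -> unit_variation g (left_field a) eps W ->
  exists c, expansion (fun t => cf (W t)) v (time_radius eps) (fun t => D (cf (W t))) c ell.

Local Notation S1 := (sphere_int (fun _ : H => 1 : R)).

Lemma unit_vfield_left b : dot (crd ip e b) (crd ip e b) = 1 ->
  unit_vfield g (left_field b).
Proof.
move=> b1; split; first exact: vfield_left.
by move=> p hp; rewrite (left_metric_dot hip he) !crdf_left.
Qed.

Lemma energy_expansion (eps : R) W : 0 < eps -> unit_variation g (left_field a) eps W ->
  exists c C, forall t, `|t| < time_radius eps -> `|F (W t) - (c + 2^-1 * (vol_factor ip e *
    sphere_int (fun p => ell (cf (W t) p - v))))| <= C * t ^+ 2.
Proof.
move=> eps0 vW; have [c ec] := Dexp eps0 vW.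
have [C hC] := sphere_int_expansion ec.
have K0 := vol_factor_gt0 hip he.
exists (2^-1 * (vol_factor ip e * (c * S1))), (2^-1 * (vol_factor ip e * C)) => t ht.
(* The expansion also supplies the continuity of the density that [integral_volE] asks for. *)
have [_ [k [C' [_ /(_ t ht)[cD _ _ _ _]]]]] := ec.
have -> : F (W t) = 2^-1 * (vol_factor ip e * sphere_int (D (cf (W t)))).
  by rewrite FE ?(integral_volE hip he)//; exact: (vfieldW vW (time_radius_lt eps0 ht)).
have := hC t ht.
move: (sphere_int _) (sphere_int (fun=> 1)) (sphere_int (fun p => ell _)) => x y z b.
have -> : 2^-1 * (vol_factor ip e * x) - (2^-1 * (vol_factor ip e * (c * y)) +
    2^-1 * (vol_factor ip e * z)) = 2^-1 * (vol_factor ip e * (x - (c * y + z))) by ring.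
rewrite !normrM ger0_norm ?invr_ge0// (ger0_norm (ltW K0)) -!mulrA.
by apply: ler_wpM2l; rewrite ?invr_ge0//; apply: ler_wpM2l => //; exact: ltW.
Qed.

(** Such an [ell] is a multiple of the product with [v]. For z = w_t - v the unit length of both
    fields gives <v, z> = - |z|^2 / 2, so the first-order term of the energy is already O(t^2). *)
Lemma critical_of_gradient : (forall u, dot v u = 0 -> ell u = 0) ->
  critical g F (left_field a).
Proof.
move=> ell0; split=> [|eps W eps0 vW]; first exact: unit_vfield_left.
have [c [C hC]] := energy_expansion eps0 vW.
have [c' [[gr grE] _]] := Dexp eps0 vW.
have K0 := vol_factor_gt0 hip he.
have [C' C'0 hC'] : exists2 C', 0 <= C' & forall t, `|t| < time_radius eps ->
    `|sphere_int (fun p => ell (cf (W t) p - v))| <= C' * t ^+ 2.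
  have jb k := strip_bound eps0 (smooth_jointw e hip vW k)
    (fun p hp => congr1 (fun u : 'rV_3 => u 0 k) (w0 e vW hp)).
  have [C0 C00 b0] := jb 0; have [C1 C10 b1] := jb 1; have [C2 C20 b2] := jb 2.
  (* Bounds |ell z| = |ell v| |z|^2 / 2 by B t^2, with one Lipschitz constant for each coordinate of
     z. *)
  pose B := `|ell v| / 2 * (C0 ^+ 2 + C1 ^+ 2 + C2 ^+ 2).
  have B0 : 0 <= B.
    by apply: mulr_ge0; [exact: divr_ge0|do 2?apply: addr_ge0; exact: sqr_ge0].
  exists (B * sphere_bound R).
    by apply: mulr_ge0 => //; rewrite /sphere_bound; do ?apply: mulr_ge0 => //;
      rewrite ?invr_ge0 ?pi_ge0.
  move=> t ht; rewrite mulrAC.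
  have ce : continuous (fun p => ell (cf (W t) p - v)).
    rewrite (_ : (fun p => _) = fun p => dot gr (cf (W t) p - v)).
      exact: (@continuous_ell _ _ v _ (continuous_w hip eps0 vW) gr t ht).
    by apply/funext => p; rewrite grE.
  apply: (sphere_int_bound ce) => p hp.
  set u := cf (W t) p.
  have u1 : dot u u = 1.
    have [_ h _] := vW; have [_ /(_ p hp)] := h t (time_radius_lt eps0 ht).
    by rewrite (left_metric_dot hip he).
  have [z zE] : exists z, z = u - v by exists (u - v).
  rewrite -zE; have vz : dot v z = - (dot z z / 2).
    have uE : u = z + v by rewrite zE subrK.
    by move: u1; rewrite uE !(dotDl, dotDr) v1 (dotC z v); lra.
  (* [ell] is applied to the component of [z] orthogonal to [v]. *)
  have ellz : ell z = dot v z * ell v.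
    have := ell0 (z - dot v z *: v); rewrite dotDr -scaleNr dotZr v1 mulr1 subrr.
    by move=> /(_ erefl) /eqP; rewrite !grE dotDr dotZr mulNr subr_eq0 => /eqP.
  rewrite ellz vz normrM normrN mulrC.
  have zz : 0 <= dot z z / 2.
    by apply: divr_ge0 => //; rewrite /dot -!expr2 !addr_ge0 ?sqr_ge0.
  rewrite (ger0_norm zz) /B -!mulrA; apply: ler_wpM2l => //.
  have sq k (C3 : R) : 0 <= C3 -> `|u 0 k - v 0 k| <= C3 * `|t| ->
      z 0 k * z 0 k <= C3 ^+ 2 * t ^+ 2.
    move=> C0' h; have -> : z 0 k * z 0 k = `|u 0 k - v 0 k| ^+ 2.
      by rewrite real_normK ?num_real// expr2 zE !mxE.
    rewrite -exprMn -[(C3 * t) ^+ 2]real_normK ?num_real// normrM (ger0_norm C0').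
    by rewrite lerXn2r// nnegrE mulr_ge0.
  have s0 := sq 0 _ C00 (b0 t p ht hp); have s1 := sq 1 _ C10 (b1 t p ht hp).
  have s2 := sq 2 _ C20 (b2 t p ht hp).
  rewrite /dot; move: (z 0 0 * z 0 0) (z 0 1 * z 0 1) (z 0 2 * z 0 2) s0 s1 s2.
  by move=> z0 z1 z2; lra.
have d0 : is_derive (0 : R) (1 : R) (cst (0 : R)) 0 by exact: is_derive_cst.
apply: (is_derive_remainder (c := c) (C := C + 2^-1 * (vol_factor ip e * C'))
  (time_radius_gt0 eps0) _ d0).
move=> t ht; have h1 := hC t ht; have h2 := hC' t ht.
move: (F (W t)) (sphere_int _) h1 h2 => x y h1 h2.
rewrite /cst; have -> : x - (c + 0) = (x - (c + 2^-1 * (vol_factor ip e * y))) +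
  2^-1 * (vol_factor ip e * y) by ring.
apply: le_trans (ler_normD _ _) _; rewrite mulrDl; apply: lerD => //.
rewrite !normrM ger0_norm ?invr_ge0// (ger0_norm (ltW K0)) -!mulrA.
by apply: ler_wpM2l; rewrite ?invr_ge0//; apply: ler_wpM2l => //; exact: ltW.
Qed.

Definition rotation_variation (b : 'rV[R]_3) (t : R) : H -> H :=
  left_field (dec e (cos t *: v + sin t *: b)).

Lemma crdf_rotation b t p : SU2 p ->
  cf (rotation_variation b t) p = cos t *: v + sin t *: b.
Proof. by move=> hp; rewrite crdf_left// decK. Qed.

Lemma rotation_variationP b : dot v b = 0 -> dot b b = 1 ->
  unit_variation g (left_field a) 1 (rotation_variation b).
Proof.
move=> vb b1; split=> [|t _|p hp].
- have oU := @open_strip R 4 1; have [sc ss] := smooth_on_trig oU.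
  apply: smooth_on_qmul => //; first exact: smooth_on_snd.
  apply: smooth_on_imq => //; apply: smooth_on_dec => //.
  apply/(smooth_on_rowP oU) => k.
  apply: (smooth_on_ext oU (f := fun s => cos s.1 * v 0 k + sin s.1 * b 0 k)).
    by move=> s _; rewrite !mxE.
  by apply: smooth_onD => //; apply: smooth_onM => //; exact: smooth_on_cst.
- apply: unit_vfield_left; rewrite decK// !(dotDl, dotDr, dotZl, dotZr).
  by rewrite v1 b1 (dotC b v) vb -[RHS](cos2Dsin2 t); ring.
- rewrite /rotation_variation cos0 sin0 scale1r scale0r addr0; congr (left_field _ p).
  exact: crdK.
Qed.

(** The representing vector is part of every expansion; the constant variation gives one. *)
Lemma gradient_linear : exists gr, forall u, ell u = dot gr u.
Proof.
have vW : unit_variation g (left_field a) 1 (fun _ => left_field a).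
  split=> // [|t _]; last exact: unit_vfield_left.
  have oU := @open_strip R 4 1; apply: smooth_on_left => //; exact: smooth_on_snd.
by have [c [[gr grE] _]] := Dexp ltr01 vW; exists gr.
Qed.

(** Along the great circle from v towards a unit vector b, the difference w_t - v is the same at all
    points of the sphere, so the derivative of the energy is [ell b] times a positive constant. A
    general nonzero u is rescaled to unit length. *)
Lemma gradient_of_critical : critical g F (left_field a) ->
  forall u, dot v u = 0 -> ell u = 0.
Proof.
move=> [_ crit] u vu.
pose n := Num.sqrt (dot u u).
have uu0 : 0 <= dot u u by rewrite /dot -!expr2 !addr_ge0 ?sqr_ge0.
have K0 := vol_factor_gt0 hip he.
have [gr grE] := gradient_linear.
have unit_case b : dot v b = 0 -> dot b b = 1 -> ell b = 0.
  move=> vb b1; have vW := rotation_variationP vb b1.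
  have dF := crit 1 _ ltr01 vW.
  have [c [C hC]] := energy_expansion ltr01 vW.
  pose G t := 2^-1 * (vol_factor ip e * (((cos t - 1) * ell v + sin t * ell b) * S1)).
  have GE t : 2^-1 * (vol_factor ip e *
      sphere_int (fun p => ell (cf (rotation_variation b t) p - v))) = G t.
    have c1 : continuous (fun _ : H => 1 : R) by exact: cst_continuous.
    suff -> : sphere_int (fun p => ell (cf (rotation_variation b t) p - v)) =
      ((cos t - 1) * ell v + sin t * ell b) * S1 by [].
    apply: etrans (sphere_intZ _ c1); apply: eq_sphere_int => p hp.
    have -> : cf (rotation_variation b t) p - v = (cos t - 1) *: v + sin t *: b.
      by rewrite crdf_rotation// scalerBl scale1r addrAC.
    by rewrite mulr1 !grE dotDr !dotZr.
  have dG : is_derive (0 : R) (1 : R) G (2^-1 * (vol_factor ip e * (ell b * S1))).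
    rewrite /G; apply: is_derive_eq.
    by rewrite /GRing.scale /= sin0 cos0; ring.
  have dF' : is_derive (0 : R) (1 : R) (fun t => F (rotation_variation b t))
      (2^-1 * (vol_factor ip e * (ell b * S1))).
    apply: (is_derive_remainder (c := c) (C := C) (time_radius_gt0 ltr01) _ dG) => t ht.
    by rewrite -GE; exact: hC.
  have [_ d0] := dF; have [_ d1] := dF'; move: d1; rewrite d0 => /esym /eqP.
  rewrite !mulf_eq0 invr_eq0 pnatr_eq0 /= (gt_eqF K0) (gt_eqF (sphere_int1_gt0 R)) orbF.
  by move/eqP.
have [u0|un0] := eqVneq (dot u u) 0.
  have -> : u = 0.
    move: u0; rewrite /dot -!expr2 => u0.
    have q k : 0 <= u 0 k ^+ 2 by exact: sqr_ge0.
    have z k : u 0 k ^+ 2 = 0 -> u 0 k = 0 by move/eqP; rewrite sqrf_eq0 => /eqP.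
    have := q 0; have := q 1; have := q 2 => q2 q1 q0.
    by apply: row3P; rewrite [RHS]mxE; apply: z; lra.
  by rewrite grE /dot !mxE; ring.
have n0 : 0 < n by rewrite sqrtr_gt0 lt_neqAle eq_sym un0.
have nn : n ^+ 2 = dot u u by exact: sqr_sqrtr.
have vb : dot v (n^-1 *: u) = 0 by rewrite dotZr vu mulr0.
have b1 : dot (n^-1 *: u) (n^-1 *: u) = 1.
  by rewrite dotZl dotZr -nn expr2; field; rewrite gt_eqF.
have := unit_case _ vb b1.
rewrite !grE dotZr => /eqP; rewrite mulf_eq0 invr_eq0 gt_eqF//= => /eqP.
by [].
Qed.

(** The three vectors are the cross products of the basis vectors with v. They span its orthogonal
    complement, because (v × u) × v = u for u orthogonal to the unit vector v. *)
Lemma criticalP : critical g F (left_field a) <->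
  [/\ ell (vec3 0 (- v 0 2) (v 0 1)) = 0, ell (vec3 (v 0 2) 0 (- v 0 0)) = 0
    & ell (vec3 (- v 0 1) (v 0 0) 0) = 0].
Proof.
split=> [/gradient_of_critical cr|[e0 e1 e2]].
  by split; apply: cr; rewrite /dot !vec3E; ring.
apply: critical_of_gradient => u vu; have [gr grE] := gradient_linear.
pose x := cross v u.
have uE : u = x 0 0 *: vec3 0 (- v 0 2) (v 0 1) + x 0 1 *: vec3 (v 0 2) 0 (- v 0 0)
    + x 0 2 *: vec3 (- v 0 1) (v 0 0) 0.
  move: v1 vu; rewrite /x /cross !vec3E /dot.
  move: (v 0 0) (v 0 1) (v 0 2) => v0 v1' v2 hv hu.
  apply: row3P; rewrite !(mxE, vec3E) /=.
  - move: (u 0 0) (u 0 1) (u 0 2) hu => u0 u1 u2 hu.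
    transitivity ((v0 * v0 + v1' * v1' + v2 * v2) * u0 - v0 * (v0 * u0 + v1' * u1 + v2 * u2)).
      by rewrite hv hu mulr0 subr0 mul1r.
    by ring.
  - move: (u 0 0) (u 0 1) (u 0 2) hu => u0 u1 u2 hu.
    transitivity ((v0 * v0 + v1' * v1' + v2 * v2) * u1 - v1' * (v0 * u0 + v1' * u1 + v2 * u2)).
      by rewrite hv hu mulr0 subr0 mul1r.
    by ring.
  - move: (u 0 0) (u 0 1) (u 0 2) hu => u0 u1 u2 hu.
    transitivity ((v0 * v0 + v1' * v1' + v2 * v2) * u2 - v2 * (v0 * u0 + v1' * u1 + v2 * u2)).
      by rewrite hv hu mulr0 subr0 mul1r.
    by ring.
move: e0 e1 e2; rewrite !grE [in X in _ -> _ -> _ -> X]uE !(dotDr, dotZr) => -> -> ->.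
by rewrite !mulr0 !addr0.
Qed.

End Criticality.

(** * Critical points *)

Section GradientFormulas.
Variables (R : realType) (l : 'I_3 -> R).
Local Notation m := (mu l).
Implicit Types u v : 'rV[R]_3.

(** The eigenvalues of the rough Laplacian on left-invariant fields. *)
Definition lapl_coef (i : 'I_3) : R := m 0 ^+ 2 + m 1 ^+ 2 + m 2 ^+ 2 - m i ^+ 2.

(** Minus the sectional curvature of the plane orthogonal to e_i; the curvature operator is diagonal
    in this frame. *)
Definition curv_coef (i : 'I_3) : R :=
  [:: m 1 * m 2 - m 0 * l 0; m 2 * m 0 - m 1 * l 1; m 0 * m 1 - m 2 * l 2]`_i.

Lemma frame_rotE u :
  [/\ frame_rot l 0 u = vec3 0 (- (m 0 * u 0 2)) (m 0 * u 0 1),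
      frame_rot l 1 u = vec3 (m 1 * u 0 2) 0 (- (m 1 * u 0 0))
    & frame_rot l 2 u = vec3 (- (m 2 * u 0 1)) (m 2 * u 0 0) 0].
Proof.
have uE i j : unitv R i 0 j = (j == i)%:R by rewrite mxE eqxx.
by split; apply: row3P; rewrite /frame_rot [LHS]mxE /cross !vec3E !uE /=; ring.
Qed.

Lemma lapl0E u : lapl0 l u = vec3 (lapl_coef 0 * u 0 0) (lapl_coef 1 * u 0 1)
  (lapl_coef 2 * u 0 2).
Proof.
have [a0 a1 a2] := frame_rotE u.
rewrite /lapl0 sum3 a0 a1 a2.
have [-> _ _] := frame_rotE (vec3 0 (- (m 0 * u 0 2)) (m 0 * u 0 1)).
have [_ -> _] := frame_rotE (vec3 (m 1 * u 0 2) 0 (- (m 1 * u 0 0))).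
have [_ _ ->] := frame_rotE (vec3 (- (m 2 * u 0 1)) (m 2 * u 0 0) 0).
apply: row3P; rewrite [LHS]mxE [X in - X]mxE [X in - (X + _)]mxE !vec3E /lapl_coef; ring.
Qed.

Lemma curvvE (x y z : 'rV[R]_3) :
  curvv l x y z = cross (diag3 curv_coef (cross x y)) z.
Proof.
rewrite /curvv; congr (cross _ z); apply: row3P;
  by rewrite [LHS]mxE [X in _ + X]mxE /cross /diag3 !vec3E /curv_coef /=; ring.
Qed.

Definition S_coef (i j : 'I_3) : R := curv_coef i * m j - curv_coef j * m i.

Lemma cross_unitv (x : 'rV[R]_3) :
  [/\ cross x (unitv R 0) = vec3 0 (x 0 2) (- x 0 1),
      cross x (unitv R 1) = vec3 (- x 0 2) 0 (x 0 0)
    & cross x (unitv R 2) = vec3 (x 0 1) (- x 0 0) 0].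
Proof.
have uE i j : unitv R i 0 j = (j == i)%:R by rewrite mxE eqxx.
by split; apply: row3P; rewrite /cross !vec3E !uE /=; ring.
Qed.

(** Stated for two vectors so that it yields both [S0] and its polarisation [dS0]. *)
Lemma curvv_sum u v :
  curvv l (frame_rot l 0 u) v (unitv R 0) + curvv l (frame_rot l 1 u) v (unitv R 1)
  + curvv l (frame_rot l 2 u) v (unitv R 2) =
  vec3 (curv_coef 1 * m 2 * (u 0 1 * v 0 2) - curv_coef 2 * m 1 * (u 0 2 * v 0 1))
       (curv_coef 2 * m 0 * (u 0 2 * v 0 0) - curv_coef 0 * m 2 * (u 0 0 * v 0 2))
       (curv_coef 0 * m 1 * (u 0 0 * v 0 1) - curv_coef 1 * m 0 * (u 0 1 * v 0 0)).
Proof.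
have [-> -> ->] := frame_rotE u; rewrite !curvvE.
have [-> _ _] := cross_unitv (diag3 curv_coef (cross (vec3 0 (- (m 0 * u 0 2)) (m 0 * u 0 1)) v)).
have [_ -> _] := cross_unitv (diag3 curv_coef (cross (vec3 (m 1 * u 0 2) 0 (- (m 1 * u 0 0))) v)).
have [_ _ ->] := cross_unitv (diag3 curv_coef (cross (vec3 (- (m 2 * u 0 1)) (m 2 * u 0 0) 0) v)).
by apply: row3P; rewrite [LHS]mxE [X in X + _]mxE /cross /diag3 !vec3E; ring.
Qed.

Lemma S0E v : S0 l v = vec3 (S_coef 1 2 * (v 0 1 * v 0 2)) (S_coef 2 0 * (v 0 2 * v 0 0))
  (S_coef 0 1 * (v 0 0 * v 0 1)).
Proof.
by rewrite /S0 sum3 curvv_sum /S_coef; congr vec3; ring.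
Qed.

Lemma dS0E v u : dS0 l v u = vec3 (S_coef 1 2 * (u 0 1 * v 0 2 + v 0 1 * u 0 2))
  (S_coef 2 0 * (u 0 2 * v 0 0 + v 0 2 * u 0 0))
  (S_coef 0 1 * (u 0 0 * v 0 1 + v 0 0 * u 0 1)).
Proof.
rewrite /dS0 big_split /= !sum3 !curvv_sum.
by apply: row3P; rewrite [LHS]mxE !vec3E /S_coef; ring.
Qed.

Lemma grad_vertE v u : grad_vert l v u = 2 * (lapl_coef 0 * v 0 0 * u 0 0
  + lapl_coef 1 * v 0 1 * u 0 1 + lapl_coef 2 * v 0 2 * u 0 2).
Proof.
rewrite /grad_vert sum3; have [-> -> ->] := frame_rotE u; have [-> -> ->] := frame_rotE v.
by rewrite /dot !vec3E /lapl_coef; ring.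
Qed.

Section UnitVector.
Variables (x y z : R).
Hypothesis xyz1 : x ^+ 2 + y ^+ 2 + z ^+ 2 = 1.
Local Notation v := (vec3 x y z).

(* The restriction of an energy to unit left-invariant fields is a quadratic form in the
   squares of the coordinates, with coefficients c01, c02, c12; the system below says that
   its gradient is normal to the sphere. *)
Definition normal_gradient (c01 c02 c12 : R) : Prop :=
  let Q0 := c01 * y ^+ 2 + c02 * z ^+ 2 in
  let Q1 := c01 * x ^+ 2 + c12 * z ^+ 2 in
  let Q2 := c02 * x ^+ 2 + c12 * y ^+ 2 in
  [/\ y * z * (Q2 - Q1) = 0, z * x * (Q0 - Q2) = 0 & x * y * (Q1 - Q0) = 0].

Definition bivert_coef (i j : 'I_3) : R := (lapl_coef i - lapl_coef j) ^+ 2.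
(** By [S0E] the term |S|^2 is itself a sum of the squares of [S_coef i j] times v_i^2 v_j^2, so it
    only shifts the coefficients. *)
Definition bi_coef (i j : 'I_3) : R := bivert_coef i j + S_coef i j ^+ 2.

Lemma grad_bivertE u : grad_bivert l v u =
  2 * (lapl_coef 0 ^+ 2 * x * u 0 0 + lapl_coef 1 ^+ 2 * y * u 0 1
    + lapl_coef 2 ^+ 2 * z * u 0 2) -
  4 * (lapl_coef 0 * x ^+ 2 + lapl_coef 1 * y ^+ 2 + lapl_coef 2 * z ^+ 2) *
  (lapl_coef 0 * x * u 0 0 + lapl_coef 1 * y * u 0 1 + lapl_coef 2 * z * u 0 2).
Proof. by rewrite /grad_bivert !lapl0E /dot !vec3E; ring. Qed.

(** The factor x^2 + y^2 + z^2 = 1 is inserted to make the gradient homogeneous; the differences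
    (A_i - A_j)^2 of the Laplacian eigenvalues then come out. *)
Lemma grad_bivert_tangent :
  [/\ grad_bivert l v (vec3 0 (- z) y) = 2 * (y * z *
        (bivert_coef 0 2 * x ^+ 2 + bivert_coef 1 2 * y ^+ 2
         - (bivert_coef 0 1 * x ^+ 2 + bivert_coef 1 2 * z ^+ 2))),
      grad_bivert l v (vec3 z 0 (- x)) = 2 * (z * x *
        (bivert_coef 0 1 * y ^+ 2 + bivert_coef 0 2 * z ^+ 2
         - (bivert_coef 0 2 * x ^+ 2 + bivert_coef 1 2 * y ^+ 2)))
    & grad_bivert l v (vec3 (- y) x 0) = 2 * (x * y *
        (bivert_coef 0 1 * x ^+ 2 + bivert_coef 1 2 * z ^+ 2
         - (bivert_coef 0 1 * y ^+ 2 + bivert_coef 0 2 * z ^+ 2)))].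
Proof.
rewrite !grad_bivertE !vec3E /bivert_coef.
move: (lapl_coef 0) (lapl_coef 1) (lapl_coef 2) => A B C.
split.
- transitivity (2 * (y * z) * (C - B) * ((B + C) * (x ^+ 2 + y ^+ 2 + z ^+ 2)
    - 2 * (A * x ^+ 2 + B * y ^+ 2 + C * z ^+ 2))); first by rewrite xyz1; ring.
  by ring.
- transitivity (2 * (z * x) * (A - C) * ((A + C) * (x ^+ 2 + y ^+ 2 + z ^+ 2)
    - 2 * (A * x ^+ 2 + B * y ^+ 2 + C * z ^+ 2))); first by rewrite xyz1; ring.
  by ring.
- transitivity (2 * (x * y) * (B - A) * ((B + A) * (x ^+ 2 + y ^+ 2 + z ^+ 2)
    - 2 * (A * x ^+ 2 + B * y ^+ 2 + C * z ^+ 2))); first by rewrite xyz1; ring.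
  by ring.
Qed.

Lemma mul2_eq0 (t : R) : 2 * t = 0 <-> t = 0.
Proof. by split=> [|->]; [lra|rewrite mulr0]. Qed.

Lemma grad_bivertP :
  [/\ grad_bivert l v (vec3 0 (- z) y) = 0, grad_bivert l v (vec3 z 0 (- x)) = 0
    & grad_bivert l v (vec3 (- y) x 0) = 0] <->
  normal_gradient (bivert_coef 0 1) (bivert_coef 0 2) (bivert_coef 1 2).
Proof.
have [-> -> ->] := grad_bivert_tangent; rewrite /normal_gradient.
by split=> -[e0 e1 e2]; split; apply/mul2_eq0.
Qed.

Lemma grad_biP :
  [/\ grad_bi l v (vec3 0 (- z) y) = 0, grad_bi l v (vec3 z 0 (- x)) = 0
    & grad_bi l v (vec3 (- y) x 0) = 0] <->
  normal_gradient (bi_coef 0 1) (bi_coef 0 2) (bi_coef 1 2).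
Proof.
rewrite /grad_bi; have [-> -> ->] := grad_bivert_tangent.
rewrite /normal_gradient /bi_coef !S0E !dS0E /dot !vec3E.
have -> : S_coef 2 0 = - S_coef 0 2 by rewrite /S_coef; ring.
move: (S_coef 0 1) (S_coef 0 2) (S_coef 1 2) (bivert_coef 0 1) (bivert_coef 0 2)
  (bivert_coef 1 2) => s01 s02 s12 c01 c02 c12.
by split=> -[e0 e1 e2]; split; lra.
Qed.

Lemma grad_vertP :
  [/\ grad_vert l v (vec3 0 (- z) y) = 0, grad_vert l v (vec3 z 0 (- x)) = 0
    & grad_vert l v (vec3 (- y) x 0) = 0] <->
  [/\ y * z * (lapl_coef 2 - lapl_coef 1) = 0, z * x * (lapl_coef 0 - lapl_coef 2) = 0
    & x * y * (lapl_coef 1 - lapl_coef 0) = 0].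
Proof.
rewrite !grad_vertE !vec3E.
move: (lapl_coef 0) (lapl_coef 1) (lapl_coef 2) => A B C.
by split=> -[e0 e1 e2]; split; apply/mul2_eq0; lra.
Qed.

End UnitVector.

End GradientFormulas.

Section CriticalPoints.
Variable R : realType.
Variables x y z : R.
Hypothesis xyz1 : x ^+ 2 + y ^+ 2 + z ^+ 2 = 1.
Local Notation NG := (normal_gradient x y z).

Lemma mulf_eq0P (a b : R) : a * b = 0 -> a = 0 \/ b = 0.
Proof. by move/eqP; rewrite mulf_eq0 => /orP[/eqP|/eqP]; [left|right]. Qed.

Lemma normal_gradient0 : NG 0 0 0.
Proof. by split; ring. Qed.

(** With these coefficients two of the equations are multiples of x^2 + y^2 - z^2 and the third
    holds identically. *)
Lemma normal_gradient_z c : 0 < c ->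
  (NG 0 c c <-> (y * z = 0 /\ z * x = 0) \/ x ^+ 2 + y ^+ 2 = z ^+ 2).
Proof.
move=> c0; rewrite /normal_gradient; split=> [[e0 e1 _]|].
  have f0 : c * (y * z) * (x ^+ 2 + y ^+ 2 - z ^+ 2) = 0 by rewrite -[RHS]e0; ring.
  have f1 : c * (z * x) * (x ^+ 2 + y ^+ 2 - z ^+ 2) = 0.
    by rewrite -[RHS]oppr0 -[in RHS]e1; ring.
  have [g0|] := mulf_eq0P f0; last by right; lra.
  have [g1|] := mulf_eq0P f1; last by right; lra.
  by left; split; [have [|//] := mulf_eq0P g0; lra|have [|//] := mulf_eq0P g1; lra].
case=> [[e0 e1]|e].
  by rewrite e0 e1; split; ring.
by rewrite -e; split; ring.
Qed.

Lemma normal_gradient_x c : 0 < c ->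
  (NG c c 0 <-> (z * x = 0 /\ x * y = 0) \/ y ^+ 2 + z ^+ 2 = x ^+ 2).
Proof.
move=> c0; rewrite /normal_gradient; split=> [[_ e1 e2]|].
  have f1 : c * (z * x) * (y ^+ 2 + z ^+ 2 - x ^+ 2) = 0 by rewrite -[RHS]e1; ring.
  have f2 : c * (x * y) * (y ^+ 2 + z ^+ 2 - x ^+ 2) = 0.
    by rewrite -[RHS]oppr0 -[in RHS]e2; ring.
  have [g0|] := mulf_eq0P f1; last by right; lra.
  have [g1|] := mulf_eq0P f2; last by right; lra.
  by left; split; [have [|//] := mulf_eq0P g0; lra|have [|//] := mulf_eq0P g1; lra].
case=> [[e0 e1]|e].
  by rewrite e0 e1; split; ring.
by rewrite -e; split; ring.
Qed.

(* If no coordinate vanishes, Q0 = Q1 and Q1 = Q2 force x^2 > y^2 + z^2 and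
   z^2 > x^2 + y^2, because c02 > c01 + c12. *)
Lemma normal_gradient_distinct c01 c02 c12 : 0 < c01 -> 0 < c12 -> c01 + c12 < c02 ->
  (NG c01 c02 c12 <-> [\/ [/\ y * z = 0, z * x = 0 & x * y = 0],
    (x = 0 /\ y ^+ 2 = z ^+ 2), (y = 0 /\ x ^+ 2 = z ^+ 2) | (z = 0 /\ x ^+ 2 = y ^+ 2)]).
Proof.
move=> p01 p12 p02; rewrite /normal_gradient; split=> [[e0 e1 e2]|]; last first.
  case=> [[-> -> ->]|[-> e]|[-> e]|[-> e]].
  - by split; ring.
  - by rewrite e; split; ring.
  - by rewrite e; split; ring.
  - by rewrite e; split; ring.
have [x0|xn] := eqVneq x 0.
  move: e0; rewrite x0 => e0.
  have f0 : c12 * (y * z) * (y ^+ 2 - z ^+ 2) = 0 by rewrite -[RHS]e0; ring.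
  have [g|g] := mulf_eq0P f0; last by constructor 2; split => //; lra.
  constructor 1; split; [|by rewrite mulr0|by rewrite mul0r].
  by have [|//] := mulf_eq0P g; lra.
have [y0|yn] := eqVneq y 0.
  move: e1; rewrite y0 => e1.
  have f0 : c02 * (z * x) * (z ^+ 2 - x ^+ 2) = 0 by rewrite -[RHS]e1; ring.
  have [g|g] := mulf_eq0P f0; last by constructor 3; split => //; lra.
  constructor 1; split; [by rewrite mul0r| |by rewrite mulr0].
  by have [|//] := mulf_eq0P g; lra.
have [z0|zn] := eqVneq z 0.
  move: e2; rewrite z0 => e2.
  have f0 : c01 * (x * y) * (x ^+ 2 - y ^+ 2) = 0 by rewrite -[RHS]e2; ring.
  have [g|g] := mulf_eq0P f0; last by constructor 4; split => //; lra.
  constructor 1; split; [by rewrite mulr0|by rewrite mul0r|].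
  by have [|//] := mulf_eq0P g; lra.
exfalso.
have sx : 0 < x ^+ 2 by rewrite exprn_even_gt0.
have sy : 0 < y ^+ 2 by rewrite exprn_even_gt0.
have sz : 0 < z ^+ 2 by rewrite exprn_even_gt0.
have cancel (a b c : R) : a != 0 -> b != 0 -> a * b * c = 0 -> c = 0.
  move=> an bn /eqP; rewrite !mulf_eq0 (negbTE an) (negbTE bn) => /eqP.
  by [].
have {}e0 := cancel _ _ _ yn zn e0; have {}e2 := cancel _ _ _ xn yn e2.
move: (x ^+ 2) (y ^+ 2) (z ^+ 2) sx sy sz e0 e2 => a b c sa sb sc e0 e2.
have h1 : 0 < (c02 - c01 - c12) * c by apply: mulr_gt0 => //; lra.
have h2 : 0 < (c02 - c01 - c12) * a by apply: mulr_gt0 => //; lra.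
have g1 : 0 < c01 * (a - b - c) by lra.
have g2 : 0 < c12 * (c - a - b) by lra.
rewrite pmulr_rgt0// in g1; rewrite pmulr_rgt0// in g2; lra.
Qed.

End CriticalPoints.

(** * Inequalities between the coefficients *)

Section Coefficients.
Variables (R : realType) (l : 'I_3 -> R).
Hypotheses (l2_gt0 : 0 < l 2) (l21 : l 2 <= l 1) (l10 : l 1 <= l 0).

(** Differences of squares: [mu 1 + mu 2 = l 0] and [mu 1 - mu 2 = l 2 - l 1], and cyclically. *)
Lemma lapl_coef_sub :
  [/\ lapl_coef l 2 - lapl_coef l 1 = (l 2 - l 1) * l 0,
      lapl_coef l 0 - lapl_coef l 2 = (l 0 - l 2) * l 1
    & lapl_coef l 1 - lapl_coef l 0 = (l 1 - l 0) * l 2].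
Proof. by split; rewrite /lapl_coef /mu; field. Qed.

Definition admissible (c01 c02 c12 : R) : Prop :=
  [/\ l 0 = l 1 -> c01 = 0 /\ c02 = c12, l 1 = l 2 -> c12 = 0 /\ c02 = c01,
      l 1 < l 0 -> 0 < c01, l 2 < l 1 -> 0 < c12
    & l 1 < l 0 -> l 2 < l 1 -> c01 + c12 < c02].

(** With s = (l_0 - l_1) l_2 and t = (l_1 - l_2) l_0 the coefficients are c01 = s^2, c12 = t^2 and
    c02 = (s + t)^2, so the gap in the last inequality is 2 s t. *)
Lemma admissible_bivert :
  admissible (bivert_coef l 0 1) (bivert_coef l 0 2) (bivert_coef l 1 2).
Proof.
have [e21 e02 e10] := lapl_coef_sub.
have E01 : bivert_coef l 0 1 = ((l 0 - l 1) * l 2) ^+ 2.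
  by rewrite /bivert_coef -[X in X ^+ 2]opprB e10; ring.
have E02 : bivert_coef l 0 2 = ((l 0 - l 1) * l 2 + (l 1 - l 2) * l 0) ^+ 2.
  by rewrite /bivert_coef e02; ring.
have E12 : bivert_coef l 1 2 = ((l 1 - l 2) * l 0) ^+ 2.
  by rewrite /bivert_coef -[X in X ^+ 2]opprB e21; ring.
rewrite /admissible E01 E02 E12.
move: (l 0) (l 1) (l 2) l2_gt0 l21 l10 => a b c c0 cb ba; split.
- by move=> ->; split; ring.
- by move=> ->; split; ring.
- move=> h; apply: exprn_gt0; apply: mulr_gt0. lra. lra.
- by move=> h; apply: exprn_gt0; apply: mulr_gt0; lra.
- move=> h h'; have a0 : 0 < (a - b) * c by apply: mulr_gt0; lra.
  have b0 : 0 < (b - c) * a by apply: mulr_gt0; lra.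
  move: (_ * c) (_ * a) a0 b0 => s t s0 t0.
  by have ab := mulr_gt0 s0 t0; rewrite sqrrD; lra.
Qed.

(** The strict inequality is inherited from [admissible_bivert] once the squares of [S_coef] satisfy
    the weak one. In terms of p, q, r, the values of [mu], the constants [l] are the pairwise sums
    and p <= q <= r with q > 0, while p may be negative. *)
Lemma admissible_bi : admissible (bi_coef l 0 1) (bi_coef l 0 2) (bi_coef l 1 2).
Proof.
have [b1 b2 b3 b4 b5] := admissible_bivert.
pose p := mu l 0; pose q := mu l 1; pose r := mu l 2.
have pq : p + q = l 2 by rewrite /p /q /mu; field.
have qr : q + r = l 0 by rewrite /q /r /mu; field.
have pr : p + r = l 1 by rewrite /p /r /mu; field.
have K0 : curv_coef l 0 = q * r - p * (q + r) by rewrite qr.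
have K1 : curv_coef l 1 = r * p - q * (p + r) by rewrite pr.
have K2 : curv_coef l 2 = p * q - r * (p + q) by rewrite pq.
have c0 : 0 < p + q by rewrite pq.
have cb : p + q <= p + r by rewrite pq pr.
have ba : p + r <= q + r by rewrite pr qr.
have pqle : p <= q by lra.
have qrle : q <= r by lra.
have q0 : 0 < q by lra.
pose s := (q - p) * (r * (p + q) - p * q).
have S01 : S_coef l 0 1 = s by rewrite /S_coef K0 K1 -/p -/q /s; ring.
have S02 : S_coef l 0 2 = (r - p) * (p * q + r * (q - p)).
  by rewrite /S_coef K0 K2 -/p -/r; ring.
have S12 : S_coef l 1 2 = (r - q) * (p * q - r * (q - p)).
  by rewrite /S_coef K1 K2 -/q -/r; ring.
have s0 : 0 <= s.
  apply: mulr_ge0; first lra.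
  (* This form is nonnegative also for negative p, since p + q > 0. *)
  have -> : r * (p + q) - p * q = (r - q) * (p + q) + q ^+ 2 by ring.
  by apply: addr_ge0; [apply: mulr_ge0; lra|exact: sqr_ge0].
have sle : S_coef l 0 1 ^+ 2 + S_coef l 1 2 ^+ 2 <= S_coef l 0 2 ^+ 2.
  (* Here A = S02 + S12 - S01 and B = S02 - S12 - S01, so S02^2 - S12^2 = (s + A) (s + B) with s =
     S01. *)
  pose A := 2 * p ^+ 2 * (r - q); pose B := 2 * (r - q) * (q - p) * (r - p).
  have rq : 0 <= r - q by rewrite subr_ge0.
  have qp : 0 <= q - p by rewrite subr_ge0.
  have rp : 0 <= r - p by rewrite subr_ge0; exact: le_trans qrle.
  have A0 : 0 <= A.
    by apply: mulr_ge0 => //; apply: mulr_ge0 => //; exact: sqr_ge0.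
  have B0 : 0 <= B by do 3?apply: mulr_ge0 => //.
  have E : S_coef l 0 2 ^+ 2 - S_coef l 1 2 ^+ 2 - S_coef l 0 1 ^+ 2 =
      s * A + s * B + A * B by rewrite S01 S02 S12 /s /A /B; ring.
  have := mulr_ge0 s0 A0; have := mulr_ge0 s0 B0; have := mulr_ge0 A0 B0.
  by move=> h1 h2 h3; lra.
split; rewrite /bi_coef.
- move=> e; have [-> ->] := b1 e; have pqE : p = q.
    by apply: (addIr r); rewrite pr qr.
  by rewrite S01 S02 S12 /s pqE; split; ring.
- move=> e; have [-> ->] := b2 e; have qrE : q = r.
    by apply: (addrI p); rewrite pq pr.
  by rewrite S01 S02 S12 /s qrE; split; ring.
- by move=> /b3 h; apply: ltr_wpDr => //; exact: sqr_ge0.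
- by move=> /b4 h; apply: ltr_wpDr => //; exact: sqr_ge0.
- by move=> h h'; rewrite addrACA; exact: ltr_leD (b5 h h') sle.
Qed.

End Coefficients.

(** * Algebraic criteria for left-invariant unit fields *)

Section LeftUnitFields.
Variables (R : realType) (ip : 'rV[R]_3 -> 'rV[R]_3 -> R) (e : 'I_3 -> 'rV[R]_3).
Variable l : 'I_3 -> R.
Hypothesis hip : inner_product ip.
Hypothesis he : forall i j, ip (e i) (e j) = (i == j)%:R.
Hypothesis h1 : lie (e 1) (e 2) = l 0 *: e 0.
Hypothesis h2 : lie (e 2) (e 0) = l 1 *: e 1.
Hypothesis h3 : lie (e 0) (e 1) = l 2 *: e 2.
Variable nabla : ('rV[R]_4 -> 'rV[R]_4) -> ('rV[R]_4 -> 'rV[R]_4) ->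
  'rV[R]_4 -> 'rV[R]_4.
Hypothesis hnabla : levi_civita (left_metric ip) nabla.
Hypotheses (l0_gt0 : 0 < l 0) (l1_gt0 : 0 < l 1) (l2_gt0 : 0 < l 2).
Variables x y z : R.
Hypothesis xyz1 : x ^+ 2 + y ^+ 2 + z ^+ 2 = 1.
Local Notation g := (left_metric ip).
Local Notation E := (fun i => left_field (e i)).
Local Notation V := (left_field (x *: e 0 + y *: e 1 + z *: e 2)).
Local Notation a := (dec e (vec3 x y z)).

Lemma left_field_dec : V = left_field a.
Proof. by rewrite /dec sum3 !vec3E. Qed.

Lemma crd_dec : crd ip e a = vec3 x y z.
Proof. exact: decK. Qed.

Lemma dot_crd_dec : dot (crd ip e a) (crd ip e a) = 1.
Proof. by rewrite crd_dec /dot !vec3E -!expr2. Qed.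

Lemma biharmonic_unit_sectionP : biharmonic_unit_section g nabla E V <->
  normal_gradient x y z (bivert_coef l 0 1) (bivert_coef l 0 2) (bivert_coef l 1 2).
Proof.
rewrite left_field_dec -(grad_bivertP l xyz1) -crd_dec.
have FE := vertical_bienergyE hip he h1 h2 h3 hnabla.
have := criticalP hip he dot_crd_dec FE
  (fun eps W => @expansion_bivert _ _ _ l hip a eps W).
by rewrite [in X in _ -> X]crd_dec [in X in X -> _]crd_dec !vec3E.
Qed.

Lemma biharmonic_unit_vfieldP : biharmonic_unit_vfield g nabla E V <->
  normal_gradient x y z (bi_coef l 0 1) (bi_coef l 0 2) (bi_coef l 1 2).
Proof.
rewrite left_field_dec -(grad_biP l xyz1) -crd_dec.
have FE := bienergyE hip he h1 h2 h3 hnabla.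
have := criticalP hip he dot_crd_dec FE
  (fun eps W => @expansion_bi _ _ _ l hip a eps W).
by rewrite [in X in _ -> X]crd_dec [in X in X -> _]crd_dec !vec3E.
Qed.

(** The gradient is tangentially zero when the diagonal Laplacian maps v to a multiple of itself;
    each difference of eigenvalues is a difference of two of the constants times the positive third
    one. *)
Lemma harmonic_unit_sectionP : harmonic_unit_section g nabla E V <->
  [/\ l 1 = l 2 \/ y * z = 0, l 0 = l 2 \/ z * x = 0 & l 0 = l 1 \/ x * y = 0].
Proof.
have cancel (s b c d : R) : 0 < d -> s * ((b - c) * d) = 0 <-> (c = b \/ s = 0).
  move=> d0; split=> [/eqP|[->|->]]; [|by rewrite subrr mul0r mulr0|by rewrite mul0r].
  by rewrite !mulf_eq0 (gt_eqF d0) orbF subr_eq0 => /orP[/eqP|/eqP] ->; [right|left].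
have [e21 e02 e10] := lapl_coef_sub l.
have c0 := cancel (y * z) (l 2) (l 1) (l 0) l0_gt0.
have c1 := cancel (z * x) (l 0) (l 2) (l 1) l1_gt0.
have c2 := cancel (x * y) (l 1) (l 0) (l 2) l2_gt0.
rewrite -e21 in c0; rewrite -e02 in c1; rewrite -e10 in c2.
suff -> : harmonic_unit_section g nabla E V <->
  [/\ y * z * (lapl_coef l 2 - lapl_coef l 1) = 0,
      z * x * (lapl_coef l 0 - lapl_coef l 2) = 0
    & x * y * (lapl_coef l 1 - lapl_coef l 0) = 0].
  rewrite (_ : (l 0 = l 2) = (l 2 = l 0)); last by apply/propext; split.
  by split=> -[/c0 ? /c1 ? /c2 ?]; split.
rewrite left_field_dec -(grad_vertP l) -crd_dec.
have FE := vertical_energyE hip he h1 h2 h3 hnabla.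
have := criticalP hip he dot_crd_dec FE
  (fun eps W => @expansion_vert _ _ _ l hip a eps W).
by rewrite [in X in _ -> X]crd_dec [in X in X -> _]crd_dec !vec3E.
Qed.

End LeftUnitFields.

Section HalfSquares.
Variable R : realType.
Implicit Types a b c : R.

Lemma sqr_eq_half a : a ^+ 2 = 1 / 2 <-> a = 1 / Num.sqrt 2 \/ a = - (1 / Num.sqrt 2).
Proof.
have r2 : (1 / Num.sqrt 2) ^+ 2 = 1 / 2 :> R by rewrite expr_div_n expr1n sqr_sqrtr.
split=> [h|[->|->]]; rewrite ?sqrrN//.
by have /eqP := h; rewrite -r2 eqf_sqr => /orP[/eqP|/eqP]; [left|right].
Qed.

(** When two of the constants coincide, [b c = 0] and [c a = 0] describe the harmonic fields: the
    poles and the equator of the axis c. The circles c^2 = 1/2 meet neither. *)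
Lemma circle_half a b c : a ^+ 2 + b ^+ 2 + c ^+ 2 = 1 ->
  ((b * c = 0 /\ c * a = 0) \/ a ^+ 2 + b ^+ 2 = c ^+ 2) /\ ~ (b * c = 0 /\ c * a = 0) <->
  (c = 1 / Num.sqrt 2 /\ a ^+ 2 + b ^+ 2 = 1 / 2) \/
  (c = - (1 / Num.sqrt 2) /\ a ^+ 2 + b ^+ 2 = 1 / 2).
Proof.
move=> abc; split=> [[[//|h] _]|h].
  have c2 : c ^+ 2 = 1 / 2 by lra.
  have ab : a ^+ 2 + b ^+ 2 = 1 / 2 by lra.
  by have /sqr_eq_half[] := c2; [left|right].
have ab : a ^+ 2 + b ^+ 2 = 1 / 2 by case: h => -[].
have c2 : c ^+ 2 = 1 / 2 by lra.
split; first by right; rewrite ab c2.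
move=> [bc ca].
have cn : c != 0 by apply/eqP => c0; move: c2; rewrite c0; lra.
have b0 : b = 0 by move/eqP: bc; rewrite mulf_eq0 (negbTE cn) orbF => /eqP.
have a0 : a = 0 by move/eqP: ca; rewrite mulf_eq0 (negbTE cn) => /eqP.
by move: ab; rewrite a0 b0; lra.
Qed.

Lemma sqr_eq_half_pair a b c : a ^+ 2 + b ^+ 2 + c ^+ 2 = 1 -> a = 0 -> b ^+ 2 = c ^+ 2 ->
  (b = 1 / Num.sqrt 2 \/ b = - (1 / Num.sqrt 2)) /\
  (c = 1 / Num.sqrt 2 \/ c = - (1 / Num.sqrt 2)).
Proof. by move=> abc a0 bc; split; apply/sqr_eq_half; move: abc; rewrite a0; lra. Qed.

Lemma half_pair_neq0 b c : (b = 1 / Num.sqrt 2 \/ b = - (1 / Num.sqrt 2)) ->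
  (c = 1 / Num.sqrt 2 \/ c = - (1 / Num.sqrt 2)) -> b ^+ 2 = c ^+ 2 /\ b * c <> 0.
Proof.
move=> /sqr_eq_half b2 /sqr_eq_half c2; split; first by rewrite b2 c2.
by move=> bc; have := congr1 (fun t => t ^+ 2) bc; rewrite exprMn b2 c2; lra.
Qed.

Lemma half_points a b c : a ^+ 2 + b ^+ 2 + c ^+ 2 = 1 ->
  let r := 1 / Num.sqrt 2 : R in
  [\/ [/\ b * c = 0, c * a = 0 & a * b = 0], (a = 0 /\ b ^+ 2 = c ^+ 2),
    (b = 0 /\ a ^+ 2 = c ^+ 2) | (c = 0 /\ a ^+ 2 = b ^+ 2)] /\
  ~ [/\ b * c = 0, c * a = 0 & a * b = 0] <->
  [\/ [/\ a = 0, b = r \/ b = - r & c = r \/ c = - r],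
      [/\ b = 0, a = r \/ a = - r & c = r \/ c = - r]
    | [/\ c = 0, a = r \/ a = - r & b = r \/ b = - r]].
Proof.
move=> abc r; split.
  have bac : b ^+ 2 + a ^+ 2 + c ^+ 2 = 1 by rewrite -abc; ring.
  have cab : c ^+ 2 + a ^+ 2 + b ^+ 2 = 1 by rewrite -abc; ring.
  case=> -[//|[a0 h]|[b0 h]|[c0 h]] _.
  - by have [] := sqr_eq_half_pair abc a0 h; constructor 1.
  - by have [] := sqr_eq_half_pair bac b0 h; constructor 2.
  - by have [] := sqr_eq_half_pair cab c0 h; constructor 3.
case=> -[h0 hb hc]; have [e n] := half_pair_neq0 hb hc.
- by split; [constructor 2|case].
- by split; [constructor 3|case=> _ /[1!mulrC]].
- by split; [constructor 4|case].
Qed.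

End HalfSquares.
Theorem theorem3p1 (R : realType)
    (ip : 'rV[R]_3 -> 'rV[R]_3 -> R) (hip : inner_product ip)
    (e : 'I_3 -> 'rV[R]_3) (he : forall i j, ip (e i) (e j) = (i == j)%:R)
    (l1 l2 l3 : R)
    (h1 : lie (e 1) (e 2) = l1 *: e 0)
    (h2 : lie (e 2) (e 0) = l2 *: e 1)
    (h3 : lie (e 0) (e 1) = l3 *: e 2)
    (h3_gt0 : 0 < l3) (h32 : l3 <= l2) (h21 : l2 <= l1)
    (nabla : ('rV[R]_4 -> 'rV[R]_4) -> ('rV[R]_4 -> 'rV[R]_4) ->
             'rV[R]_4 -> 'rV[R]_4)
    (hnabla : levi_civita (left_metric ip) nabla) :
  let g := left_metric ip in
  let E := fun i => left_field (e i) in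
  let V := fun x y z : R =>
    left_field (x *: e 0 + y *: e 1 + z *: e 2) in
  let r := 1 / Num.sqrt 2 : R in
  [/\ l1 = l2 -> l2 = l3 ->
        forall x y z, x ^+ 2 + y ^+ 2 + z ^+ 2 = 1 ->
          biharmonic_unit_section g nabla E (V x y z),
      l1 = l2 -> l3 < l2 ->
        forall x y z, x ^+ 2 + y ^+ 2 + z ^+ 2 = 1 ->
          (nonharmonic_biharmonic_unit_section g nabla E (V x y z) <->
           (z = r /\ x ^+ 2 + y ^+ 2 = 1 / 2) \/
           (z = - r /\ x ^+ 2 + y ^+ 2 = 1 / 2)),
      l2 < l1 -> l2 = l3 ->
        forall x y z, x ^+ 2 + y ^+ 2 + z ^+ 2 = 1 ->
          (nonharmonic_biharmonic_unit_section g nabla E (V x y z) <->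
           (x = r /\ y ^+ 2 + z ^+ 2 = 1 / 2) \/
           (x = - r /\ y ^+ 2 + z ^+ 2 = 1 / 2)),
      l2 < l1 -> l3 < l2 ->
        forall x y z, x ^+ 2 + y ^+ 2 + z ^+ 2 = 1 ->
          (nonharmonic_biharmonic_unit_section g nabla E (V x y z) <->
           [\/ [/\ x = 0, y = r \/ y = - r & z = r \/ z = - r],
               [/\ y = 0, x = r \/ x = - r & z = r \/ z = - r]
             | [/\ z = 0, x = r \/ x = - r & y = r \/ y = - r]])
    & forall x y z, x ^+ 2 + y ^+ 2 + z ^+ 2 = 1 ->
        (biharmonic_unit_section g nabla E (V x y z) <->
         biharmonic_unit_vfield g nabla E (V x y z))].
Proof.
move=> g E V r.
(* [l 0], [l 1] and [l 2] compute to [l1], [l2] and [l3], so the hypotheses fit by conversion. *)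
pose l (i : 'I_3) : R := [:: l1; l2; l3]`_i.
have l2_gt0 : 0 < l2 by exact: lt_le_trans h32.
have l1_gt0 : 0 < l1 by exact: lt_le_trans h21.
have bvP x y z xyz1 := @biharmonic_unit_sectionP R ip e l hip he h1 h2 h3 nabla hnabla x y z xyz1.
have bfP x y z xyz1 := @biharmonic_unit_vfieldP R ip e l hip he h1 h2 h3 nabla hnabla x y z xyz1.
have hP x y z xyz1 := @harmonic_unit_sectionP R ip e l hip he h1 h2 h3 nabla hnabla
  l1_gt0 l2_gt0 h3_gt0 x y z xyz1.
have adv : admissible l _ _ _ := @admissible_bivert R l h3_gt0 h32 h21.
have adb : admissible l _ _ _ := @admissible_bi R l h3_gt0 h32 h21.
(* From here on the coefficients are known through admissibility only, so each case is settled once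
   for both energies. *)
move: (bivert_coef l 0 1) (bivert_coef l 0 2) (bivert_coef l 1 2) bvP adv => c01 c02 c12 bvP adv.
move: (bi_coef l 0 1) (bi_coef l 0 2) (bi_coef l 1 2) bfP adb => d01 d02 d12 bfP adb.
have caseA p q s : admissible l p q s -> l1 = l2 -> l2 = l3 -> [/\ p = 0, q = 0 & s = 0].
  by move=> [a1 a2 _ _ _] /a1[p0 qs] /a2[s0 qp]; split=> //; rewrite qp p0.
have caseB p q s x y z : admissible l p q s -> l1 = l2 -> l3 < l2 ->
    (normal_gradient x y z p q s <-> (y * z = 0 /\ z * x = 0) \/ x ^+ 2 + y ^+ 2 = z ^+ 2).
  by move=> [a1 _ _ a4 _] /a1[-> ->] /a4; exact: normal_gradient_z.
have caseC p q s x y z : admissible l p q s -> l2 < l1 -> l2 = l3 ->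
    (normal_gradient x y z p q s <-> (z * x = 0 /\ x * y = 0) \/ y ^+ 2 + z ^+ 2 = x ^+ 2).
  by move=> [_ a2 a3 _ _] lt21 /a2[-> ->]; exact: normal_gradient_x (a3 lt21).
have caseD p q s x y z : admissible l p q s -> l2 < l1 -> l3 < l2 ->
    (normal_gradient x y z p q s <-> [\/ [/\ y * z = 0, z * x = 0 & x * y = 0],
    (x = 0 /\ y ^+ 2 = z ^+ 2), (y = 0 /\ x ^+ 2 = z ^+ 2) | (z = 0 /\ x ^+ 2 = y ^+ 2)]).
  by move=> [_ _ a3 a4 a5] u v; exact: normal_gradient_distinct (a3 u) (a4 v) (a5 u v).
split.
- move=> e12 e23 x y z xyz1; apply/bvP => //.
  by have [-> -> ->] := caseA _ _ _ adv e12 e23; exact: normal_gradient0.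
- move=> e12 lt32 x y z xyz1; rewrite /nonharmonic_biharmonic_unit_section.
  rewrite bvP// (caseB _ _ _ _ _ _ adv e12 lt32) hP// -(circle_half xyz1).
  (* The condition on x y holds by the equality of the first two constants; harmonicity is left with
     the other two. *)
  suff -> : [/\ l 1 = l 2 \/ y * z = 0, l 0 = l 2 \/ z * x = 0 & l 0 = l 1 \/ x * y = 0] <->
    y * z = 0 /\ z * x = 0 by [].
  have n12 : l2 <> l3 by apply/eqP; rewrite gt_eqF.
  have n02 : l1 <> l3 by rewrite e12.
  by split=> [[[/n12//|?] [/n02//|?] _]|[? ?]]; split; [..|right|right|left].
- move=> lt21 e23 x y z xyz1; rewrite /nonharmonic_biharmonic_unit_section.
  (* The axis is now that of x, so [circle_half] is used with the coordinates permuted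
     cyclically. *)
  have yzx1 : y ^+ 2 + z ^+ 2 + x ^+ 2 = 1 by rewrite -xyz1; ring.
  rewrite bvP// (caseC _ _ _ _ _ _ adv lt21 e23) hP// -(circle_half yzx1).
  suff -> : [/\ l 1 = l 2 \/ y * z = 0, l 0 = l 2 \/ z * x = 0 & l 0 = l 1 \/ x * y = 0] <->
    z * x = 0 /\ x * y = 0 by [].
  have n01 : l1 <> l2 by apply/eqP; rewrite gt_eqF.
  have n02 : l1 <> l3 by rewrite -e23.
  by split=> [[_ [/n02//|?] [/n01//|?]]|[? ?]]; split; [..|left|right|right].
- move=> lt21 lt32 x y z xyz1; rewrite /nonharmonic_biharmonic_unit_section.
  rewrite bvP// (caseD _ _ _ _ _ _ adv lt21 lt32) hP// -(half_points xyz1).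
  suff -> : [/\ l 1 = l 2 \/ y * z = 0, l 0 = l 2 \/ z * x = 0 & l 0 = l 1 \/ x * y = 0] <->
    [/\ y * z = 0, z * x = 0 & x * y = 0] by [].
  have n01 : l1 <> l2 by apply/eqP; rewrite gt_eqF.
  have n12 : l2 <> l3 by apply/eqP; rewrite gt_eqF.
  have n02 : l1 <> l3 by apply/eqP; rewrite gt_eqF// (lt_trans lt32).
  by split=> [[[/n12//|?] [/n02//|?] [/n01//|?]]|[? ? ?]]; split=> //; right.
- move=> x y z xyz1; rewrite bvP// bfP//.
  (* In each case the criterion no longer mentions the coefficients, so both energies lead to the
     same equations in x, y, z. *)
  have [e12|n12] := eqVneq l1 l2.
    have [e23|n23] := eqVneq l2 l3.
      have [-> -> ->] := caseA _ _ _ adv e12 e23.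
      by have [-> -> ->] := caseA _ _ _ adb e12 e23.
    have lt32 : l3 < l2 by rewrite lt_neqAle eq_sym n23.
    by rewrite (caseB _ _ _ _ _ _ adv e12 lt32) (caseB _ _ _ _ _ _ adb e12 lt32).
  have lt21 : l2 < l1 by rewrite lt_neqAle eq_sym n12.
  have [e23|n23] := eqVneq l2 l3.
    by rewrite (caseC _ _ _ _ _ _ adv lt21 e23) (caseC _ _ _ _ _ _ adb lt21 e23).
  have lt32 : l3 < l2 by rewrite lt_neqAle eq_sym n23.
  by rewrite (caseD _ _ _ _ _ _ adv lt21 lt32) (caseD _ _ _ _ _ _ adb lt21 lt32).
Qed.
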